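(* Let $u_0\in L^1(\mathbb{R})$ be non-negative and compactly supported, and let $u(t)$ be the solution to the Cauchy problem in $\mathbb{R}$ for the Total Variation Flow starting from $u_0$. Let $T=T(u_0)$ be the extinction time of $u$. Then $$T(u_0)=\frac12\int_{\mathbb{R}}u_0(x)\,dx,$$ and $$\int_{\mathbb{R}}u(t,x)\,dx=\int_{\mathbb{R}}u_0(x)\,dx-2t=2(T-t)\qquad\text{for all }0\le t\le T.$$
   Context: $BV(\mathbb{R})$ is the set of $f\in L^1_{loc}(\mathbb{R})$ whose distributional derivative $Df$ is a signed measure of finite total variation. Strong solution of the Total Variation Flow (TVF) $\partial_t u=\partial_x(Du/|Du|)$ on $\mathbb{R}$ with initial datum $u_0$: a function $u\in L^\infty([0,\infty),BV(\mathbb{R}))\cap W^{1,2}_{loc}([0,\infty),L^2(\mathbb{R}))$ with $u(0,\cdot)=u_0$ for which there exists a measurable $z$ on $(0,\infty)\times\mathbb{R}$ with $\|z\|_\infty\le 1$, $\partial_x z\in L^2_{loc}([0,\infty),L^2(\mathbb{R}))$ (so that $z(t,\cdot)$ is taken to be continuous for a.e. $t$), such that $\partial_t u=\partial_x z$ on $(0,\infty)\times\mathbb{R}$ and, for all $\tau>0$, $\int_0^\tau\int_{\mathbb{R}} z(t,x)\,Du(t,dx)\,dt=\int_0^\tau |Du(t,\cdot)|(\mathbb{R})\,dt$. The TVF is contractive in $L^1$ (if $u,v$ are the strong solutions starting from $u_0,v_0\in BV(\mathbb{R})\cap L^1(\mathbb{R})$, then $\|u(t)-v(t)\|_{1}\le\|u_0-v_0\|_{1}$).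 For a general $u_0\in L^1(\mathbb{R})$ the solution $u(t)$ is defined by the unique continuous extension of this semigroup to $L^1(\mathbb{R})$. The extinction time is $T(u_0):=\inf\{t\ge 0:\ u(t,\cdot)= 0 \text{ a.e.}\}$. *)

(* Defs.v *)
From HB Require Import structures.
From mathcomp Require Import all_boot all_order all_algebra.
From mathcomp Require Import all_classical all_reals all_analysis.

Set Implicit Arguments.
Unset Strict Implicit.
Unset Printing Implicit Defensive.

Import Order.TTheory GRing.Theory Num.Theory.
Import numFieldNormedType.Exports.

Local Open Scope classical_set_scope.
Local Open Scope ring_scope.

(* Conventions.  Functions of time and space are curried, [u t x].  Elements
   of L^1(R) and L^2(R) are represented by Borel functions, and equality of
   such elements is equality almost everywhere. *)

Notation leb R := (@lebesgue_measure R).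
Notation leb2 R := ((@lebesgue_measure R \x @lebesgue_measure R)%E).
Notation realCharge R := (charge (measurableTypeR R) R).

Definition L1norm (R : realType) (f : R -> R) : \bar R :=
  ('N[leb R]_1 [EFin \o f])%E.

Definition L2norm (R : realType) (f : R -> R) : \bar R :=
  ('N[leb R]_2%:E [EFin \o f])%E.

Definition inL1 (R : realType) (f : R -> R) : Prop := f \in Lfun (leb R) 1%E.

Definition inL2 (R : realType) (f : R -> R) : Prop := f \in Lfun (leb R) 2%:E.

Definition compactly_supported (R : realType) (f : R -> R) : Prop :=
  exists2 K : set R, compact K & {ae leb R, forall x, ~ K x -> f x = 0}.

Definition test_function (R : realType) (phi : R -> R) : Prop :=
  (forall n x, derivable (derive1n n phi) x 1) /\
  (exists2 K : set R, compact K & forall x, ~ K x -> phi x = 0).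

Definition d_t (R : realType) (f : R -> R -> R) : R -> R -> R :=
  fun t x => derive1 (fun s => f s x) t.

Definition d_x (R : realType) (f : R -> R -> R) : R -> R -> R :=
  fun t x => derive1 (f t) x.

(* The word [w] prescribes in which order the partial derivatives are taken. *)
Definition iter_partial (R : realType) (w : seq bool) (f : R -> R -> R) :
    R -> R -> R :=
  foldr (fun b g => if b then d_t g else d_x g) f w.

Definition smooth2 (R : realType) (f : R -> R -> R) : Prop :=
  forall w : seq bool,
    [/\ forall t x, derivable (fun s => iter_partial w f s x) t 1,
        forall t x, derivable (iter_partial w f t) x 1 &
        continuous (fun p : R * R => iter_partial w f p.1 p.2)].

Definition open_half_plane (R : realType) : set (R * R) := `]0, +oo[ `*` setT.

Definition closed_half_plane (R : realType) : set (R * R) := `[0, +oo[ `*` setT.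

(* The support is a compact subset of the open half plane (0, oo) x R. *)
Definition test_function2 (R : realType) (phi : R -> R -> R) : Prop :=
  smooth2 phi /\
  exists K : set (R * R), [/\ compact K, K `<=` @open_half_plane R &
    forall p, ~ K p -> phi p.1 p.2 = 0].

Lemma hahn_exists (R : realType) (D : realCharge R) :
  exists PN : set R * set R, hahn_decomposition D PN.1 PN.2.
Proof. by have [P [N PN]] := Hahn_decomposition D; exists (P, N). Qed.

(* The Jordan decomposition does not depend on the chosen Hahn decomposition. *)
Definition hahn (R : realType) (D : realCharge R) := svalP (cid (hahn_exists D)).

Definition charge_total_variation (R : realType) (D : realCharge R) : \bar R :=
  charge_variation (hahn D) setT.

Definition charge_integral (R : realType) (D : realCharge R) (f : R -> R) :
    \bar R :=
  (\int[jordan_pos (hahn D)]_x (f x)%:E -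
   \int[jordan_neg (hahn D)]_x (f x)%:E)%E.

Definition distributional_derivative (R : realType) (f : R -> R)
    (D : realCharge R) : Prop :=
  forall phi, test_function phi ->
    (\int[leb R]_x (f x * derive1 phi x)%:E = - charge_integral D phi)%E.

(* [D] is the measure derivative of the function [f] of BV(R); a charge is
   finite valued, so its total variation is finite. *)
Definition BV_derivative (R : realType) (f : R -> R) (D : realCharge R) : Prop :=
  locally_integrable setT f /\ distributional_derivative f D.

Definition inBV (R : realType) (f : R -> R) : Prop :=
  exists D : realCharge R, BV_derivative f D.

Definition L2loc_L2 (R : realType) (g : R -> R -> R) : Prop :=
  measurable_fun (@closed_half_plane R) (fun p => g p.1 p.2) /\
  forall tau : R, 0 < tau ->
    (\int[leb R]_(t in `[0%R, tau]) \int[leb R]_x (g t x ^+ 2)%:E < +oo)%E.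

Definition weak_d_t (R : realType) (u g : R -> R -> R) : Prop :=
  forall phi, test_function2 phi ->
    (\int[leb2 R]_(p in @open_half_plane R) (u p.1 p.2 * d_t phi p.1 p.2)%:E =
     - \int[leb2 R]_(p in @open_half_plane R) (g p.1 p.2 * phi p.1 p.2)%:E)%E.

Definition weak_d_x (R : realType) (z g : R -> R -> R) : Prop :=
  forall phi, test_function2 phi ->
    (\int[leb2 R]_(p in @open_half_plane R) (z p.1 p.2 * d_x phi p.1 p.2)%:E =
     - \int[leb2 R]_(p in @open_half_plane R) (g p.1 p.2 * phi p.1 p.2)%:E)%E.

Definition L2_continuous (R : realType) (u : R -> R -> R) : Prop :=
  (forall t, 0 <= t -> inL2 (u t)) /\
  forall t, 0 <= t -> forall e : R, 0 < e -> exists2 d : R, 0 < d &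
    forall s, 0 <= s -> `|s - t| < d -> (L2norm (u s \- u t)%R < e%:E)%E.

(* [u] is in W^{1,2}_loc([0, oo), L^2(R)) with time derivative [g]; as usual [u]
   is the representative which is continuous in time with values in L^2(R), so
   that every [u t] (and in particular [u 0]) is meaningful. *)
Definition W12loc_L2 (R : realType) (u g : R -> R -> R) : Prop :=
  [/\ L2loc_L2 u, L2loc_L2 g, weak_d_t u g & L2_continuous u].

(* [u] is in L^oo([0, oo), BV(R)), the derivative of [u t] being [Du t]. *)
Definition Linfty_BV (R : realType) (u : R -> R -> R) (Du : R -> realCharge R) :
    Prop :=
  {ae leb R, forall t, 0 <= t -> BV_derivative (u t) (Du t)} /\
  exists M : R,
    {ae leb R, forall t, 0 <= t -> (charge_total_variation (Du t) <= M%:E)%E}.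

(* [g] is the common value of the time derivative of [u] and of the space
   derivative of [z]. *)
Definition tvf_strong_solution (R : realType) (u0 : R -> R) (u : R -> R -> R) :
    Prop :=
  {ae leb R, forall x, u 0 x = u0 x} /\
  exists (Du : R -> realCharge R) (z g : R -> R -> R),
    [/\ Linfty_BV u Du,
        W12loc_L2 u g,
        [/\ measurable_fun (@open_half_plane R) (fun p => z p.1 p.2),
            {ae leb2 R, forall p, 0 < p.1 -> `|z p.1 p.2| <= 1} &
            {ae leb R, forall t, 0 < t -> continuous (z t)}],
        weak_d_x z g &
        forall tau : R, 0 < tau ->
          (\int[leb R]_(t in `]0%R, tau[) charge_integral (Du t) (z t) =
           \int[leb R]_(t in `]0%R, tau[) charge_total_variation (Du t))%E].

(* [S t f] is the value at time [t] of the solution starting from [f]: the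
   continuous extension to L^1(R), for each [t], of the map sending a datum in
   BV(R) and L^1(R) to the value at time [t] of its strong solution.  Continuity
   makes [S t] compatible with almost everywhere equality. *)
Definition tvf_semigroup (R : realType) (S : R -> (R -> R) -> (R -> R)) : Prop :=
  [/\ forall t f, 0 <= t -> inL1 f -> inL1 (S t f),
      forall t f, 0 <= t -> inL1 f -> forall e : R, 0 < e ->
        exists2 d : R, 0 < d & forall g, inL1 g ->
          (L1norm (g \- f)%R < d%:E)%E -> (L1norm (S t g \- S t f)%R < e%:E)%E &
      forall f, inBV f -> inL1 f -> exists2 u, tvf_strong_solution f u &
        forall t, 0 <= t -> {ae leb R, forall x, S t f x = u t x}].

Definition tvf_solution (R : realType) (u0 : R -> R) (u : R -> R -> R) : Prop :=
  exists2 S, tvf_semigroup S &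
    forall t, 0 <= t ->
      inL1 (u t) /\ {ae leb R, forall x, u t x = S t u0 x}.

(* The infimum is taken in the extended reals: it is +oo if [u] never vanishes. *)
Definition extinction_time (R : realType) (u : R -> R -> R) : \bar R :=
  ereal_inf [set t%:E | t in
    [set t : R | 0 <= t /\ {ae leb R, forall x, u t x = 0}]].

(* Main.v *)
Require Import Defs.
From mathcomp Require Import all_boot all_order all_algebra.
From mathcomp Require Import all_classical all_reals all_analysis.
From mathcomp Require Import measurable_realfun.
From mathcomp Require Import ring lra.

Import Order.TTheory GRing.Theory Num.Theory.
Import numFieldNormedType.Exports.

(** While a solution is not zero its mass decreases at speed exactly 2, because
    a flux that realises the total variation of a non-negative integrable
    profile takes the values 1 and - 1 on the two sides of the profile. For a
    strong solution [u] with flux [z] and g = u_t = z_x, this rests on two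
    inequalities.

    Since |z| <= 1, the integral of [g] over any interval is at least - 2, so
    that in time t a mass of at most 2 t is lost ([flux_mass_lower]).

    In the other direction, the integral of [z] against the measure Du is
    - int u g, and that it equals the total variation implies that at almost
    every time - int u g is at least every difference quotient
    (1 / h) int |u (x + h) - u x| dx ([charge_integral_flux], [ae_steepest]).
    Difference quotients are used in place of the total variation because they
    are measurable in time and because they split exactly: if [beta] is
    nondecreasing and 1-Lipschitz with beta 0 = 0, the quotient of [u] is the
    sum of those of beta u and of u - beta u. The duality with the flux bounds
    the latter from below by a quantity that tends to - int (u - beta u) g. What
    is left is that - int beta(u) g is at least the total variation of beta u,
    which is non-negative and at least twice the essential supremum of beta u
    ([steepest_descent], [steepest_descent_ge0], [steepest_descent_ge]).

    If Psi is a primitive of [beta], then int Psi(u) has a time derivative of at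
    most int beta(u) g. This is proved on the path of almost every point x,
    where u (t, x) = u (0, x) + int_0^t g (r, x) dr ([evolve_ae],
    [chain_rule_le], [energy_le]). Three choices of [beta] are used. The
    negative part shows that u >= 0 ([strong_ge0]). The identity shows that the
    norm in L^2 does not increase; hence, if u is not zero at time t, then it
    exceeds a fixed level at all times before t. The minimum with a small level
    eps then loses the energy 2 eps t up to time t, and its energy divided by
    eps tends to the mass as eps tends to 0: the mass at time t is at most the
    initial mass minus 2 t ([strong_mass_upper]). Together with the first bound,
    the mass at time t is max (int u_0 - 2 t, 0) ([strong_solution_mass]).

    For a general datum, the averages (1 / h) int_x^(x+h) u_0 are in BV(R), are
    non-negative and have the mass of u_0. They converge to u_0 almost
    everywhere, and also in L^1 because the mass is constant ([average_inBV],
    [average_cvg]). By the continuity of the semigroup the formula for the mass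
    passes to the limit ([semigroup_mass]), and the extinction time is the first
    zero of max (int u_0 - 2 t, 0). *)

Set Implicit Arguments.
Unset Strict Implicit.
Unset Printing Implicit Defensive.

Local Open Scope classical_set_scope.
Local Open Scope ring_scope.

(** * Smooth functions and a smooth step *)

(** A variant rather than a definition, so that tactics do not unfold it to
    a statement about derivatives of all orders. *)
Variant smooth (R : realType) (f : R -> R) : Prop :=
  Smooth of forall n x, derivable (derive1n n f) x 1.

Lemma smoothP (R : realType) (f : R -> R) :
  smooth f -> forall n x, derivable (derive1n n f) x 1.
Proof. by case. Qed.
Arguments smoothP {R f} _ n x.

(** Functions of a class that is stable under derivation are smooth: no
    formula for the higher derivatives is needed. *)
Lemma smooth_class (R : realType) (P : (R -> R) -> Prop) (f : R -> R) :
  (forall F, P F -> exists2 G, P G & forall x, is_derive x (1 : R) F (G x)) ->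
  P f -> smooth f.
Proof.
move=> Pd Pf; split=> n; suff : P (derive1n n f).
  by move=> /Pd[G _ FG] x; apply: ex_derive.
elim: n => [//|n /Pd[G PG FG]].
rewrite derive1nS (_ : derive1 _ = G) //; apply/funext => x.
by rewrite derive1E; apply: derive_val.
Qed.

Lemma smooth_derive1 (R : realType) (f : R -> R) :
  smooth f -> smooth (derive1 f).
Proof.
by case=> sf; split=> n x; rewrite /derive1n -iterSr; exact: sf n.+1 x.
Qed.

Lemma smooth_is_derive (R : realType) (f : R -> R) x :
  smooth f -> is_derive x (1 : R) f (derive1 f x).
Proof. by case=> sf; rewrite derive1E; apply: derivableP; exact: sf 0%N x. Qed.

Section smooth_algebra.
Variable R : realType.
Implicit Types f g : R -> R.

(** Stable under derivation, since the derivative of 1 / f is - f' / f ^ 2. *)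
Inductive smooth_span : (R -> R) -> Prop :=
| span_base f : smooth f -> smooth_span f
| span_add f g : smooth_span f -> smooth_span g ->
    smooth_span (fun x => f x + g x)
| span_mul f g : smooth_span f -> smooth_span g ->
    smooth_span (fun x => f x * g x)
| span_inv f : smooth_span f -> (forall x, f x != 0) ->
    smooth_span (fun x => (f x)^-1).

Lemma smooth_cst (c : R) : smooth (fun=> c).
Proof.
apply: (@smooth_class _ (fun f => exists c, f = fun=> c)); last by exists c.
move=> _ [k ->]; exists (fun=> 0); first by exists 0.
by move=> x; exact: is_derive_cst.
Qed.

Lemma smooth_span_smooth f : smooth_span f -> smooth f.
Proof.
apply: smooth_class => F; elim => {F}.
- move=> F sF; exists (derive1 F); last by move=> x; exact: smooth_is_derive.
  by apply: span_base; exact: smooth_derive1.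
- move=> F G _ [F' sF' dF] _ [G' sG' dG].
  exists (fun x => F' x + G' x); first exact: span_add.
  by move=> x; exact: is_deriveD.
- move=> F G sF [F' sF' dF] sG [G' sG' dG].
  exists (fun x => F x * G' x + G x * F' x).
    by apply: span_add; apply: span_mul.
  by move=> x; exact: is_deriveM.
- move=> F sF [F' sF' dF] F0.
  exists (fun x => -1 * ((F x)^-1 * (F x)^-1) * F' x).
    apply: span_mul => //; apply: span_mul.
      exact/span_base/smooth_cst.
    by apply: span_mul; apply: span_inv.
  move=> x.
  have := @is_deriveV _ F x (F' x) 1 (F0 x) (dF x).
  move/is_derive_eq; apply.
  by rewrite /GRing.scale /= mulN1r expr2 invfM.
Qed.

Lemma smoothD f g : smooth f -> smooth g -> smooth (fun x => f x + g x).
Proof. by move=> *; apply/smooth_span_smooth/span_add; exact: span_base. Qed.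

Lemma smoothM f g : smooth f -> smooth g -> smooth (fun x => f x * g x).
Proof. by move=> *; apply/smooth_span_smooth/span_mul; exact: span_base. Qed.

Lemma smoothV f : smooth f -> (forall x, f x != 0) -> smooth (fun x => (f x)^-1).
Proof. by move=> *; apply/smooth_span_smooth/span_inv => //; exact: span_base. Qed.

Lemma smoothB f g : smooth f -> smooth g -> smooth (fun x => f x - g x).
Proof.
move=> sf sg.
have h := smoothD sf (smoothM (smooth_cst (-1)) sg).
suff <- : (fun x => f x + -1 * g x) = (fun x => f x - g x) by exact: h.
by apply/funext => x; rewrite mulN1r.
Qed.

Lemma is_derive_affine (a b x : R) : is_derive x (1 : R) (fun y => a * y + b) a.
Proof.
have -> : (fun y => a * y + b) = (a \*: id) \+ cst b by [].
by apply: is_derive_eq; rewrite addr0 /GRing.scale/= mulr1.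
Qed.

Lemma smooth_affine f (a b : R) : smooth f -> smooth (fun x => f (a * x + b)).
Proof.
move=> sf.
apply: (@smooth_class _ (fun h => exists c g, smooth g /\
   h = fun x => c * g (a * x + b))); last first.
  by exists 1, f; split => //; apply/funext => x; rewrite mul1r.
move=> _ [c [g [sg ->]]].
exists (fun x => (c * a) * derive1 g (a * x + b)).
  exists (c * a), (derive1 g); split; last by [].
  exact: (smooth_derive1 sg).
move=> x.
have h1 := is_derive_affine a b x.
have h2 : is_derive (a * x + b) (1 : R) g (derive1 g (a * x + b)).
  exact: smooth_is_derive.
have := @is_derive1_comp _ g (fun y => a * y + b) x _ _ h2 h1.
move=> h3; have := @is_deriveZ _ _ _ _ c _ _ _ h3.
by move/is_derive_eq; apply; rewrite /GRing.scale /= mulrA mulrAC -mulrA mulrCA mulrA.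
Qed.

End smooth_algebra.

Section exp_bump.
Variable R : realType.

(** The derivatives of exp (- 1 / x) are combinations of these functions,
    which thus span a class stable under derivation. *)
Definition expinv (k : nat) (x : R) : R :=
  if 0 < x then x ^- k * expR (- x^-1) else 0.

Lemma expinv_ge0 k x : 0 <= expinv k x.
Proof.
rewrite /expinv; case: ltP => // x0.
by rewrite mulr_ge0 ?expR_ge0// invr_ge0 exprn_ge0// ltW.
Qed.

Lemma expinv_gt0 k x : 0 < x -> 0 < expinv k x.
Proof.
by rewrite /expinv => x0; rewrite x0 mulr_gt0 ?expR_gt0// invr_gt0 exprn_gt0.
Qed.

Lemma expinv_le0 k x : x <= 0 -> expinv k x = 0.
Proof. by rewrite /expinv; case: ltP. Qed.

(** The factor x ^ 2 yields a zero derivative at 0. The bound comes from the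
    term of order k + 2 of the exponential series at 1 / x. *)
Lemma expinv_bound k (x : R) : `|expinv k x| <= (k.+2)`!%:R * x ^+ 2.
Proof.
rewrite ger0_norm ?expinv_ge0//; rewrite /expinv; case: ltP => [x0|_]; last first.
  by rewrite mulr_ge0// sqr_ge0.
rewrite expRN ler_pdivrMr ?expR_gt0//.
have xV0 : 0 <= x^-1 by rewrite invr_ge0 ltW.
have := @expR_ge1Dxn R _ k.+1 xV0.
move=> h.
have h2 : (x^-1) ^+ k.+2 / (k.+2)`!%:R <= expR x^-1.
  by apply: le_trans h; rewrite lerDr.
apply: le_trans (ler_wpM2l _ h2); last by rewrite mulr_ge0// sqr_ge0.
rewrite mulrA mulrAC (mulrC _ (x ^+ 2)) mulfK; last by rewrite pnatr_eq0 -lt0n fact_gt0.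
rewrite exprVn -(addn2 k) exprD invfM mulrCA mulfV ?mulr1//.
by rewrite expf_neq0// gt_eqF.
Qed.

Lemma is_derive_expinv k x :
  is_derive x (1 : R) (expinv k) (- k%:R * expinv k.+1 x + expinv k.+2 x).
Proof.
have [x0|x0|->] := ltgtP x 0.
- apply: (@near_eq_is_derive _ _ _ (cst 0)).
  + near=> y; rewrite /expinv; case: ltP => // y0; exfalso.
    suff : y < 0 by rewrite ltNge (ltW y0).
    by near: y; exact: lt_nbhsl.
  + apply: is_derive_eq.
    by rewrite !expinv_le0 ?(ltW x0)// mulr0 addr0.
- apply: (@near_eq_is_derive _ _ _ (fun y : R => (y ^+ k)^-1 * expR (- y^-1))).
  + near=> y; rewrite /expinv; case: ltP => // y0; exfalso.
    suff : 0 < y by rewrite ltNge y0.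
    by near: y; exact: lt_nbhsr.
  + have xn0 : x != 0 by rewrite gt_eqF.
    have dV : is_derive x (1 : R) (fun y : R => y^-1) (- x ^- 2).
      have := @is_deriveV _ id x 1 1 xn0 (is_derive_id _ _).
      by move/is_derive_eq; apply; rewrite /GRing.scale/= mulr1.
    have dVk : is_derive x (1 : R) (fun y : R => (y ^+ k)^-1)
        (- k%:R * x ^- k.+1).
      have xk0 : x ^+ k != 0 by rewrite expf_neq0.
      have dX := @is_deriveX _ _ id k x 1 1 (is_derive_id _ _).
      rewrite (_ : id ^+ k = fun y : R => y ^+ k) in dX; last first.
        by apply/funext => y; rewrite exprfctE.
      have := @is_deriveV _ (fun y : R => y ^+ k) x _ 1 xk0 dX.
      move/is_derive_eq; apply; rewrite /GRing.scale /= mulr1.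
      case: k xk0 {dX} => [|k] xk0; first by rewrite mul0r !mulr0 oppr0 mul0r.
      rewrite !mulNr; congr (- _).
      rewrite mulrC -mulrA; congr (_ * _).
      rewrite [k.+1.-1]/= expr2 invfM mulrA [in X in _ * X / _ = _]exprS.
      rewrite !exprS !invfM; field.
      by rewrite xn0 /= expf_neq0.
    have dE : is_derive x (1 : R) (fun y : R => expR (- y^-1))
        (x ^- 2 * expR (- x^-1)).
      have h1 := @is_deriveN _ _ _ (fun y : R => y^-1) x 1 _ dV.
      have := @is_derive1_comp _ expR (fun y => - y^-1) x _ _ (is_derive_expR _) h1.
      by move/is_derive_eq; apply; rewrite opprK mulrC.
    have := @is_deriveM _ _ _ _ x 1 _ _ dVk dE.
    move/is_derive_eq; apply; rewrite /expinv x0 /GRing.scale /=.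
    have e2 : x ^- k.+2 = x ^- k * x ^- 2 by rewrite -invfM -exprD addn2.
    by rewrite e2 addrC; ring.
- rewrite !expinv_le0// mulr0 addr0.
  have e0 : expinv k 0 = 0 by rewrite expinv_le0.
  suff h : h^-1 *: (expinv k (h *: 1 + 0) - expinv k 0) @[h --> (0 : R)^'] --> (0 : R).
    split; first by apply/cvg_ex; exists 0.
    by apply/cvg_lim => //.
  apply/cvgr0Pnorm_le => e e0'.
  set C : R := (k.+2)`!%:R.
  have C0 : 0 < C by rewrite ltr0n fact_gt0.
  near=> h.
  have h0 : h != 0 by near: h; exact: nbhs_dnbhs_neq.
  rewrite e0 subr0 addr0 /GRing.scale/= mulr1 normrM normfV.
  rewrite ler_pdivrMl ?normr_gt0//.
  apply: le_trans (expinv_bound _ _) _.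
  rewrite -/C -real_normK ?num_real// expr2 mulrA mulrC ler_pM2l ?normr_gt0//.
  rewrite -ler_pdivlMl//.
  near: h; apply: dnbhs0_le => //.
  by rewrite mulr_gt0// invr_gt0.
Unshelve. all: by end_near.
Qed.

Inductive expinv_span : (R -> R) -> Prop :=
| expinv_base k : expinv_span (expinv k)
| expinv_comb a f g : expinv_span f -> expinv_span g ->
    expinv_span (fun x => a * f x + g x).

Lemma smooth_expinv k : smooth (expinv k).
Proof.
apply: (@smooth_class _ expinv_span); last exact: expinv_base.
move=> F; elim => {F} [n|a f g sf [f' sf' df] sg [g' sg' dg]].
  exists (fun x => - n%:R * expinv n.+1 x + expinv n.+2 x).
    by apply: expinv_comb; exact: expinv_base.
  exact: is_derive_expinv.
exists (fun x => a * f' x + g' x); first exact: expinv_comb.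
move=> x; have h := @is_deriveZ _ _ _ f a x 1 (f' x) (df x).
exact: (@is_deriveD _ _ _ _ g x 1 _ _ h (dg x)).
Qed.

Definition smooth_step (x : R) : R :=
  expinv 0 x / (expinv 0 x + expinv 0 (1 - x)).

Lemma smooth_step_den x : 0 < expinv 0 x + expinv 0 (1 - x).
Proof.
have [x0|x0] := leP x 0.
  by rewrite ltr_wpDl ?expinv_ge0// expinv_gt0// subr_gt0 (le_lt_trans x0).
by rewrite ltr_pwDl ?expinv_ge0// expinv_gt0.
Qed.

Lemma smooth_smooth_step : smooth smooth_step.
Proof.
have s1 := smooth_expinv 0.
have s2 : smooth (fun x => expinv 0 (1 - x)).
  have := smooth_affine (-1) 1 s1.
  by congr smooth; apply/funext => x; rewrite mulN1r addrC.
apply: smoothM => //; apply: smoothV; first exact: smoothD.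
by move=> x; rewrite gt_eqF// smooth_step_den.
Qed.

Lemma smooth_step_le0 x : x <= 0 -> smooth_step x = 0.
Proof. by move=> x0; rewrite /smooth_step expinv_le0// mul0r. Qed.

Lemma smooth_step_ge1 x : 1 <= x -> smooth_step x = 1.
Proof.
move=> x1; rewrite /smooth_step (@expinv_le0 _ (1 - x)) ?subr_le0// addr0 divff//.
by rewrite gt_eqF// expinv_gt0// (lt_le_trans _ x1).
Qed.

Lemma smooth_step_ge0 x : 0 <= smooth_step x.
Proof. by rewrite divr_ge0 ?expinv_ge0// ltW// smooth_step_den. Qed.

Lemma smooth_step_le1 x : smooth_step x <= 1.
Proof.
by rewrite ler_pdivrMr ?smooth_step_den// mul1r lerDl expinv_ge0.
Qed.

End exp_bump.

(** * Integrals of real functions *)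

Lemma normrM_le_sqD (R : realDomainType) (a b : R) : `|a * b| <= a ^+ 2 + b ^+ 2.
Proof.
rewrite normrM -(real_normK (num_real a)) -(real_normK (num_real b)).
have := sqr_ge0 (`|a| - `|b|); have := mulr_ge0 (normr_ge0 a) (normr_ge0 b).
by rewrite sqrrB; move: `|a| `|b| => x y; lra.
Qed.

Lemma normr_le_sqD1 (R : realDomainType) (a : R) : `|a| <= a ^+ 2 + 1.
Proof. by have := normrM_le_sqD a 1; rewrite mulr1 expr1n. Qed.

Section integrable_tools.
Context d (T : measurableType d) (R : realType) (mu : {measure set T -> \bar R}).
Implicit Types (D : set T) (f g : T -> R).

Local Notation intble D f := (mu.-integrable D (EFin \o f)).

Lemma intble_meas D f : intble D f -> measurable_fun D f.
Proof. by move=> /measurable_int/measurable_EFinP. Qed.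

Lemma intbleD D f g : measurable D -> intble D f -> intble D g ->
  intble D (fun x => f x + g x).
Proof. by move=> mD; exact: integrableD. Qed.

Lemma intbleB D f g : measurable D -> intble D f -> intble D g ->
  intble D (fun x => f x - g x).
Proof. by move=> mD; exact: integrableB. Qed.

Lemma intbleZ D f (k : R) : measurable D -> intble D f ->
  intble D (fun x => k * f x).
Proof. by move=> mD; exact: integrableZl. Qed.

Lemma intble_norm D f : intble D f -> intble D (fun x => `|f x|).
Proof. exact: integrable_norm. Qed.

Lemma intbleN D f : measurable D -> intble D f -> intble D (fun x => - f x).
Proof. by move=> mD; exact: integrableN. Qed.

Lemma intble_le D f g : measurable D -> measurable_fun D f -> intble D g ->
  (forall x, D x -> `|f x| <= g x) -> intble D f.
Proof.
move=> mD mf ig fg; apply: (le_integrable mD) ig; first exact/measurable_EFinP.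
move=> x Dx; rewrite lee_fin (le_trans (fg x Dx))//.
by rewrite ler_norm.
Qed.

Lemma intble_bounded_mul D f g (C : R) : measurable D -> measurable_fun D f ->
  (forall x, D x -> `|f x| <= C) -> intble D g -> intble D (fun x => f x * g x).
Proof.
move=> mD mf fC ig.
apply: (@intble_le _ _ (fun x => C * `|g x|)) => //.
- by apply: measurable_funM => //; exact: intble_meas.
- by apply: intbleZ => //; exact: intble_norm.
- by move=> x Dx; rewrite normrM ler_wpM2r// fC.
Qed.

Lemma intble_mul2 D f g : measurable D ->
  measurable_fun D f -> measurable_fun D g ->
  intble D (fun x => f x ^+ 2) -> intble D (fun x => g x ^+ 2) ->
  intble D (fun x => f x * g x).
Proof.
move=> mD mf mg f2 g2.
apply: (@intble_le _ _ (fun x => f x ^+ 2 + g x ^+ 2)) => //.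
- exact: measurable_funM.
- exact: intbleD.
- by move=> x _; exact: normrM_le_sqD.
Qed.

Lemma intble_lty D f : measurable D -> measurable_fun D f ->
  (\int[mu]_(x in D) (`|f x|)%:E < +oo)%E -> intble D f.
Proof. by move=> mD mf h; apply/integrableP; split => //; exact/measurable_EFinP. Qed.

Lemma intble_ge0_lty D f : measurable D -> measurable_fun D f ->
  (forall x, D x -> 0 <= f x) ->
  (\int[mu]_(x in D) (f x)%:E < +oo)%E -> intble D f.
Proof.
move=> mD mf f0 h; apply: intble_lty => //.
rewrite (eq_integral (fun x => (f x)%:E))// => x /set_mem Dx.
by rewrite ger0_norm// f0.
Qed.

Lemma EFin_Rintegral D f : measurable D -> intble D f ->
  (\int[mu]_(x in D) f x)%:E = (\int[mu]_(x in D) (f x)%:E)%E.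
Proof. by move=> mD fi; rewrite /Rintegral fineK// integrable_fin_num. Qed.

Lemma ae_eq_Rintegral D f g : measurable D ->
  measurable_fun D f -> measurable_fun D g ->
  {ae mu, forall x, D x -> f x = g x} ->
  \int[mu]_(x in D) f x = \int[mu]_(x in D) g x.
Proof.
move=> mD mf mg fg; congr fine; apply: ae_eq_integral => //;
  try exact/measurable_EFinP.
by apply: filterS fg => x fg Dx; rewrite fg.
Qed.

Lemma ae_le_Rintegral D f g : measurable D -> intble D f -> intble D g ->
  {ae mu, forall x, D x -> f x <= g x} ->
  \int[mu]_(x in D) f x <= \int[mu]_(x in D) g x.
Proof.
move=> mD fi gi fg.
have mf := intble_meas fi; have mg := intble_meas gi.
rewrite (_ : \int[mu]_(x in D) g x = \int[mu]_(x in D) Num.max (f x) (g x)).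
  apply: le_Rintegral => //; last by move=> x _; rewrite le_max lexx.
  apply: (@intble_le _ _ (fun x => `|f x| + `|g x|)) => //.
  - exact: measurable_maxr.
  - by apply: intbleD => //; exact: intble_norm.
  - by move=> x _; case: (leP (f x) (g x)) => _; rewrite ?lerDr ?lerDl.
apply: ae_eq_Rintegral => //; first exact: measurable_maxr.
by apply: filterS fg => x fg Dx; rewrite max_r// fg.
Qed.

Lemma Rintegral_dominated D (f_ : nat -> T -> R) f g : measurable D ->
  (forall n, measurable_fun D (f_ n)) -> measurable_fun D f ->
  {ae mu, forall x, D x -> f_ n x @[n --> \oo] --> f x} ->
  intble D g ->
  (forall n x, D x -> `|f_ n x| <= g x) ->
  \int[mu]_(x in D) f_ n x @[n --> \oo] --> \int[mu]_(x in D) f x.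
Proof.
move=> mD mf_ mf cf ig fg.
have [] := @dominated_convergence _ _ _ mu D mD (fun n => EFin \o f_ n) (EFin \o f)
   (EFin \o g).
- by move=> n; exact/measurable_EFinP.
- exact/measurable_EFinP.
- apply: filterS cf => x cf Dx; apply: cvg_EFin; last exact: cf.
  exact: nearW.
- exact: ig.
- by apply: aeW => x n Dx; rewrite lee_fin fg.
move=> fi _ cv; apply: fine_cvg.
by rewrite EFin_Rintegral.
Qed.

Lemma ae_imp (P Q : T -> Prop) : (forall x, P x -> Q x) ->
  {ae mu, forall x, P x} -> {ae mu, forall x, Q x}.
Proof. by move=> PQ; exact: filterS. Qed.

Lemma ae_and (P Q : T -> Prop) : {ae mu, forall x, P x} ->
  {ae mu, forall x, Q x} -> {ae mu, forall x, P x /\ Q x}.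
Proof. by move=> aP aQ; apply: filterS2 aP aQ => x; split. Qed.

Lemma ae_all_nat (P : nat -> T -> Prop) :
  (forall n, {ae mu, forall x, P n x}) -> {ae mu, forall x, forall n, P n x}.
Proof.
move=> aP; have h : mu.-negligible (\bigcup_n ~` [set x | P n x]).
  by apply: negligible_bigcup => n; exact: aP.
apply: negligibleS h => x /=.
by move/existsNP => [n Pn]; exists n.
Qed.

End integrable_tools.

Section lebesgue_shift.
Context {R : realType}.
Local Notation mu := (@lebesgue_measure R).
Local Notation intble D f := (mu.-integrable D (EFin \o f)).
Implicit Types (f : R -> R) (h : R).

Lemma measurable_shift h :
  measurable_fun [set: measurableTypeR R] (fun x : R => x + h : measurableTypeR R).
Proof. exact: measurable_funD. Qed.

Lemma lebesgue_measure_shift h (A : set R) : measurable A ->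
  pushforward mu (fun x : R => x + h : measurableTypeR R) A = mu A.
Proof.
have mh := measurable_shift h.
move=> mA; apply/esym/lebesgue_measure_unique => //= _ [[a b]] _ <-.
rewrite /pushforward.
rewrite (_ : _ @^-1` _ = `]a - h, b - h]%classic); last first.
  by apply/seteqP; split => x /=; rewrite !in_itv/= ltrBlDr lerBrDr.
rewrite !lebesgue_measure_itv/= !lte_fin ltrD2r -!EFinB.
by case: ifP => // _; congr EFin; ring.
Qed.

Lemma ge0_integral_shift h (f : R -> \bar R) : measurable_fun setT f ->
  (forall x, 0 <= f x)%E -> (\int[mu]_x f (x + h)%R = \int[mu]_x f x)%E.
Proof.
move=> mf f0.
have mh := measurable_shift h.
rewrite [RHS](@eq_measure_integral _ _ _ _ (pushforward mu (fun x : R => x + h : measurableTypeR R))); last first.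
  by move=> A mA _; exact/esym/lebesgue_measure_shift.
by rewrite ge0_integral_pushforward.
Qed.

Lemma intble_shift h f : intble setT f -> intble setT (fun x => f (x + h)).
Proof.
move=> fi; have mf := intble_meas fi.
apply: intble_lty => //.
  by apply: (measurableT_comp mf); exact: measurable_shift.
rewrite (ge0_integral_shift h (f := fun x => `|f x|%:E))//.
  by case/integrableP : fi.
by apply/measurable_EFinP; exact: measurableT_comp.
Qed.

Lemma Rintegral_shift h f : intble setT f ->
  \int[mu]_x f (x + h) = \int[mu]_x f x.
Proof.
move=> fi; have mf := intble_meas fi; have mh := measurable_shift h.
congr fine.
rewrite [RHS](@eq_measure_integral _ _ _ _ (pushforward mu (fun x : R => x + h : measurableTypeR R))); last first.
  by move=> A mA _; exact/esym/lebesgue_measure_shift.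
rewrite integral_pushforward//; first exact/measurable_EFinP.
exact: intble_shift.
Qed.

End lebesgue_shift.

(** * Lebesgue points *)

Section lebesgue_points.
Context {R : realType}.
Local Notation mu := (@lebesgue_measure R).
Local Notation intble D f := (mu.-integrable D (EFin \o f)).
Implicit Types (f v : R -> R).

Lemma Rintegral_supp (A : set (measurableTypeR R)) f : (forall x, ~ A x -> f x = 0) ->
  \int[mu]_(x in A) f x = \int[mu]_x f x.
Proof.
move=> f0; rewrite Rintegral_mkcond; apply: eq_Rintegral => x _.
by rewrite patchE; case: ifPn => // /negP; rewrite inE => /f0.
Qed.

Lemma intble_supp (A : set (measurableTypeR R)) f : measurable A -> (forall x, ~ A x -> f x = 0) ->
  intble A f -> intble setT f.
Proof.
move=> mA f0 fi; have := (integrable_mkcond (EFin \o f : measurableTypeR R -> \bar R) mA).1 fi.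
apply: eq_integrable => // x _; rewrite patchE; case: ifPn => // /negP.
by rewrite inE => /f0/= ->.
Qed.

Lemma intble_itv (A : set (measurableTypeR R)) f a b : measurable A ->
  locally_integrable setT f -> A `<=` `[a, b] -> intble A f.
Proof.
move=> mA [mf _ fK] AB; apply: intble_lty => //; first exact: measurable_funTS.
have := fK _ (@subsetT _ `[a, b]) (@segment_compact R a b).
apply: le_lt_trans; apply: ge0_subset_integral => //.
by apply/measurable_EFinP; apply: measurableT_comp => //; exact: measurable_funTS.
Qed.

Lemma intble_locally f : intble setT f -> locally_integrable setT f.
Proof. by move=> fi; apply: open_integrable_locally => //; exact: openT. Qed.

Lemma fine_lebesgue_itv (a b : R) : a <= b ->
  fine (mu `]a, b]) = b - a.
Proof.
rewrite lebesgue_measure_itv/= lte_fin le_eqVlt => /predU1P[->|->//].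
by rewrite ltxx subrr.
Qed.

Lemma invn_gt0 n : 0 < n.+1%:R^-1 :> R.
Proof. by rewrite invr_gt0 ltr0n. Qed.

Lemma lebesgue_pt_right v x : locally_integrable setT v -> lebesgue_pt v x ->
  n.+1%:R * \int[mu]_(y in `]x, x + n.+1%:R^-1]) `|v y - v x|
    @[n --> \oo] --> 0.
Proof.
move=> lv vx.
(* The open ball of radius 2 / (n + 1) contains the closed end of the interval. *)
pose r n : R := 2 * n.+1%:R^-1.
have r0 n : 0 < r n by rewrite mulr_gt0 ?invn_gt0.
have rcv : r n @[n --> \oo] --> 0.
  by rewrite -[X in _ --> X](mulr0 2); apply: cvgM; [exact: cvg_cst|exact: cvg_harmonic].
move/cvge_at_rightP : vx => /(_ r (conj r0 rcv)) vx.
have vxf : fine (davg v x (r n)) @[n --> \oo] --> 0 by exact: fine_cvg.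
have cbnd n : intble (ball x (r n)) (fun y => v y - v x).
  apply: (@intble_itv _ _ (x - r n) (x + r n)).
  - exact: measurable_ball.
  - apply: locally_integrableB => //.
    split => //; first exact: openT.
    move=> K _ cK; rewrite integral_cst//=; last exact: compact_measurable.
    by rewrite lte_mul_pinfty// compact_finite_measure.
  - rewrite ball_itv; exact: subset_itv_oo_cc.
have key n : n.+1%:R * \int[mu]_(y in `]x, x + n.+1%:R^-1]) `|v y - v x| <=
    4 * fine (davg v x (r n)).
  have -> : fine (davg v x (r n)) =
      (r n *+ 2)^-1 * \int[mu]_(y in ball x (r n)) `|v y - v x|.
    rewrite /davg /iavg lebesgue_measure_ball ?(ltW (r0 n))// inver.
    rewrite mulrn_eq0/= gt_eqF// fineM//.
    rewrite (_ : (\int[_]_(y in _) _)%E = (\int[mu]_(y in ball x (r n)) `|v y - v x|%:E)%E)//.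
    apply: integrable_fin_num; first exact: measurable_ball.
    exact: intble_norm.
  rewrite (_ : 4 * _ = n.+1%:R * \int[mu]_(y in ball x (r n)) `|v y - v x|); last first.
    rewrite mulrA; congr (_ * _); rewrite /r mulr2n.
    have : n.+1%:R != 0 :> R by rewrite pnatr_eq0.
    by move: (n.+1%:R : R) => N N0; field.
  rewrite ler_pM2l ?ltr0n//.
  rewrite /Rintegral fine_le//.
  - apply: integrable_fin_num => //.
    apply: integrableS (intble_norm (cbnd n)) => //; first exact: measurable_ball.
    rewrite ball_itv => y /=; rewrite !in_itv/= => /andP[xy yx].
    have := r0 n; have := invn_gt0 n; rewrite /r.
    by move: (n.+1%:R^-1) yx => h yx h0 _; apply/andP; split; lra.
  - apply: integrable_fin_num; first exact: measurable_ball.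
    exact: intble_norm.
  - apply: ge0_subset_integral => //; first exact: measurable_ball.
      by case/integrableP: (intble_norm (cbnd n)).
    rewrite ball_itv => y /=; rewrite !in_itv/= => /andP[xy yx].
    have := r0 n; have := invn_gt0 n; rewrite /r.
    by move: (n.+1%:R^-1) yx => h yx h0 _; apply/andP; split; lra.
apply: (@squeeze_cvgr _ _ _ _ (fun=> 0) (fun n => 4 * fine (davg v x (r n)))).
- near=> n; rewrite key andbT mulr_ge0//.
  by apply: Rintegral_ge0.
- exact: cvg_cst.
- by rewrite -[X in _ --> X](mulr0 4); apply: cvgM => //; exact: cvg_cst.
Unshelve. all: by end_near.
Qed.

Lemma locally_integrable_cst (c : R) : locally_integrable [set: R] (fun=> c).
Proof.
split => //; first exact: openT.
move=> K _ cK; rewrite integral_cst//=; last exact: compact_measurable.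
by rewrite lte_mul_pinfty// compact_finite_measure.
Qed.

Lemma intble_cst_itv (c a b : R) : intble `]a, b] (fun=> c).
Proof.
apply: (intble_itv _ (locally_integrable_cst c) (@subset_itv_oc_cc _ _ a b)).
exact: measurable_itv.
Qed.

(** Kernels of height O(n) on an interval of length 1 / (n + 1) that starts
    at [x] need not be centred: the mean of |v - v x| over this interval
    tends to 0. *)
Lemma kernel_cvg v x (C : R) (w : nat -> R -> R) :
  locally_integrable setT v -> lebesgue_pt v x ->
  (forall n, measurable_fun [set: measurableTypeR R] (w n)) ->
  (forall n y, `|w n y| <= C * n.+1%:R) ->
  (forall n, \int[mu]_(y in `]x, x + n.+1%:R^-1]) w n y = 1) ->
  \int[mu]_(y in `]x, x + n.+1%:R^-1]) (w n y * v y) @[n --> \oo] --> v x.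
Proof.
move=> lv vx mw wC w1.
have C0 : 0 <= C.
  by have := wC 0%N 0; rewrite mulr1; apply: le_trans.
pose A n : set (measurableTypeR R) := [set` `]x, x + n.+1%:R^-1]].
have mA n : measurable (A n) by exact: measurable_itv.
have AB n : A n `<=` `[x, x + n.+1%:R^-1] by exact: subset_itv_oc_cc.
have lc := locally_integrable_cst.
have vi n : intble (A n) (fun y => v y - v x).
  by apply: (intble_itv (mA n) _ (@AB n)) => //; exact: (locally_integrableB lv (lc (v x))).
have wvi n (c : R -> R) : intble (A n) c -> intble (A n) (fun y => w n y * c y).
  move=> ic; apply: (@intble_bounded_mul _ _ _ _ _ _ _ (C * n.+1%:R)) => //.
  exact: measurable_funTS.
have ci n (c : R) : intble (A n) (fun=> c) by apply: (intble_itv (mA n) _ (@AB n)).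
have e n : \int[mu]_(y in A n) (w n y * v y) - v x =
    \int[mu]_(y in A n) (w n y * (v y - v x)).
  rewrite -[X in _ - X = _]mul1r -(w1 n) -/(A n) -RintegralZr//; last first.
    have := wvi n _ (ci n 1).
    by apply: eq_integrable => // y _ /=; rewrite mulr1.
  rewrite -RintegralB//; first by apply: eq_Rintegral => y _; rewrite mulrBr.
  - by apply: wvi; apply: (intble_itv (mA n) _ (@AB n)).
  - by apply: wvi.
apply/cvgrPdist_le => e0 e0gt.
have := lebesgue_pt_right lv vx.
move=> /cvgr0Pnorm_le /(_ (e0 / (C + 1))).
have C1 : 0 < C + 1 by lra.
rewrite divr_gt0// => /(_ isT); apply: filterS => n hn.
rewrite distrC e; apply: le_trans (le_normr_Rintegral _ _) _ => //.
  exact: wvi.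
have h1 : \int[mu]_(t in A n) `|w n t * (v t - v x)| <=
   \int[mu]_(t in A n) (C * n.+1%:R * `|v t - v x|).
  apply: le_Rintegral => //.
  - by apply: intble_norm; exact: wvi.
  - by apply: intbleZ => //; exact: intble_norm.
  - by move=> y _; rewrite normrM ler_wpM2r.
apply: (le_trans h1); rewrite RintegralZl//; last exact: intble_norm.
rewrite -mulrA; move: hn; rewrite ger0_norm; last first.
  by rewrite mulr_ge0//; apply: Rintegral_ge0.
move=> hn; have := ler_wpM2l C0 hn.
move/le_trans; apply.
rewrite mulrA ler_pdivrMr// mulrC ler_wpM2l ?(ltW e0gt)//; lra.
Qed.

Lemma lebesgue_avg v x : locally_integrable setT v -> lebesgue_pt v x ->
  n.+1%:R * \int[mu]_(y in `]x, x + n.+1%:R^-1]) v y @[n --> \oo] --> v x.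
Proof.
move=> lv vx.
rewrite (_ : (fun n => _) = fun n : nat =>
    \int[mu]_(y in `]x, x + n.+1%:R^-1]) (n.+1%:R * v y)); last first.
  apply/funext => n; rewrite RintegralZl//.
  by apply: (@intble_itv _ _ x (x + n.+1%:R^-1)) => //; exact: subset_itv_oc_cc.
apply: (@kernel_cvg _ _ 1 (fun n _ => n.+1%:R)) => //.
- by move=> n y; rewrite mul1r ger0_norm.
- move=> n; rewrite Rintegral_cst// fine_lebesgue_itv ?lerDl ?(ltW (invn_gt0 n))//.
  by rewrite addrC addKr divff// pnatr_eq0.
Qed.

(** The equality holds at every Lebesgue point of [v], so that [P] can be
    any property, such as the positivity of a time. *)
Lemma itv_integral0_ae (P : R -> Prop) v : locally_integrable setT v ->
  (forall x, P x -> forall h, 0 < h -> \int[mu]_(y in `]x, x + h]) v y = 0) ->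
  {ae mu, forall x, P x -> v x = 0}.
Proof.
move=> lv v0; apply: ae_imp (lebesgue_differentiation lv) => x vx Px.
have := lebesgue_avg lv vx.
rewrite (_ : (fun n => _) = fun=> 0); last first.
  by apply/funext => n; rewrite v0 ?mulr0// invn_gt0.
by move=> /cvg_lim <-//; rewrite lim_cst.
Qed.

End lebesgue_points.

(** * Mollified steps and plateaus *)

Section mollified_step.
Context {R : realType}.
Local Notation mu := (@lebesgue_measure R).
Local Notation intble D f := (mu.-integrable D (EFin \o f)).
Implicit Types (a b x y : R) (n : nat).

Lemma smooth_continuous (f : R -> R) : smooth f -> continuous f.
Proof.
case=> sf x; apply/differentiable_continuous/derivable1_diffP.
exact: sf 0%N x.
Qed.

Lemma smooth_measurable (f : R -> R) : smooth f ->
  measurable_fun [set: measurableTypeR R] f.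
Proof. by move=> /smooth_continuous cf; exact: continuous_measurable_fun. Qed.

Lemma smooth_derive1_intble (f : R -> R) a b : smooth f -> intble `[a, b] (derive1 f).
Proof.
move=> sf; apply: continuous_compact_integrable; first exact: segment_compact.
by apply: continuous_subspaceT; exact/smooth_continuous/smooth_derive1.
Qed.

Lemma smooth_ftc (f : R -> R) a b : smooth f -> a < b ->
  \int[mu]_(x in `[a, b]) derive1 f x = f b - f a.
Proof.
move=> sf ab; have cf := smooth_continuous sf.
rewrite /Rintegral (@continuous_FTC2 _ (derive1 f) f a b ab)//.
- by apply: continuous_subspaceT; exact/smooth_continuous/smooth_derive1.
- split.
  + by move=> x _; exact: smoothP sf 0%N x.
  + by apply: cvg_at_right_filter; exact: cf.
  + by apply: cvg_at_left_filter; exact: cf.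
Qed.

Lemma derive1_smooth_step_out y : y <= 0 \/ 1 <= y ->
  derive1 (@smooth_step R) y = 0.
Proof.
have ds x : derivable (@smooth_step R) x 1.
  exact: (smoothP (smooth_smooth_step R) 0%N x).
have yin : y \in `](y - 1), (y + 1)[.
  by rewrite in_itv/= ltrBlDr ltrDl ltr01.
move=> [y0|y1]; rewrite derive1E; apply: derive_val.
- apply: (@derive1_at_min _ _ (y - 1) (y + 1)) => //; first lra.
  by move=> t _; rewrite smooth_step_le0// smooth_step_ge0.
- apply: (@derive1_at_max _ _ (y - 1) (y + 1)) => //; first lra.
  by move=> t _; rewrite (smooth_step_ge1 y1) smooth_step_le1.
Qed.

Lemma derive1_smooth_step_bounded :
  exists2 C : R, 0 < C & forall y, `|derive1 (@smooth_step R) y| <= C.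
Proof.
have cs : continuous (derive1 (@smooth_step R)).
  exact/smooth_continuous/smooth_derive1/smooth_smooth_step.
have : compact ((derive1 (@smooth_step R)) @` `[0, 1]).
  apply: continuous_compact; last exact: segment_compact.
  exact: continuous_subspaceT.
move=> /compact_bounded[M [_ hM]].
exists (`|M| + 1); first by rewrite ltr_wpDl.
move=> y; have [y0|y0] := leP y 0.
  by rewrite derive1_smooth_step_out ?normr0 ?addr_ge0//; left.
have [y1|y1] := leP 1 y.
  by rewrite derive1_smooth_step_out ?normr0 ?addr_ge0//; right.
apply: (hM (`|M| + 1)); first by rewrite ltr_pwDr// ler_norm.
by exists y => //=; rewrite in_itv/= (ltW y0) (ltW y1).
Qed.

(** The rise takes place on [a, a + 1 / (n + 1)], to the right of [a], so
    that limits are indicators of half-open intervals ]a, b]. *)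
Definition step_at n a y : R := smooth_step (n.+1%:R * (y - a)).

Definition dstep_at n a y : R :=
  n.+1%:R * derive1 (@smooth_step R) (n.+1%:R * (y - a)).

Lemma smooth_step_at n a : smooth (step_at n a).
Proof.
have := smooth_affine (n.+1%:R) (- (n.+1%:R * a)) (smooth_smooth_step R).
by congr smooth; apply/funext => y; rewrite /step_at mulrBr.
Qed.

Lemma is_derive_step_at n a y : is_derive y (1 : R) (step_at n a) (dstep_at n a y).
Proof.
have -> : step_at n a = (@smooth_step R) \o (fun y => n.+1%:R * y - n.+1%:R * a).
  by apply/funext => x; rewrite /step_at /= mulrBr.
have h1 := is_derive_affine n.+1%:R (- (n.+1%:R * a)) y.
have := is_derive1_comp (smooth_is_derive _ (smooth_smooth_step R)) h1.
by move/is_derive_eq; apply; rewrite /dstep_at mulrC mulrBr.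
Qed.

Lemma derive1_step_at n a : derive1 (step_at n a) = dstep_at n a.
Proof.
by apply/funext => y; rewrite derive1E; apply: derive_val; exact: is_derive_step_at.
Qed.

Lemma step_at_ge0 n a y : 0 <= step_at n a y.
Proof. exact: smooth_step_ge0. Qed.

Lemma step_at_le1 n a y : step_at n a y <= 1.
Proof. exact: smooth_step_le1. Qed.

Lemma step_at_left n a y : y <= a -> step_at n a y = 0.
Proof. by move=> ya; rewrite /step_at smooth_step_le0// pmulr_rle0// subr_le0. Qed.

Lemma step_at_right n a y : a + n.+1%:R^-1 <= y -> step_at n a y = 1.
Proof.
move=> ya; rewrite /step_at smooth_step_ge1// -ler_pdivrMl ?ltr0n// mulr1.
by rewrite lerBrDl.
Qed.

Lemma dstep_at_out n a y : ~ (`]a, a + n.+1%:R^-1]%classic y) -> dstep_at n a y = 0.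
Proof.
rewrite /= in_itv/= => /negP; rewrite negb_and -leNgt -ltNge => h.
rewrite /dstep_at derive1_smooth_step_out ?mulr0//.
case/orP: h => h; [left|right]; first by rewrite pmulr_rle0 ?ltr0n// subr_le0.
by rewrite -ler_pdivrMl ?ltr0n// mulr1 lerBrDl ltW.
Qed.

Lemma dstep_at_bounded : exists2 C : R, 0 < C &
  forall n a y, `|dstep_at n a y| <= C * n.+1%:R.
Proof.
have [C C0 hC] := derive1_smooth_step_bounded.
by exists C => // n a y; rewrite /dstep_at normrM normr_nat mulrC ler_wpM2r.
Qed.

Lemma smooth_dstep_at n a : smooth (dstep_at n a).
Proof. by rewrite -derive1_step_at; exact/smooth_derive1/smooth_step_at. Qed.

Lemma measurable_dstep_at n a :
  measurable_fun [set: measurableTypeR R] (dstep_at n a).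
Proof. exact: smooth_measurable (smooth_dstep_at n a). Qed.

Lemma integral_dstep_at n a :
  \int[mu]_(y in `]a, a + n.+1%:R^-1]) dstep_at n a y = 1.
Proof.
have ab : a < a + n.+1%:R^-1 by rewrite ltrDl invn_gt0.
rewrite -derive1_step_at Rintegral_itv_obnd_cbnd.
  by rewrite smooth_ftc// ?(step_at_right (lexx _)) ?step_at_left ?subr0//; exact: smooth_step_at.
apply: integrableS (smooth_derive1_intble _ _ (smooth_step_at n a)) => //.
exact: subset_itv_oc_cc.
Qed.

Lemma dstep_at_cvg (v : R -> R) a : locally_integrable setT v -> lebesgue_pt v a ->
  \int[mu]_y (dstep_at n a y * v y) @[n --> \oo] --> v a.
Proof.
move=> lv va; have [C C0 hC] := dstep_at_bounded.
rewrite (_ : (fun n => _) = fun n : nat =>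
    \int[mu]_(y in `]a, a + n.+1%:R^-1]) (dstep_at n a y * v y)); last first.
  apply/funext => n; apply/esym/Rintegral_supp => y /dstep_at_out ->.
  by rewrite mul0r.
apply: (@kernel_cvg _ _ _ C (fun n => dstep_at n a)) => //.
- by move=> n; exact: measurable_dstep_at.
- by move=> n; exact: integral_dstep_at.
Qed.

Lemma step_at_cvg a y : step_at n a y @[n --> \oo] --> (\1_(`]a, +oo[) y : R).
Proof.
rewrite indicE; case: (ltP a y) => ay.
  rewrite mem_set/=; last by rewrite in_itv/= ay.
  apply: cvg_near_cst; near=> n; rewrite step_at_right// -lerBrDl ltW//.
  near: n; apply: (@near_infty_natSinv_lt _ (PosNum (_ : 0 < y - a))).
  by rewrite subr_gt0.
rewrite memNset/=; last by rewrite in_itv/= andbT ltNge ay.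
by apply: cvg_near_cst; apply: nearW => n; rewrite step_at_left.
Unshelve. all: by end_near.
Qed.

Definition plateau n a b y : R := step_at n a y - step_at n b y.

Definition dplateau n a b y : R := dstep_at n a y - dstep_at n b y.

Lemma smooth_plateau n a b : smooth (plateau n a b).
Proof. exact: (smoothB (smooth_step_at n a) (smooth_step_at n b)). Qed.

Lemma derive1_plateau n a b : derive1 (plateau n a b) = dplateau n a b.
Proof.
apply/funext => y; rewrite derive1E; apply: derive_val.
exact: (is_deriveB (is_derive_step_at n a y) (is_derive_step_at n b y)).
Qed.

Lemma plateau_le1 n a b y : `|plateau n a b y| <= 1.
Proof.
rewrite /plateau ler_norml.
have := step_at_ge0 n a y; have := step_at_le1 n a y.
have := step_at_ge0 n b y; have := step_at_le1 n b y.
by move: (step_at n a y) (step_at n b y) => p q *; apply/andP; split; lra.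
Qed.

Lemma plateau_out n a b y : a <= b -> ~ `[a, b + 1]%classic y -> plateau n a b y = 0.
Proof.
move=> ab; rewrite /= in_itv/= => /negP; rewrite negb_and -!ltNge => h.
have n1 : n.+1%:R^-1 <= 1 :> R by rewrite invf_le1// ler1n.
rewrite /plateau; case/orP: h => h.
  by rewrite !step_at_left ?subrr// ltW// (lt_le_trans h).
by rewrite !step_at_right ?subrr//; move: n1 h; move: (n.+1%:R^-1) => e; lra.
Qed.

Lemma dplateau_out n a b y : a <= b -> ~ `[a, b + 1]%classic y -> dplateau n a b y = 0.
Proof.
move=> ab; rewrite /= in_itv/= => /negP; rewrite negb_and -!ltNge => h.
have n1 : n.+1%:R^-1 <= 1 :> R by rewrite invf_le1// ler1n.
have n0 := invn_gt0 (R:=R) n.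
by rewrite /dplateau !dstep_at_out ?subrr//= in_itv/= => /andP[];
  move: n0 n1 h; move: (n.+1%:R^-1) => e e0 e1 /orP[] h; lra.
Qed.

Lemma plateau_cvg a b y : a <= b -> plateau n a b y @[n --> \oo] --> (\1_(`]a, b]) y : R).
Proof.
move=> ab; rewrite (_ : \1_(`]a, b]) y = \1_(`]a, +oo[) y - \1_(`]b, +oo[) y).
  by apply: cvgB; exact: step_at_cvg.
rewrite !indicE !mem_setE /= !in_itv/= !andbT.
by case: (ltP a y) => ay; case: (leP y b) => yb; rewrite ?subrr ?subr0//=; lra.
Qed.

Lemma plateau_test_function n a b : a <= b -> test_function (plateau n a b).
Proof.
move=> ab; split; first by move=> k x; exact: smoothP (smooth_plateau n a b) k x.
exists [set` `[a, b + 1]]; first exact: segment_compact.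
by move=> x; exact: plateau_out.
Qed.

(** The partial derivatives of a product of functions of separate variables
    are again such products. *)
Lemma iter_partial_prod (eta phi : R -> R) (w : seq bool) : smooth eta -> smooth phi ->
  exists i j, iter_partial w (fun t x => eta t * phi x) =
    fun t x => derive1n i eta t * derive1n j phi x.
Proof.
move=> [seta] [sphi]; elim: w => [|b w [i [j ih]]]; first by exists 0%N, 0%N.
rewrite /= -/(iter_partial w _) ih; case: b.
- exists i.+1, j; apply/funext => t; apply/funext => x.
  rewrite /d_t derive1E; apply: derive_val.
  have h : is_derive t (1 : R) (derive1n i eta) (derive1n i.+1 eta t).
    by rewrite derive1nS derive1E; apply: derivableP; exact: seta.
  have := is_deriveZ (derive1n j phi x) h.
  rewrite /GRing.scale /= mulrC.
  by congr is_derive; apply/funext => s /=; rewrite mulrC.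
- exists i, j.+1; apply/funext => t; apply/funext => x.
  rewrite /d_x derive1E; apply: derive_val.
  have h : is_derive x (1 : R) (derive1n j phi) (derive1n j.+1 phi x).
    by rewrite derive1nS derive1E; apply: derivableP; exact: sphi.
  exact: (is_deriveZ (derive1n i eta t) h).
Qed.

Lemma smooth_derive1n (f : R -> R) n : smooth f -> smooth (derive1n n f).
Proof. by move=> sf; elim: n => // n ih; rewrite derive1nS; exact: smooth_derive1. Qed.

Lemma smooth2_prod (eta phi : R -> R) : smooth eta -> smooth phi ->
  smooth2 (fun t x => eta t * phi x).
Proof.
move=> seta sphi w; have [i [j ->]] := iter_partial_prod w seta sphi.
split.
- move=> t x; apply: derivableM; first exact: (smoothP seta i t).
  exact: derivable_cst.
- move=> t x; apply: derivableM; first exact: derivable_cst.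
  exact: (smoothP sphi j x).
- move=> p; apply: cvgM.
    apply: (@continuous_comp _ _ _ (@fst R R)); first exact: cvg_fst.
    exact/smooth_continuous/smooth_derive1n.
  apply: (@continuous_comp _ _ _ (@snd R R)); first exact: cvg_snd.
  exact/smooth_continuous/smooth_derive1n.
Qed.

Lemma test_function2_prod n m s t a b : 0 < s -> s <= t -> a <= b ->
  test_function2 (fun r x => plateau n s t r * plateau m a b x).
Proof.
move=> s0 st ab; split; first by apply: smooth2_prod; exact: smooth_plateau.
exists ([set` `[s, t + 1]] `*` [set` `[a, b + 1]]); split.
- by apply: compact_setX; exact: segment_compact.
- move=> [r x] [/= + _]; rewrite !in_itv/= => /andP[sr _]; split => //=.
  by rewrite in_itv/= andbT (lt_le_trans s0).
- move=> [r x] /= /not_andP[h|h]; first by rewrite plateau_out// mul0r.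
  by rewrite (plateau_out _ _ h)// mulr0.
Qed.

Lemma d_t_prod (eta phi : R -> R) t x : derivable eta t 1 ->
  d_t (fun t x => eta t * phi x) t x = derive1 eta t * phi x.
Proof.
move=> deta; rewrite /d_t derive1E; apply: derive_val.
have := is_deriveZ (phi x) (derivableP deta); rewrite -derive1E.
rewrite /GRing.scale /= mulrC.
by congr is_derive; apply/funext => s /=; rewrite mulrC.
Qed.

Lemma d_x_prod (eta phi : R -> R) t x : derivable phi x 1 ->
  d_x (fun t x => eta t * phi x) t x = eta t * derive1 phi x.
Proof.
move=> dphi; rewrite /d_x derive1E; apply: derive_val.
by have := is_deriveZ (eta t) (derivableP dphi); rewrite -derive1E.
Qed.

End mollified_step.

(** * Iterated integrals *)

Section product_tools.
Context d1 d2 (T1 : measurableType d1) (T2 : measurableType d2) (R : realType).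
Variable m1 : {sigma_finite_measure set T1 -> \bar R}.
Variable m2 : {sigma_finite_measure set T2 -> \bar R}.
Implicit Types f : T1 -> T2 -> R.

Local Notation prod_measurable f :=
  (measurable_fun [set: T1 * T2] (fun p => f p.1 p.2)).
Local Notation prod_intble f :=
  ((m1 \x m2)%E.-integrable [set: T1 * T2] (fun p => (f p.1 p.2)%:E)).

Lemma measurable_section1 f x : prod_measurable f -> measurable_fun setT (f x).
Proof. by move=> mf; exact: (measurableT_comp mf (measurable_pair1 x)). Qed.

Lemma measurable_section2 f y : prod_measurable f ->
  measurable_fun setT (fun x => f x y).
Proof. by move=> mf; exact: (measurableT_comp mf (measurable_pair2 y)). Qed.

Lemma measurable_integral_section f : prod_measurable f ->
  measurable_fun setT (fun x => \int[m2]_y f x y).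
Proof.
move=> mf.
have mEf : measurable_fun [set: T1 * T2] (fun p => (f p.1 p.2)%:E).
  exact/measurable_EFinP.
rewrite /Rintegral; apply: (measurableT_comp (f := fine)) => //.
rewrite (_ : (fun x => _) = (fun x =>
    \int[m2]_y ((fun p => (f p.1 p.2)%:E)^\+)%E (x, y) -
    \int[m2]_y ((fun p => (f p.1 p.2)%:E)^\-)%E (x, y))%E); last first.
  apply/funext => x; rewrite [LHS]integralE; congr (_ - _)%E;
    by apply: eq_integral => y _; rewrite ?funeposE ?funenegE.
apply: emeasurable_funB.
- apply: (measurable_fun_fubini_tonelli_F (m2 := m2)
     ((fun p : T1 * T2 => (f p.1 p.2)%:E)^\+)%E) => //.
  exact: measurable_funepos.
- apply: (measurable_fun_fubini_tonelli_F (m2 := m2)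
     ((fun p : T1 * T2 => (f p.1 p.2)%:E)^\-)%E) => //.
  exact: measurable_funeneg.
Qed.

Lemma prod_intble_lty f : prod_measurable f ->
  (\int[m1]_x \int[m2]_y (`|f x y|)%:E < +oo)%E -> prod_intble f.
Proof. by move=> mf h; apply/integrable12ltyP => //; exact/measurable_EFinP. Qed.

Lemma prod_intble_meas f : prod_intble f -> prod_measurable f.
Proof. by move=> fi; apply/measurable_EFinP; exact: measurable_int fi. Qed.

Lemma prod_lty_intble f : prod_intble f ->
  (\int[m1]_x \int[m2]_y (`|f x y|)%:E < +oo)%E.
Proof.
by move=> fi; have := (integrable12ltyP _ _ (measurable_int (m1 \x m2)%E fi)).1 fi.
Qed.

Lemma prod_intble_section f : prod_intble f ->
  {ae m1, forall x, m2.-integrable setT (EFin \o f x)}.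
Proof. by move=> /ae_integrable1. Qed.

Lemma prod_intble_section2 f : prod_intble f ->
  {ae m2, forall y, m1.-integrable setT (EFin \o f^~ y)}.
Proof. by move=> /ae_integrable2. Qed.

Lemma intble_integral_section f : prod_intble f ->
  m1.-integrable setT (EFin \o (fun x => \int[m2]_y f x y)).
Proof.
move=> fi; have mf := prod_intble_meas fi.
apply/integrableP; split.
  by apply/measurable_EFinP; exact: measurable_integral_section.
have := integrable_fubini_F fi => /integrableP[_].
apply: le_lt_trans.
apply: ae_ge0_le_integral => //.
- apply: measurableT_comp => //.
  by apply/measurable_EFinP; exact: measurable_integral_section.
- by apply: measurableT_comp => //; exact: (measurable_fubini_F fi).
- apply: ae_imp (prod_intble_section fi) => x fix_ _.
  by rewrite /fubini_F -(EFin_Rintegral _ fix_).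
Qed.

Lemma Rfubini1 f : prod_intble f ->
  \int[(m1 \x m2)%E]_p f p.1 p.2 = \int[m1]_x \int[m2]_y f x y.
Proof.
move=> fi; have mf := prod_intble_meas fi.
congr fine; rewrite -(integral12_prod_meas1 fi).
apply: ae_eq_integral => //; first exact: (measurable_fubini_F fi).
  by apply/measurable_EFinP; exact: measurable_integral_section.
apply: ae_imp (prod_intble_section fi) => x fix_ _.
by rewrite /fubini_F /= EFin_Rintegral.
Qed.

Lemma ae_prod (P : T1 * T2 -> Prop) : {ae (m1 \x m2)%E, forall p, P p} ->
  {ae m1, forall x, {ae m2, forall y, P (x, y)}}.
Proof.
move=> [A [mA A0 PA]].
have mX : measurable_fun setT (m2 \o xsection A) by exact: measurable_fun_xsection.
have /ae_eq_integral_abs : (\int[m1]_x `|(m2 \o xsection A) x| = 0)%E.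
  by rewrite -[RHS]A0; apply: eq_integral => x _; rewrite gee0_abs.
move=> /(_ measurableT mX); apply: ae_imp => x /(_ I) /= xA0.
exists (xsection A x); split => //; first exact: measurable_xsection.
by move=> y /= Pxy; rewrite /xsection /= inE; exact: PA.
Qed.

Lemma prod_measurable1 (f : T1 -> R) : measurable_fun setT f ->
  prod_measurable (fun x (_ : T2) => f x).
Proof. by move=> mf; exact: (measurableT_comp mf measurable_fst). Qed.

Lemma prod_measurable2 (f : T2 -> R) : measurable_fun setT f ->
  prod_measurable (fun (_ : T1) y => f y).
Proof. by move=> mf; exact: (measurableT_comp mf measurable_snd). Qed.

End product_tools.

Section product_swap.
Context d1 d2 (T1 : measurableType d1) (T2 : measurableType d2) (R : realType).
Variable m1 : {sigma_finite_measure set T1 -> \bar R}.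
Variable m2 : {sigma_finite_measure set T2 -> \bar R}.
Implicit Types f : T1 -> T2 -> R.

Local Notation prod_measurable f :=
  (measurable_fun [set: T1 * T2] (fun p => f p.1 p.2)).
Local Notation prod_intble f :=
  ((m1 \x m2)%E.-integrable [set: T1 * T2] (fun p => (f p.1 p.2)%:E)).

Lemma prod_measurable_swap f : prod_measurable f ->
  measurable_fun [set: T2 * T1] (fun p => f p.2 p.1).
Proof.
move=> mf; have ms : measurable_fun [set: T2 * T1] (fun p => (p.2, p.1)).
  by apply: measurable_fun_pair; [exact: measurable_snd|exact: measurable_fst].
exact: (measurableT_comp mf ms).
Qed.

Lemma prod_intble_swap f : prod_intble f ->
  (m2 \x m1)%E.-integrable [set: T2 * T1] (fun p => (f p.2 p.1)%:E).
Proof.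
move=> fi; have mf := prod_intble_meas fi.
have ms : measurable_fun [set: T2 * T1] (fun p => (f p.2 p.1)%:E).
  by apply/measurable_EFinP; exact: prod_measurable_swap.
apply/(integrable12ltyP m2 m1 ms).
exact: ((integrable21ltyP _ _ (measurable_int (m1 \x m2)%E fi)).1 fi).
Qed.

Lemma Rfubini f : prod_intble f ->
  \int[m1]_x \int[m2]_y f x y = \int[m2]_y \int[m1]_x f x y.
Proof.
move=> fi; have si := @prod_intble_swap f fi.
have -> : \int[m2]_y \int[m1]_x f x y =
    \int[(m2 \x m1)%E]_p f p.2 p.1 by rewrite -(Rfubini1 (f := fun y x => f x y) si).
rewrite -(Rfubini1 fi); congr fine.
rewrite -(integral21_prod_meas1 fi).
by rewrite -(integral12_prod_meas1 si).
Qed.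

End product_swap.

(** * Cut-offs in the plane *)

Section plane_functions.
Context {R : realType}.
Local Notation mu := (@lebesgue_measure R).
Local Notation mR := (measurableTypeR R).
Local Notation intble D f := (mu.-integrable D (EFin \o f)).
Local Notation plane_measurable F :=
  (measurable_fun [set: mR * mR] (fun p => F p.1 p.2)).
Local Notation plane_intble F :=
  ((mu \x mu)%E.-integrable [set: mR * mR] (fun p => (F p.1 p.2)%:E)).
Implicit Types (F : R -> R -> R) (alpha beta : R -> R) (a b s t : R).

Lemma indic_le (A B : set R) x : A `<=` B -> \1_A x <= \1_B x :> R.
Proof.
move=> AB; rewrite !indicE; case: (boolP (x \in A)) => xA; last by rewrite mulr0n ler0n.
by rewrite mem_set//; apply: AB; exact: set_mem.
Qed.

Lemma plane_intble_le F G : plane_measurable F -> plane_intble G ->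
  (forall r x, `|F r x| <= G r x) -> plane_intble F.
Proof.
move=> mF iG FG.
apply: (@intble_le _ _ _ (mu \x mu)%E setT (fun p => F p.1 p.2) _ _ _ iG) => //.
Qed.

(** The indicator bounds [alpha] and also records its support. *)
Definition box_bounded (alpha : R -> R) a b := measurable_fun [set: mR] alpha /\
  exists2 C, 0 <= C & forall r, `|alpha r| <= C * \1_(`[a, b]) r.

(** The integrability common to fluxes, which are bounded, and to time
    derivatives, which are square integrable on strips. *)
Definition box_intble F := plane_measurable F /\
  forall tau L : R, 0 < tau ->
    plane_intble (fun r x => \1_(`[- tau, tau]) r * \1_(`[- L, L]) x * F r x).

Lemma box_intble_mul F alpha beta a b s t : box_intble F ->
  box_bounded alpha s t -> box_bounded beta a b ->
  plane_intble (fun r x => alpha r * (F r x * beta x)).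
Proof.
move=> [mF iF] [ma [C C0 hC]] [mb [C' C'0 hC']].
pose tau := Num.max 1 (Num.max (- s) t); pose L := Num.max (- a) b.
have tau0 : 0 < tau by rewrite lt_max ltr01.
have := iF tau L tau0 => /integrable_norm iFL.
apply: (@plane_intble_le (fun r x => alpha r * (F r x * beta x)) (fun r x => C * C' *
  `|\1_(`[- tau, tau]) r * \1_(`[- L, L]) x * F r x|)).
- apply: measurable_funM; first exact: prod_measurable1.
  by apply: measurable_funM => //; exact: prod_measurable2.
- exact: (intbleZ (C * C') measurableT iFL).
- move=> r x; rewrite !normrM [X in _ * (X * _ * _)]ger0_norm//.
  rewrite [X in _ * (_ * X * _)]ger0_norm//.
  have h1 : `|alpha r| <= C * \1_(`[- tau, tau]) r.
    apply: (le_trans (hC r)); rewrite ler_wpM2l//; apply: indic_le => y /=.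
    rewrite !in_itv/= => /andP[sy yt]; rewrite /tau lerNl !le_max.
    by rewrite lerN2 sy yt !orbT.
  have h2 : `|beta x| <= C' * \1_(`[- L, L]) x.
    apply: (le_trans (hC' x)); rewrite ler_wpM2l//; apply: indic_le => y /=.
    rewrite !in_itv/= => /andP[sy yt]; rewrite /L lerNl !le_max.
    by rewrite lerN2 sy yt orbT.
  have := ler_pM (normr_ge0 _) (normr_ge0 _) h1 h2 => h.
  have := ler_wpM2r (normr_ge0 (F r x)) h.
  by congr (_ <= _); ring.
Qed.

Lemma box_bounded_indic a b : box_bounded (\1_(`]a, b])) a b.
Proof.
split; first exact: measurable_indic.
exists 1 => // r; rewrite mul1r ger0_norm//.
by apply: indic_le; exact: subset_itv_oc_cc.
Qed.

Lemma box_bounded_plateau n a b : a <= b -> box_bounded (plateau n a b) a (b + 1).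
Proof.
move=> ab; split; first exact: smooth_measurable (smooth_plateau n a b).
exists 1 => // r; rewrite mul1r indicE.
have [rI|rI] := boolP (r \in _); first exact: plateau_le1.
by rewrite plateau_out ?normr0//; rewrite notin_setE in rI.
Qed.

Lemma dplateau_bounded : exists2 C : R, 0 < C &
  forall n a b y, `|dplateau n a b y| <= C * n.+1%:R.
Proof.
have [C C0 hC] := @dstep_at_bounded R; exists (C + C); first by rewrite addr_gt0.
move=> n a b y; apply: (le_trans (ler_normB _ _)).
by rewrite mulrDl lerD.
Qed.

Lemma box_bounded_dplateau n a b : a <= b -> box_bounded (dplateau n a b) a (b + 1).
Proof.
move=> ab; split.
  by apply: measurable_funB; exact: measurable_dstep_at.
have [C C0 hC] := dplateau_bounded.
exists (C * n.+1%:R); first by rewrite mulr_ge0// ltW.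
move=> r; rewrite indicE.
have [rI|rI] := boolP (r \in _); first by rewrite mulr1.
by rewrite dplateau_out ?normr0 ?mulr0//; rewrite notin_setE in rI.
Qed.

Lemma indic_itvE a b x : \1_(`]a, b]) x = ((a < x) && (x <= b))%:R :> R.
Proof. by rewrite indicE mem_setE in_itv. Qed.

Lemma Rintegral_indic (A : set mR) (f : R -> R) :
  \int[mu]_x (f x * \1_A x) = \int[mu]_(x in A) f x.
Proof.
rewrite [RHS]Rintegral_mkcond; apply: eq_Rintegral => x _.
by rewrite patchE indicE; case: (x \in A); rewrite ?mulr1 ?mulr0.
Qed.

Lemma RintegralZl_intble (c : R) (f : R -> R) : intble setT (fun x => c * f x) ->
  \int[mu]_x (c * f x) = c * \int[mu]_x f x.
Proof.
have [->|c0] := eqVneq c 0 => icf.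
  under eq_Rintegral do rewrite mul0r.
  by rewrite Rintegral_cst// !mul0r.
apply: RintegralZl => //.
have := intbleZ c^-1 measurableT icf.
by apply: eq_integrable => // x _ /=; rewrite mulKf.
Qed.

Lemma box_fubini F alpha beta s t a b : box_intble F ->
  box_bounded alpha s t -> box_bounded beta a b ->
  \int[(mu \x mu)%E]_p (alpha p.1 * (F p.1 p.2 * beta p.2)) =
  \int[mu]_r (alpha r * \int[mu]_x (F r x * beta x)).
Proof.
move=> bF ba bb; have iF := box_intble_mul bF ba bb.
rewrite (Rfubini1 (f := fun r x : mR => alpha r * (F r x * beta x)) iF).
have mF := bF.1; have ma := ba.1; have mb := bb.1.
apply: ae_eq_Rintegral => //.
- exact: (measurable_integral_section _ (prod_intble_meas
    (f := fun r x : mR => alpha r * (F r x * beta x)) iF)).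
- apply: measurable_funM => //.
  apply: (measurable_integral_section _ (f := fun r x : mR => F r x * beta x)).
  by apply: measurable_funM => //; exact: prod_measurable2.
- apply: ae_imp (prod_intble_section
    (f := fun r x : mR => alpha r * (F r x * beta x)) iF) => r ir _.
  exact: (RintegralZl_intble ir).
Qed.

(** Dominated convergence in the plane, all plateaus being below the
    indicator of [a, b + 1]. *)
Lemma plateau_limit_space F alpha s t a b : box_intble F -> box_bounded alpha s t ->
  a <= b ->
  \int[mu]_r (alpha r * \int[mu]_x (F r x * plateau n a b x)) @[n --> \oo] -->
  \int[mu]_r (alpha r * \int[mu]_(x in `]a, b]) F r x).
Proof.
move=> bF ba ab.
have bI : box_bounded (\1_(`]a, b + 1])) a (b + 1) by exact: box_bounded_indic.
rewrite (_ : \int[mu]_r (_ * \int[mu]_(x in _) _) =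
   \int[mu]_r (alpha r * \int[mu]_x (F r x * \1_(`]a, b]) x))); last first.
  by apply: eq_Rintegral => r _; rewrite Rintegral_indic.
rewrite -(box_fubini bF ba (box_bounded_indic a b)).
rewrite (_ : (fun n => _) = fun n => \int[(mu \x mu)%E]_p
   (alpha p.1 * (F p.1 p.2 * plateau n a b p.2))); last first.
  by apply/funext => n; rewrite -(box_fubini bF ba (box_bounded_plateau n ab)).
have mF := bF.1; have ma := ba.1.
have m1 beta : measurable_fun [set: mR] beta ->
    measurable_fun [set: mR * mR] (fun p => alpha p.1 * (F p.1 p.2 * beta p.2)).
  move=> mb; apply: measurable_funM; first exact: prod_measurable1.
  by apply: measurable_funM => //; exact: prod_measurable2.
have bc : box_bounded (\1_(`[a, b + 1])) a (b + 1).
  split; first exact: measurable_indic.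
  by exists 1 => // r; rewrite mul1r ger0_norm.
apply: (@Rintegral_dominated _ _ _ (mu \x mu)%E setT _ _
  (fun p => `|alpha p.1 * (F p.1 p.2 * \1_(`[a, b + 1]) p.2)|)) => //.
- by move=> n; apply: m1; exact: (box_bounded_plateau n ab).1.
- by apply: m1; exact: measurable_indic.
- apply: aeW => -[r x] _ /=; apply: cvgMr; apply: cvgMr; exact: plateau_cvg.
- by apply: intble_norm; exact: (box_intble_mul bF ba bc).
- move=> n [r x] _ /=; rewrite !normrM ler_wpM2l// ler_wpM2l//.
  rewrite indicE [X in _ <= X]ger0_norm//.
  have [xI|xI] := boolP (x \in _); first exact: plateau_le1.
  by rewrite plateau_out ?normr0//; rewrite notin_setE in xI.
Qed.

Lemma plateau_limit_time (c : R -> R) s t : locally_integrable setT c -> s <= t ->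
  \int[mu]_r (plateau n s t r * c r) @[n --> \oo] --> \int[mu]_(r in `]s, t]) c r.
Proof.
move=> lc st; have mc : measurable_fun [set: mR] c by case: lc.
rewrite -Rintegral_indic.
have ic : intble `[s, t + 1] c by apply: (intble_itv _ lc (@subset_refl _ _)).
apply: (@Rintegral_dominated _ _ _ mu setT _ _ (fun r => \1_(`[s, t + 1]) r * `|c r|)) => //.
- by move=> n; apply: measurable_funM => //; exact: (box_bounded_plateau n st).1.
- by apply: measurable_funM => //; exact: measurable_indic.
- apply: aeW => r _; rewrite mulrC; apply: cvgMl; exact: plateau_cvg.
- apply: (@intble_supp _ `[s, t + 1]) => //.
    by move=> x xI; rewrite indicE memNset// mul0r.
  have := intble_norm ic; apply: eq_integrable => // x xI /=.
  by rewrite indicE xI mul1r.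
- move=> n r _; rewrite normrM ler_wpM2r// indicE.
  have [rI|rI] := boolP (r \in _); first exact: plateau_le1.
  by rewrite plateau_out ?normr0//; rewrite notin_setE in rI.
Qed.

End plane_functions.

(** * Extension by zero to the whole plane *)

Section time_patch.
Context {R : realType}.
Local Notation mu := (@lebesgue_measure R).
Local Notation mR := (measurableTypeR R).
Local Notation intble D f := (mu.-integrable D (EFin \o f)).
Local Notation plane_measurable F :=
  (measurable_fun [set: mR * mR] (fun p => F p.1 p.2)).
Local Notation plane_intble F :=
  ((mu \x mu)%E.-integrable [set: mR * mR] (fun p => (F p.1 p.2)%:E)).
Implicit Types (u g z F : R -> R -> R).

(** Functions known for non-negative times only are extended by zero, so
    that the theorems on the product measure apply in the whole plane. *)
Definition after0 (u : R -> R -> R) (r x : R) : R := if 0 <= r then u r x else 0.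

Definition clamp1 (s : R) : R := Num.max (-1) (Num.min 1 s).

(** A flux is bounded by 1 almost everywhere; the clamp makes it bounded
    everywhere and does not change it where it was bounded. *)
Definition after0_clamp (z : R -> R -> R) (r x : R) : R :=
  if 0 < r then clamp1 (z r x) else 0.

Lemma clamp1_le1 s : `|clamp1 s| <= 1.
Proof.
rewrite /clamp1 ler_norml le_max lexx /= ge_max ge_min lexx /= andbT.
lra.
Qed.

Lemma clamp1_id s : `|s| <= 1 -> clamp1 s = s.
Proof. by rewrite ler_norml /clamp1 => /andP[s1 s2]; rewrite min_r// max_r. Qed.

Lemma closed_halfE (r x : R) : ((r, x) \in @closed_half_plane R) = (0 <= r).
Proof.
apply/idP/idP; rewrite inE /closed_half_plane /= in_itv/= andbT; first by case.
by [].
Qed.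

Lemma open_halfE (r x : R) : ((r, x) \in @open_half_plane R) = (0 < r).
Proof.
apply/idP/idP; rewrite inE /open_half_plane /= in_itv/= andbT; first by case.
by [].
Qed.

Lemma measurable_closed_half : measurable (@closed_half_plane R : set (mR * mR)).
Proof. by apply: measurableX => //; exact: measurable_itv. Qed.

Lemma measurable_open_half : measurable (@open_half_plane R : set (mR * mR)).
Proof. by apply: measurableX => //; exact: measurable_itv. Qed.

Lemma after0_measurable u :
  measurable_fun (@closed_half_plane R) (fun p => u p.1 p.2) ->
  plane_measurable (after0 u).
Proof.
move=> mu_; have := (measurable_restrictT (fun p : mR * mR => u p.1 p.2)
   measurable_closed_half).1 mu_.
congr (measurable_fun _ _); apply/funext => -[r x]; rewrite patchE /after0 /=.
by rewrite closed_halfE.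
Qed.

Lemma after0_clamp_measurable z :
  measurable_fun (@open_half_plane R) (fun p => z p.1 p.2) ->
  plane_measurable (after0_clamp z).
Proof.
move=> mz; have mc : measurable_fun (@open_half_plane R : set (mR * mR))
    (fun p => clamp1 (z p.1 p.2)).
  by apply: measurable_maxr => //; exact: measurable_minr.
have := (measurable_restrictT (fun p : mR * mR => clamp1 (z p.1 p.2))
   measurable_open_half).1 mc.
congr (measurable_fun _ _); apply/funext => -[r x]; rewrite patchE /after0_clamp /=.
by rewrite open_halfE.
Qed.

Lemma after0_clamp_le1 z r x : `|after0_clamp z r x| <= 1.
Proof. by rewrite /after0_clamp; case: ifP; rewrite ?normr0 ?clamp1_le1. Qed.

Lemma strip_sq_intble g tau : L2loc_L2 g -> 0 < tau ->
  plane_intble (fun r x => \1_(`[0, tau]) r * after0 g r x ^+ 2).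
Proof.
move=> [mg g2] tau0.
apply: (prod_intble_lty (f := fun r x : mR => \1_(`[0, tau]) r * after0 g r x ^+ 2)).
  apply: measurable_funM.
    by apply: prod_measurable1; exact: measurable_indic.
  by apply: measurable_funX; exact: after0_measurable.
have := g2 _ tau0; rewrite integral_mkcond.
congr (_ < _)%E; apply: eq_integral => r _; rewrite patchE.
have [rI|rI] := boolP (r \in _).
  apply: eq_integral => x _; rewrite indicE rI mul1r ger0_norm ?sqr_ge0//.
  by move: rI; rewrite inE/= in_itv/= /after0 => /andP[-> _].
rewrite (eq_integral (cst 0%E)) ?integral_cst ?mul0e// => x _.
by rewrite indicE (negbTE rI) mul0r normr0.
Qed.

Lemma box_indic_intble (a b s t : R) :
  plane_intble (fun r x => \1_(`[s, t]) r * \1_(`[a, b]) x).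
Proof.
apply: (prod_intble_lty (f := fun r x : mR => \1_(`[s, t]) r * \1_(`[a, b]) x)).
  apply: measurable_funM.
    by apply: prod_measurable1; exact: measurable_indic.
  by apply: prod_measurable2; exact: measurable_indic.
have mI (c d : R) : measurable_fun [set: mR] (fun x => (\1_(`[c, d]) x : R)%:E).
  by apply/measurable_EFinP; exact: measurable_indic.
have I0 (c d : R) (x : mR) : [set: mR] x -> (0 <= (\1_(`[c, d]) x : R)%:E)%E.
  by move=> _; rewrite lee_fin.
rewrite (eq_integral (fun r : mR => (\1_(`[s, t]) r)%:E * mu `[a, b])%E); last first.
  move=> r _; rewrite -[X in (_ * mu X)%E]setIT -integral_indic//.
  rewrite -ge0_integralZl//.
  by apply: eq_integral => x _; rewrite ger0_norm// mulr_ge0.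
rewrite ge0_integralZr//.
rewrite integral_indic// setIT.
have fin (c d : R) : mu `[c, d] \is a fin_num.
  rewrite ge0_fin_numE//; apply: compact_finite_measure; exact: segment_compact.
by apply: lte_mul_pinfty; rewrite ?fin// ltey_eq fin.
Qed.

Lemma box_intble_after0 g : L2loc_L2 g -> box_intble (after0 g).
Proof.
move=> lg; have mg := after0_measurable lg.1; split => // tau L tau0.
have i1 := strip_sq_intble lg tau0.
have i2 := box_indic_intble (-L) L (-tau) tau.
apply: (plane_intble_le (F := fun r x => \1_(`[- tau, tau]) r * \1_(`[- L, L]) x * after0 g r x)
   (G := fun r x => \1_(`[0, tau]) r * after0 g r x ^+ 2 +
     \1_(`[- tau, tau]) r * \1_(`[- L, L]) x) _ (intbleD measurableT i1 i2)).
- apply: measurable_funM => //; apply: measurable_funM.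
    by apply: prod_measurable1; exact: measurable_indic.
  by apply: prod_measurable2; exact: measurable_indic.
- move=> r x /=.
  rewrite /after0; case: ifPn => r0; last first.
    by rewrite mulr0 normr0 expr0n/= mulr0 add0r mulr_ge0.
  have -> : \1_(`[- tau, tau]) r = \1_(`[0, tau]) r :> R.
    rewrite !indicE !mem_setE !in_itv/= r0 andTb.
    by rewrite (_ : - tau <= r) // (le_trans _ r0)// oppr_le0 ltW.
  rewrite !indicE; case: (r \in _); case: (x \in _);
    rewrite ?(mul0r, mulr0, mul1r, mulr1, normr0, addr0, add0r) ?sqr_ge0//.
  exact: normr_le_sqD1.
Qed.

Lemma box_intble_clamp z :
  measurable_fun (@open_half_plane R) (fun p => z p.1 p.2) ->
  box_intble (after0_clamp z).
Proof.
move=> mz; have mg := after0_clamp_measurable mz; split => // tau L tau0.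
have i2 := box_indic_intble (-L) L (-tau) tau.
apply: (plane_intble_le
  (F := fun r x => \1_(`[- tau, tau]) r * \1_(`[- L, L]) x * after0_clamp z r x)
  (G := fun r x => \1_(`[- tau, tau]) r * \1_(`[- L, L]) x) _ i2).
- apply: measurable_funM => //; apply: measurable_funM.
    by apply: prod_measurable1; exact: measurable_indic.
  by apply: prod_measurable2; exact: measurable_indic.
- move=> r x; rewrite normrM [X in X * _]ger0_norm ?mulr_ge0//.
  by rewrite ler_piMr ?mulr_ge0// after0_clamp_le1.
Qed.

Lemma half_plane_integral (F H : R -> R -> R) :
  plane_measurable F -> measurable_fun (@open_half_plane R) (fun p => H p.1 p.2) ->
  (forall r x, r <= 0 -> F r x = 0) ->
  {ae (mu \x mu)%E, forall p : mR * mR, 0 < p.1 -> H p.1 p.2 = F p.1 p.2} ->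
  plane_intble F ->
  (\int[(mu \x mu)%E]_(p in @open_half_plane R) (H p.1 p.2)%:E =
   (\int[(mu \x mu)%E]_p (F p.1 p.2))%:E)%E.
Proof.
move=> mF mH F0 HF iF.
rewrite EFin_Rintegral//.
transitivity (\int[(mu \x mu)%E]_(p in @open_half_plane R) (F p.1 p.2)%:E)%E.
  apply: ae_eq_integral; first exact: measurable_open_half.
  - exact/measurable_EFinP.
  - by apply/measurable_EFinP; exact: measurable_funTS.
  - apply: ae_imp HF => p HF [/= + _]; rewrite in_itv/= andbT => p0.
    by rewrite HF.
rewrite [LHS]integral_mkcond. apply: eq_integral => -[r x] _; rewrite patchE.
by rewrite open_halfE; case: (ltP 0 r) => // r0; rewrite F0.
Qed.

End time_patch.

(** * Square integrability and weak derivatives *)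

Section L2_norm.
Context {R : realType}.
Local Notation mu := (@lebesgue_measure R).
Local Notation mR := (measurableTypeR R).
Local Notation intble D f := (mu.-integrable D (EFin \o f)).

Lemma inL2_measurable (f : R -> R) : inL2 f -> measurable_fun [set: mR] f.
Proof. by move=> /sub_Lfun_mfun; rewrite inE. Qed.

Lemma inL2_sq (f : R -> R) : inL2 f -> intble setT (fun x => f x ^+ 2).
Proof. by move=> /Lfun2_integrable_sqr. Qed.

Lemma inL1_intble (f : R -> R) : inL1 f -> intble setT f.
Proof. by move=> /Lfun1_integrable. Qed.

Lemma sq_locally_integrable (f : R -> R) : measurable_fun [set: mR] f ->
  intble setT (fun x => f x ^+ 2) -> locally_integrable setT f.
Proof.
move=> mf f2; split => //; first exact: openT.
move=> K _ cK; have mK : measurable (K : set mR) by exact: compact_measurable.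
have i1 : intble K (fun=> 1).
  by apply: intble_lty => //; have [_ _] := locally_integrable_cst (1 : R); apply.
have i2 : intble K (fun x => f x ^+ 2) by exact: integrableS f2.
have : intble K f.
  apply: (intble_le _ _ (intbleD mK i2 i1)) => //; first exact: measurable_funTS.
  by move=> x _; exact: normr_le_sqD1.
by case/integrableP.
Qed.

Lemma intble_itv_sq (f : R -> R) (a b : R) : measurable_fun [set: mR] f ->
  intble setT (fun x => f x ^+ 2) -> intble `]a, b] f.
Proof.
move=> mf f2; have mI : measurable (`]a, b] : set mR) by exact: measurable_itv.
exact: (intble_itv mI (sq_locally_integrable mf f2) (@subset_itv_oc_cc _ _ a b)).
Qed.

Lemma L2norm_lt_sq (f : R -> R) (e : R) : measurable_fun [set: mR] f ->
  intble setT (fun x => f x ^+ 2) ->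
  (L2norm f < e%:E)%E -> \int[mu]_x (f x ^+ 2) < e ^+ 2.
Proof.
move=> mf f2; rewrite /L2norm => fe.
have e0 : 0 <= e.
  by rewrite -lee_fin; apply: le_trans (ltW fe); exact: Lnorm_ge0.
have := powR_Lnorm mu (EFin \o f) (r := 2); rewrite pnatr_eq0 => /(_ isT).
have : (0 <= 'N[mu]_2%:E[EFin \o f])%E by exact: Lnorm_ge0.
move: fe; case: ('N[mu]_2%:E[EFin \o f])%E => [r| |]//; rewrite !lte_fin !lee_fin => re r0.
rewrite (eq_integral (fun x : mR => (f x ^+ 2)%:E)); last first.
  by move=> x _ /=; rewrite (powR_mulrn 2)// real_normK ?num_real.
have e2 := EFin_Rintegral measurableT f2.
rewrite -e2 poweR_EFin.
rewrite (powR_mulrn 2 r0) => -[h].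
by rewrite -h ltrXn2r.
Qed.

Lemma Rintegral_itv_sq_bound (f : R -> R) (a b e : R) :
  measurable_fun [set: mR] f -> intble setT (fun x => f x ^+ 2) -> a <= b -> 0 < e ->
  \int[mu]_x (f x ^+ 2) < e ^+ 2 ->
  `|\int[mu]_(x in `]a, b]) f x| <= (b - a + 1) * e.
Proof.
move=> mf f2 ab e0 fe.
have mab : measurable (`]a, b] : set mR) by exact: measurable_itv.
have f2ab : intble `]a, b] (fun x => f x ^+ 2) by exact: integrableS f2.
have cab (c : R) : intble `]a, b] (fun=> c).
  exact: intble_cst_itv.
have ib : intble `]a, b] (fun x => e + e^-1 * f x ^+ 2).
  by apply: intbleD => //; exact: intbleZ.
have fb x : `|f x| <= e + e^-1 * f x ^+ 2.
  have := sqr_ge0 (`|f x| - e); rewrite -(real_normK (num_real (f x))).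
  move: `|f x| (normr_ge0 (f x)) => y y0; rewrite sqrrB => h.
  rewrite -(ler_pM2l e0) mulrDr mulrA divff ?gt_eqF// mul1r.
  have : 0 <= y * e by rewrite mulr_ge0// ltW.
  by rewrite mulrC; nra.
have iff : intble `]a, b] f.
  by apply: (intble_le _ _ ib) => //; exact: measurable_funTS.
apply: (le_trans (le_normr_Rintegral _ iff)) => //.
have := le_Rintegral mab (intble_norm iff) ib (fun x _ => fb x).
move/le_trans; apply.
rewrite RintegralD//; last exact: intbleZ.
rewrite RintegralZl// Rintegral_cst// fine_lebesgue_itv//.
have : \int[mu]_(x in `]a, b]) (f x ^+ 2) <= e ^+ 2.
  apply: le_trans (ltW fe).
  rewrite /Rintegral fine_le ?integrable_fin_num//.
  apply: ge0_subset_integral => //.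
  - by apply/measurable_EFinP; apply: measurable_funX.
  - by move=> x _; rewrite lee_fin sqr_ge0.
move=> h; have h2 : e^-1 * \int[mu]_(x in `]a, b]) (f x ^+ 2) <= e.
  by rewrite ler_pdivrMl// -expr2.
by rewrite mulrDl mul1r mulrC; lra.
Qed.

Lemma intble_sqB (f h : R -> R) :
  measurable_fun [set: mR] f -> measurable_fun [set: mR] h ->
  intble setT (fun x => f x ^+ 2) -> intble setT (fun x => h x ^+ 2) ->
  intble setT (fun x => (f x - h x) ^+ 2).
Proof.
move=> mf mh f2 h2.
apply: (intble_le _ _ (intbleD measurableT (intbleZ 2 measurableT f2)
  (intbleZ 2 measurableT h2))) => //.
  by apply: measurable_funX; exact: measurable_funB.
move=> x _; rewrite ger0_norm ?sqr_ge0//.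
have := sqr_ge0 (f x + h x); rewrite sqrrD sqrrB; lra.
Qed.

End L2_norm.

Section weak_derivatives.
Context {R : realType}.
Local Notation mu := (@lebesgue_measure R).
Local Notation mR := (measurableTypeR R).
Local Notation intble D f := (mu.-integrable D (EFin \o f)).
Local Notation plane_measurable F :=
  (measurable_fun [set: mR * mR] (fun p => F p.1 p.2)).
Local Notation plane_intble F :=
  ((mu \x mu)%E.-integrable [set: mR * mR] (fun p => (F p.1 p.2)%:E)).
Implicit Types (u g z F : R -> R -> R).

Lemma locally_integrable_section F (beta : R -> R) a b : box_intble F ->
  box_bounded beta a b ->
  locally_integrable setT (fun r => \int[mu]_x (F r x * beta x)).
Proof.
move=> bF bb.
have mc : measurable_fun [set: mR] (fun r => \int[mu]_x (F r x * beta x)).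
  apply: (measurable_integral_section _ (f := fun r x : mR => F r x * beta x)).
  by apply: measurable_funM; [exact: bF.1|apply: prod_measurable2; exact: bb.1].
split => //; first exact: openT.
move=> K _ cK; have [M [_ hM]] := compact_bounded cK.
pose tau := `|M| + 1.
have Kt : K `<=` `[- tau, tau].
  move=> x Kx; have := hM tau _ x Kx.
  by rewrite /= in_itv/= -ler_norml; apply; rewrite /tau ltr_pwDr// ler_norm.
have ba : box_bounded (\1_(`[- tau, tau]) : R -> R) (- tau) tau.
  split; first exact: measurable_indic.
  by exists 1 => // r; rewrite mul1r ger0_norm.
have := intble_integral_section
  (f := fun r x : mR => \1_(`[- tau, tau]) r * (F r x * beta x))
  (box_intble_mul bF ba bb).
move=> i1.
have mK : measurable (K : set mR) by exact: compact_measurable.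
have iK : intble K (fun r => \int[mu]_x (\1_(`[- tau, tau]) r * (F r x * beta x))).
  exact: integrableS i1.
have : intble K (fun r => \int[mu]_x (F r x * beta x)).
  apply: eq_integrable iK => // r rK /=; congr EFin; apply: eq_Rintegral => x _.
  by rewrite indicE mem_set ?mul1r//; apply: Kt; exact: set_mem.
by case/integrableP.
Qed.

(** A product of plateaus separates the variables: the weak equation becomes
    one between integrals in time of integrals in space. *)
Lemma weak_d_t_plateau u g n m s t a b : L2loc_L2 u -> L2loc_L2 g -> weak_d_t u g ->
  0 < s -> s <= t -> a <= b ->
  \int[mu]_r (dplateau n s t r * \int[mu]_x (after0 u r x * plateau m a b x)) =
  - \int[mu]_r (plateau n s t r * \int[mu]_x (after0 g r x * plateau m a b x)).
Proof.
move=> lu lg ug s0 st ab.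
have bU := box_intble_after0 lu; have bG := box_intble_after0 lg.
have bb := box_bounded_plateau m ab; have ba := box_bounded_plateau n st.
have bda := box_bounded_dplateau n st.
have := ug _ (test_function2_prod n m s0 st ab).
have iU := box_intble_mul bU bda bb; have iG := box_intble_mul bG ba bb.
have dtE r x : d_t (fun r x => plateau n s t r * plateau m a b x) r x =
    dplateau n s t r * plateau m a b x.
  by rewrite d_t_prod ?derive1_plateau//; exact: smoothP (smooth_plateau n s t) 0%N r.
have mH (w : R -> R -> R) (alpha : R -> R) : L2loc_L2 w ->
    measurable_fun [set: mR] alpha ->
    measurable_fun (@open_half_plane R)
      (fun p => w p.1 p.2 * (alpha p.1 * plateau m a b p.2)).
  move=> lw ma; apply: measurable_funM.
    apply: measurable_funS lw.1; first exact: measurable_closed_half.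
    by move=> [r x] [/=]; rewrite !in_itv/= !andbT => r0 _; split => //=;
      rewrite in_itv/= andbT ltW.
  apply: measurable_funTS; apply: measurable_funM.
    exact: prod_measurable1.
  by apply: prod_measurable2; exact: bb.1.
rewrite (half_plane_integral
  (F := fun r x => dplateau n s t r * (after0 u r x * plateau m a b x))
  (H := fun r x => u r x * d_t (fun r x => plateau n s t r * plateau m a b x) r x)).
- rewrite (half_plane_integral
    (F := fun r x => plateau n s t r * (after0 g r x * plateau m a b x))
    (H := fun r x => g r x * (plateau n s t r * plateau m a b x))).
  + rewrite (box_fubini bU bda bb) (box_fubini bG ba bb) -EFinN.
    by move=> h; apply: EFin_inj; exact: h.
  + exact: (prod_intble_meas (f := fun r x : mR => plateau n s t r * (after0 g r x * plateau m a b x)) iG).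
  + by apply: mH => //; exact: ba.1.
  + move=> r x r0; rewrite plateau_out ?mul0r//= in_itv/= => /andP[sr _]; lra.
  + apply: aeW => -[r x] /= r0; rewrite /after0 (ltW r0); ring.
  + exact: iG.
- exact: (prod_intble_meas (f := fun r x : mR => dplateau n s t r * (after0 u r x * plateau m a b x)) iU).
- under eq_fun do rewrite dtE.
  by apply: mH => //; exact: bda.1.
- move=> r x r0; rewrite dplateau_out ?mul0r//= in_itv/= => /andP[sr _]; lra.
- apply: aeW => -[r x] /= r0; rewrite dtE /after0 (ltW r0); ring.
- exact: iU.
Qed.

Lemma weak_d_x_plateau z g n m s t a b :
  measurable_fun (@open_half_plane R) (fun p => z p.1 p.2) ->
  {ae (mu \x mu)%E, forall p, 0 < p.1 -> `|z p.1 p.2| <= 1} ->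
  L2loc_L2 g -> weak_d_x z g ->
  0 < s -> s <= t -> a <= b ->
  \int[mu]_r (plateau n s t r * \int[mu]_x (after0_clamp z r x * dplateau m a b x)) =
  - \int[mu]_r (plateau n s t r * \int[mu]_x (after0 g r x * plateau m a b x)).
Proof.
move=> mz z1 lg zg s0 st ab.
have bU := box_intble_clamp mz; have bG := box_intble_after0 lg.
have bb := box_bounded_plateau m ab; have ba := box_bounded_plateau n st.
have bda := box_bounded_dplateau m ab.
have := zg _ (test_function2_prod n m s0 st ab).
have iU := box_intble_mul bU ba bda; have iG := box_intble_mul bG ba bb.
have dxE r x : d_x (fun r x => plateau n s t r * plateau m a b x) r x =
    plateau n s t r * dplateau m a b x.
  by rewrite d_x_prod ?derive1_plateau//; exact: smoothP (smooth_plateau m a b) 0%N x.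
rewrite (half_plane_integral
  (F := fun r x => plateau n s t r * (after0_clamp z r x * dplateau m a b x))
  (H := fun r x => z r x * d_x (fun r x => plateau n s t r * plateau m a b x) r x)).
- rewrite (half_plane_integral
    (F := fun r x => plateau n s t r * (after0 g r x * plateau m a b x))
    (H := fun r x => g r x * (plateau n s t r * plateau m a b x))).
  + rewrite (box_fubini bU ba bda) (box_fubini bG ba bb) -EFinN.
    by move=> h; apply: EFin_inj; exact: h.
  + exact: (prod_intble_meas (f := fun r x : mR => plateau n s t r * (after0 g r x * plateau m a b x)) iG).
  + apply: measurable_funM.
      apply: measurable_funS lg.1; first exact: measurable_closed_half.
      by move=> [r x] [/=]; rewrite !in_itv/= !andbT => r0 _; split => //=;
        rewrite in_itv/= andbT ltW.
    apply: measurable_funTS; apply: measurable_funM.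
      by apply: prod_measurable1; exact: ba.1.
    by apply: prod_measurable2; exact: bb.1.
  + move=> r x r0; rewrite plateau_out ?mul0r//= in_itv/= => /andP[sr _]; lra.
  + apply: aeW => -[r x] /= r0; rewrite /after0 (ltW r0); ring.
  + exact: iG.
- exact: (prod_intble_meas (f := fun r x : mR => plateau n s t r * (after0_clamp z r x * dplateau m a b x)) iU).
- under eq_fun do rewrite dxE.
  apply: measurable_funM => //.
  apply: measurable_funTS; apply: measurable_funM.
    by apply: prod_measurable1; exact: ba.1.
  by apply: prod_measurable2; exact: bda.1.
- move=> r x r0; rewrite plateau_out ?mul0r//= in_itv/= => /andP[sr _]; lra.
- apply: ae_imp z1 => -[r x] /= z1 r0; rewrite dxE /after0_clamp r0 clamp1_id ?z1//; ring.
- exact: iU.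
Qed.

End weak_derivatives.

(** * Increments in time *)

Section increments.
Context {R : realType}.
Local Notation mu := (@lebesgue_measure R).
Local Notation mR := (measurableTypeR R).
Local Notation intble D f := (mu.-integrable D (EFin \o f)).
Implicit Types (u g z F : R -> R -> R).

Lemma L2_continuous_itv u (a b t e : R) : L2_continuous u -> a <= b -> 0 <= t -> 0 < e ->
  exists2 d, 0 < d & forall s, 0 <= s -> `|s - t| < d ->
    `|\int[mu]_(x in `]a, b]) u s x - \int[mu]_(x in `]a, b]) u t x| <= e.
Proof.
move=> [uL2 uc] ab t0 e0.
have c0 : 0 < b - a + 1 by lra.
have [d d0 hd] := uc t t0 (e / (b - a + 1)) (divr_gt0 e0 c0).
exists d => // s s0 sd.
have := hd s s0 sd.
have ms := inL2_measurable (uL2 s s0); have mt := inL2_measurable (uL2 t t0).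
have s2 := inL2_sq (uL2 s s0); have t2 := inL2_sq (uL2 t t0).
have md : measurable_fun [set: mR] (fun x => u s x - u t x) by exact: measurable_funB.
have d2 := intble_sqB ms mt s2 t2.
move/(L2norm_lt_sq md d2) => h.
have := Rintegral_itv_sq_bound md d2 ab (divr_gt0 e0 c0) h.
rewrite RintegralB//; [|exact: intble_itv_sq|exact: intble_itv_sq].
by rewrite mulrC divfK ?gt_eqF.
Qed.

Lemma weak_d_t_time u g n s t a b : L2loc_L2 u -> L2loc_L2 g -> weak_d_t u g ->
  0 < s -> s <= t -> a <= b ->
  \int[mu]_r (dplateau n s t r * \int[mu]_(x in `]a, b]) after0 u r x) =
  - \int[mu]_r (plateau n s t r * \int[mu]_(x in `]a, b]) after0 g r x).
Proof.
move=> lu lg ug s0 st ab.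
have h1 := plateau_limit_space (box_intble_after0 lu) (box_bounded_dplateau n st) ab.
have h2 := plateau_limit_space (box_intble_after0 lg) (box_bounded_plateau n st) ab.
apply: (cvg_unique _ h1) => //.
rewrite (_ : (fun m => _) = (fun m => - \int[mu]_r (plateau n s t r *
  \int[mu]_x (after0 g r x * plateau m a b x)))); last first.
  by apply/funext => m; exact: weak_d_t_plateau.
exact: cvgN.
Qed.

Lemma Rintegral_section_indic F (a b : R) :
  (fun r => \int[mu]_(x in `]a, b]) F r x) = (fun r => \int[mu]_x (F r x * \1_(`]a, b]) x)).
Proof. by apply/funext => r; rewrite Rintegral_indic. Qed.

Lemma locally_integrable_section_itv F (a b : R) : box_intble F ->
  locally_integrable setT (fun r => \int[mu]_(x in `]a, b]) F r x).
Proof.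
move=> bF; rewrite Rintegral_section_indic.
exact: (locally_integrable_section bF (box_bounded_indic a b)).
Qed.

Lemma intble_dstep_mul (c : R -> R) n s : locally_integrable setT c ->
  intble setT (fun r => dstep_at n s r * c r).
Proof.
move=> lc; apply: (@intble_supp _ `]s, s + n.+1%:R^-1]) => //.
  by move=> r /dstep_at_out ->; rewrite mul0r.
have [C C0 hC] := @dstep_at_bounded R.
apply: (@intble_bounded_mul _ _ _ _ _ _ _ (C * n.+1%:R)) => //.
- by apply: measurable_funTS; exact: measurable_dstep_at.
- apply: (intble_itv _ lc (@subset_itv_oc_cc _ _ s (s + n.+1%:R^-1))).
  exact: measurable_itv.
Qed.

(** The mass of an interval is continuous in time, hence every time is a
    Lebesgue point of it and the plateaus in time can be sharpened to an
    indicator. *)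
Lemma time_increment_pos u g s t a b : L2loc_L2 u -> L2loc_L2 g -> weak_d_t u g ->
  L2_continuous u -> 0 < s -> s <= t -> a <= b ->
  \int[mu]_(x in `]a, b]) u t x - \int[mu]_(x in `]a, b]) u s x =
  \int[mu]_(r in `]s, t]) \int[mu]_(x in `]a, b]) after0 g r x.
Proof.
move=> lu lg ug uc s0 st ab.
pose cU r := \int[mu]_(x in `]a, b]) after0 u r x.
pose cG r := \int[mu]_(x in `]a, b]) after0 g r x.
have lcU : locally_integrable setT cU.
  by apply: locally_integrable_section_itv; exact: box_intble_after0.
have lcG : locally_integrable setT cG.
  by apply: locally_integrable_section_itv; exact: box_intble_after0.
have cUE r : 0 <= r -> cU r = \int[mu]_(x in `]a, b]) u r x.
  by move=> r0; rewrite /cU /after0 r0.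
have cUc r : 0 < r -> lebesgue_pt cU r.
  move=> r0; apply: (@continuous_lebesgue_pt _ _ _ setT) => //.
  - by apply: open_nbhsT.
  - by case: lcU.
  - apply/cvgrPdist_le => e e0.
    have [d d0 hd] := L2_continuous_itv uc ab (ltW r0) e0.
    near=> q.
    have q0 : 0 < q by near: q; exact: lt_nbhsr.
    rewrite distrC (cUE _ (ltW r0)) (cUE _ (ltW q0)); apply: hd; first exact: ltW.
    by rewrite distrC; near: q; apply/nbhs_ballP; exists d.
have t0 : 0 < t by exact: lt_le_trans st.
rewrite -!cUE ?ltW//.
have h1 : \int[mu]_r (dplateau n s t r * cU r) @[n --> \oo] --> cU s - cU t.
  rewrite (_ : (fun n => _) = fun n => \int[mu]_r (dstep_at n s r * cU r) -
      \int[mu]_r (dstep_at n t r * cU r)); last first.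
    apply/funext => n; rewrite -RintegralB//; try exact: intble_dstep_mul.
    by apply: eq_Rintegral => r _; rewrite /dplateau mulrBl.
  by apply: cvgB; apply: dstep_at_cvg => //; exact: cUc.
have h2 : \int[mu]_r (plateau n s t r * cG r) @[n --> \oo] -->
    \int[mu]_(r in `]s, t]) cG r by exact: plateau_limit_time.
have h3 : \int[mu]_r (plateau n s t r * cG r) @[n --> \oo] --> - (cU s - cU t).
  rewrite (_ : (fun n => _) = fun n => - \int[mu]_r (dplateau n s t r * cU r)).
    exact: cvgN.
  by apply/funext => n; rewrite (weak_d_t_time n lu lg ug)// opprK.
by have := cvg_unique _ h2 h3; rewrite opprB => ->.
Unshelve. all: by end_near.
Qed.

(** Time 0 is reached by continuity: a test function vanishes near time 0. *)
Lemma time_increment u g s t a b : L2loc_L2 u -> L2loc_L2 g -> weak_d_t u g ->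
  L2_continuous u -> 0 <= s -> s <= t -> a <= b ->
  \int[mu]_(x in `]a, b]) u t x - \int[mu]_(x in `]a, b]) u s x =
  \int[mu]_(r in `]s, t]) \int[mu]_(x in `]a, b]) after0 g r x.
Proof.
move=> lu lg ug uc s0' st ab.
have [s0|s0|s0] := ltgtP 0 s.
- exact: time_increment_pos.
- by move: s0'; rewrite leNgt s0.
move: st; rewrite -s0 => {s s0 s0'} t0'. have [t0|t0|<-] := ltgtP 0 t; first last.
- by rewrite subrr set_itvoc0 Rintegral_set0.
- by move: t0'; rewrite leNgt t0.
(* Positive initial times, up to t, that tend to 0. *)
pose sn (n : nat) : R := t * n.+1%:R^-1.
have sn0 n : 0 < sn n by rewrite mulr_gt0// invn_gt0.
have snt n : sn n <= t by rewrite ler_piMr ?(ltW t0)// invf_le1// ler1n.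
have sncv : sn n @[n --> \oo] --> 0.
  by rewrite -[X in _ --> X](mulr0 t); apply: cvgM; [exact: cvg_cst|exact: cvg_harmonic].
pose cG r := \int[mu]_(x in `]a, b]) after0 g r x.
have lcG : locally_integrable setT cG.
  by apply: locally_integrable_section_itv; exact: box_intble_after0.
have mcG : measurable_fun [set: mR] cG by case: lcG.
have iG : intble `]0, t] cG.
  by apply: (intble_itv _ lcG (@subset_itv_oc_cc _ _ 0 t)); exact: measurable_itv.
have h1 : \int[mu]_(x in `]a, b]) u t x - \int[mu]_(x in `]a, b]) u (sn n) x
    @[n --> \oo] --> \int[mu]_(x in `]a, b]) u t x - \int[mu]_(x in `]a, b]) u 0 x.
  apply: cvgB; first exact: cvg_cst.
  apply/cvgrPdist_le => e e0.
  have [d d0 hd] := L2_continuous_itv uc ab (lexx 0) e0.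
  move/cvgrPdist_lt : sncv => /(_ d d0); apply: filterS => n; rewrite sub0r normrN => nd.
  by rewrite distrC; apply: hd; [exact: ltW|rewrite subr0].
have h2 : \int[mu]_(r in `]0, t]) (cG r * \1_(`]sn n, t]) r) @[n --> \oo] -->
    \int[mu]_(r in `]0, t]) cG r.
  apply: (@Rintegral_dominated _ _ _ mu `]0, t] _ _ (fun r => `|cG r|)) => //.
  - by move=> n; apply: measurable_funTS; apply: measurable_funM => //; exact: measurable_indic.
  - exact: measurable_funTS.
  - apply: aeW => r; rewrite /= in_itv/= => /andP[r0 rt].
    rewrite -[X in _ --> X]mulr1; apply: cvgM; first exact: cvg_cst.
    apply: cvg_near_cst; move/cvgrPdist_lt : sncv => /(_ r r0).
    apply: filterS => n; rewrite sub0r normrN gtr0_norm// => nr.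
    by rewrite indic_itvE nr rt.
  - exact: intble_norm.
  - move=> n r _; rewrite normrM ler_piMr// indicE.
    by case: (r \in _); rewrite ?normr1 ?normr0.
apply: (cvg_unique _ h1) => //.
rewrite (_ : (fun n => _) = fun n => \int[mu]_(r in `]0, t]) (cG r * \1_(`]sn n, t]) r)) //.
apply/funext => n; rewrite (time_increment_pos lu lg)//.
rewrite -Rintegral_indic [RHS]Rintegral_mkcond; apply: eq_Rintegral => r _.
rewrite patchE; case: ifPn => //; rewrite notin_setE/= in_itv/= => h.
rewrite indic_itvE; case: (ltP (sn n) r) => snr; last by rewrite mulr0.
case: (leP r t) => rt; last by rewrite mulr0.
by exfalso; apply: h; rewrite rt andbT (lt_trans (sn0 n)).
Qed.

End increments.

(** * The flux at almost every time *)

Section flux.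
Context {R : realType}.
Local Notation mu := (@lebesgue_measure R).
Local Notation mR := (measurableTypeR R).
Local Notation intble D f := (mu.-integrable D (EFin \o f)).
Implicit Types (u g z F : R -> R -> R).

Lemma continuous_locally_integrable (f : R -> R) : continuous f ->
  locally_integrable setT f.
Proof.
move=> cf; split; first exact: continuous_measurable_fun.
  exact: openT.
move=> K _ cK.
have : intble K f.
  by apply: continuous_compact_integrable => //; exact: continuous_subspaceT.
by case/integrableP.
Qed.

Lemma continuous_lebesgue_ptT (f : R -> R) x : continuous f -> lebesgue_pt f x.
Proof.
move=> cf; apply: (@continuous_lebesgue_pt _ _ _ setT) => //.
- exact: open_nbhsT.
- exact: continuous_measurable_fun.
- exact: cf.
Qed.

Lemma continuous_ae0 (f : R -> R) : continuous f -> {ae mu, forall x, f x = 0} ->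
  forall x, f x = 0.
Proof.
move=> cf f0 x.
have := lebesgue_avg (continuous_locally_integrable cf) (continuous_lebesgue_ptT x cf).
rewrite (_ : (fun n => _) = fun=> 0); last first.
  apply/funext => n; rewrite (ae_eq_Rintegral (g := fun=> 0)) ?Rintegral_cst ?mul0r ?mulr0//.
  - by apply: measurable_funTS; exact: continuous_measurable_fun.
  - by apply: ae_imp f0 => y.
by move=> /cvg_lim <-//; rewrite lim_cst.
Qed.

Lemma continuous_ae_le1 (f : R -> R) : continuous f -> {ae mu, forall x, `|f x| <= 1} ->
  forall x, `|f x| <= 1.
Proof.
move=> cf f1 x.
have ck : continuous (fun x => `|f x| - 1).
  move=> y; apply: cvgB; last exact: cvg_cst.
  by apply: cvg_norm; exact: cf.
have cm : continuous (fun x => `|f x| - 1 + `| `|f x| - 1 |).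
  move=> y; apply: cvgD; first exact: ck.
  by apply: cvg_norm; exact: ck.
have h : {ae mu, forall x, `|f x| - 1 + `| `|f x| - 1 | = 0}.
  apply: ae_imp f1 => y fy; have k : `|f y| - 1 <= 0 by rewrite subr_le0.
  by rewrite (ler0_norm k) subrr.
have := continuous_ae0 cm h x; have := normr_ge0 (`|f x| - 1).
move: (`| `|f x| - 1 |) => c; lra.
Qed.

Lemma ae_all_count d (T : measurableType d) (m : {measure set T -> \bar R})
    (I : countType) (P : I -> T -> Prop) :
  (forall i, {ae m, forall x, P i x}) -> {ae m, forall x, forall i, P i x}.
Proof.
move=> aP.
have : {ae m, forall x, forall n i, @unpickle I n = Some i -> P i x}.
  apply: ae_all_nat => n; case: (@unpickle I n) => [i|].
    by apply: ae_imp (aP i) => x Pix j [<-].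
  by apply: aeW => x j.
by apply: ae_imp => x h i; apply: (h (pickle i)); rewrite pickleK.
Qed.

(** The exceptional times depend on the plateau; [ae_good_flux] applies this
    to countably many plateaus. *)
Lemma flux_plateau z g m a b :
  measurable_fun (@open_half_plane R) (fun p => z p.1 p.2) ->
  {ae (mu \x mu)%E, forall p, 0 < p.1 -> `|z p.1 p.2| <= 1} ->
  L2loc_L2 g -> weak_d_x z g -> a <= b ->
  {ae mu, forall r, 0 < r ->
    \int[mu]_x (after0_clamp z r x * dplateau m a b x) =
    - \int[mu]_x (after0 g r x * plateau m a b x)}.
Proof.
move=> mz z1 lg zg ab.
pose c1 r := \int[mu]_x (after0_clamp z r x * dplateau m a b x).
pose c2 r := \int[mu]_x (after0 g r x * plateau m a b x).
have l1 : locally_integrable setT c1.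
  exact: (locally_integrable_section (box_intble_clamp mz) (box_bounded_dplateau m ab)).
have l2 : locally_integrable setT c2.
  exact: (locally_integrable_section (box_intble_after0 lg) (box_bounded_plateau m ab)).
have lc := locally_integrableD l1 l2.
have : {ae mu, forall r, 0 < r -> (c1 \+ c2) r = 0}.
  apply: itv_integral0_ae => // s s0 h h0.
  have sh : s <= s + h by rewrite lerDl ltW.
  have := plateau_limit_time l1 sh.
  have e n : \int[mu]_r (plateau n s (s + h) r * c1 r) =
      - \int[mu]_r (plateau n s (s + h) r * c2 r).
    exact: weak_d_x_plateau.
  under eq_fun do rewrite e.
  move=> h1; have h2 : (- \int[mu]_r (plateau n s (s + h) r * c2 r)) @[n --> \oo] -->
      - \int[mu]_(r in `]s, s + h]) c2 r.
    by apply: cvgN; exact: plateau_limit_time.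
  have := cvg_unique _ h1 h2 => h3.
  rewrite RintegralD//; first by rewrite h3// addNr.
  - by apply: (intble_itv _ l1 (@subset_itv_oc_cc _ _ s (s + h))); exact: measurable_itv.
  - by apply: (intble_itv _ l2 (@subset_itv_oc_cc _ _ s (s + h))); exact: measurable_itv.
apply: ae_imp => r h /h/= e; apply/eqP; rewrite -addr_eq0; apply/eqP; exact: e.
Qed.

Lemma ae_after0_sq g : L2loc_L2 g ->
  {ae mu, forall r, 0 < r -> intble setT (fun x => after0 g r x ^+ 2)}.
Proof.
move=> lg.
have : {ae mu, forall r : mR, forall n : nat,
    intble setT (fun x => \1_(`[0, n.+1%:R]) r * after0 g r x ^+ 2)}.
  apply: ae_all_nat => n.
  apply: (prod_intble_section
    (f := fun r x : mR => \1_(`[0, n.+1%:R]) r * after0 g r x ^+ 2)).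
  by apply: strip_sq_intble; rewrite ?ltr0n.
apply: ae_imp => r h r0.
have := h (Num.truncn r); apply: eq_integrable => // x _ /=.
rewrite indicE mem_set ?mul1r//= in_itv/= (ltW r0)/= ltW//.
exact: truncnS_gt.
Qed.

Lemma flux_limit (Z G : R -> R) a b : continuous Z -> locally_integrable setT G -> a <= b ->
  (forall m, \int[mu]_x (Z x * dplateau m a b x) = - \int[mu]_x (G x * plateau m a b x)) ->
  Z b - Z a = \int[mu]_(x in `]a, b]) G x.
Proof.
move=> cZ lG ab e.
have lZ := continuous_locally_integrable cZ.
have h1 : \int[mu]_x (Z x * dplateau n a b x) @[n --> \oo] --> Z a - Z b.
  rewrite (_ : (fun n => _) = fun n => \int[mu]_r (dstep_at n a r * Z r) -
      \int[mu]_r (dstep_at n b r * Z r)); last first.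
    apply/funext => n; rewrite -RintegralB//; try exact: intble_dstep_mul.
    by apply: eq_Rintegral => r _; rewrite /dplateau mulrC mulrBl.
  by apply: cvgB; apply: dstep_at_cvg => //; exact: continuous_lebesgue_ptT.
have h3 : \int[mu]_x (Z x * dplateau n a b x) @[n --> \oo] -->
    - \int[mu]_(r in `]a, b]) G r.
  rewrite (_ : (fun n => _) = fun n => - \int[mu]_r (plateau n a b r * G r)).
    by apply: cvgN; exact: plateau_limit_time.
  apply/funext => n; rewrite e; congr (- _); apply: eq_Rintegral => x _.
  by rewrite mulrC.
by have := cvg_unique _ h1 h3 => h; rewrite -(opprB (Z a)) h// opprK.
Qed.

(** Both sides are continuous in the end points, which reduces all intervals
    to countably many. *)
Lemma flux_rat_real (Z G : R -> R) : continuous Z -> locally_integrable setT G ->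
  (forall p q : rat, ratr p <= ratr q :> R ->
     Z (ratr q) - Z (ratr p) = \int[mu]_(x in `]ratr p, ratr q]) G x) ->
  forall a b, a <= b -> Z b - Z a = \int[mu]_(x in `]a, b]) G x.
Proof.
move=> cZ lG e a b; rewrite le_eqVlt => /predU1P[->|ab].
  by rewrite subrr set_itvoc0 Rintegral_set0.
have mG : measurable_fun [set: mR] G by case: lG.
have /choice[p hp] n : exists p : rat, ratr p \in `]a, Num.min b (a + n.+1%:R^-1)[ .
  by apply: rat_in_itvoo; rewrite lt_min ab ltrDl invn_gt0.
have /choice[q hq] n : exists q : rat, ratr q \in `]b, b + n.+1%:R^-1[ .
  by apply: rat_in_itvoo; rewrite ltrDl invn_gt0.
have pa n : a < ratr (p n) by have := hp n; rewrite in_itv/= => /andP[].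
have pb n : ratr (p n) < b by have := hp n; rewrite in_itv/= lt_min => /and3P[].
have pn n : ratr (p n) < a + n.+1%:R^-1 by have := hp n; rewrite in_itv/= lt_min => /and3P[].
have qb n : b < ratr (q n) by have := hq n; rewrite in_itv/= => /andP[].
have qn n : ratr (q n) < b + n.+1%:R^-1 by have := hq n; rewrite in_itv/= => /andP[].
have cv (c : R) (s : nat -> R) : (forall n, c < s n) -> (forall n, s n < c + n.+1%:R^-1) ->
    s n @[n --> \oo] --> c.
  move=> cs sc; apply: (@squeeze_cvgr _ _ _ _ (fun=> c) (fun n => c + n.+1%:R^-1)).
  - by apply: nearW => n; rewrite !ltW.
  - exact: cvg_cst.
  - by rewrite -[X in _ --> X]addr0; apply: cvgD; [exact: cvg_cst|exact: cvg_harmonic].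
have cp := cv a (fun n => ratr (p n)) pa pn.
have cq := cv b (fun n => ratr (q n)) qb qn.
have h1 : Z (ratr (q n)) - Z (ratr (p n)) @[n --> \oo] --> Z b - Z a.
  by apply: cvgB; apply: continuous_cvg => //; exact: cZ.
have iG : intble `]a, b + 1] G.
  by apply: (intble_itv _ lG (@subset_itv_oc_cc _ _ a (b + 1))); exact: measurable_itv.
have h2 : \int[mu]_(x in `]a, b + 1]) (G x * \1_(`]ratr (p n), ratr (q n)]) x) @[n --> \oo] -->
    \int[mu]_(x in `]a, b + 1]) (G x * \1_(`]a, b]) x).
  apply: (@Rintegral_dominated _ _ _ mu `]a, b + 1] _ _ (fun r => `|G r|)) => //.
  - by move=> n; apply: measurable_funTS; apply: measurable_funM => //; exact: measurable_indic.
  - by apply: measurable_funTS; apply: measurable_funM => //; exact: measurable_indic.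
  - apply: aeW => x; rewrite /= in_itv/= => /andP[ax xb].
    apply: cvgM; first exact: cvg_cst.
    have xp : \forall n \near \oo, ratr (p n) < x by exact: (cvgr_lt _ cp).
    rewrite indic_itvE ax /=; apply: cvg_near_cst; have [xb'|xb'] := leP x b.
      apply: filterS xp => n px; rewrite indic_itvE px/=.
      by rewrite (le_trans xb')// ltW.
    have xq : \forall n \near \oo, ratr (q n) < x by exact: (cvgr_lt _ cq).
    by apply: filterS xq => n qx; rewrite indic_itvE (leNgt x) qx andbF.
  - exact: intble_norm.
  - move=> n r _; rewrite normrM ler_piMr// indicE.
    by case: (r \in _); rewrite ?normr1 ?normr0.
have red (c d : R) : a <= c -> d <= b + 1 ->
    \int[mu]_(x in `]a, b + 1]) (G x * \1_(`]c, d]) x) = \int[mu]_(x in `]c, d]) G x.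
  move=> ac db; rewrite -[RHS]Rintegral_indic Rintegral_supp// => x.
  rewrite /= in_itv/= => /negP h; rewrite indic_itvE.
  case: (ltP c x) => cx; last by rewrite mulr0.
  case: (leP x d) => xd; last by rewrite mulr0.
  by exfalso; move/negP: h; apply; rewrite (le_lt_trans ac cx) (le_trans xd db).
rewrite red in h2; [|by []|by rewrite lerDl].
apply: (cvg_unique _ h1) => //.
rewrite (_ : (fun n => _) = fun n =>
  \int[mu]_(x in `]a, b + 1]) (G x * \1_(`]ratr (p n), ratr (q n)]) x)) //.
apply/funext => n; rewrite red ?e//.
- by rewrite ltW// (lt_trans (pb n)).
- exact: ltW.
- by rewrite (le_trans (ltW (qn n)))// lerD2l invf_le1// ler1n.
Qed.

(** What almost every time slice of the flux of a strong solution satisfies. *)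
Definition good_flux (Z G : R -> R) := [/\ continuous Z, forall x, `|Z x| <= 1,
  measurable_fun [set: mR] G, intble setT (fun x => G x ^+ 2) &
  forall a b, a <= b -> Z b - Z a = \int[mu]_(x in `]a, b]) G x].

Lemma ae_good_flux z g :
  measurable_fun (@open_half_plane R) (fun p => z p.1 p.2) ->
  {ae (mu \x mu)%E, forall p, 0 < p.1 -> `|z p.1 p.2| <= 1} ->
  {ae mu, forall t, 0 < t -> continuous (z t)} ->
  L2loc_L2 g -> weak_d_x z g ->
  {ae mu, forall r, 0 < r -> good_flux (z r) (g r)}.
Proof.
move=> mz z1 zc lg zg.
have h1 : {ae mu, forall r, forall i : nat * rat * rat, 0 < r ->
    ratr i.1.2 <= ratr i.2 :> R ->
    \int[mu]_x (after0_clamp z r x * dplateau i.1.1 (ratr i.1.2) (ratr i.2) x) =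
    - \int[mu]_x (after0 g r x * plateau i.1.1 (ratr i.1.2) (ratr i.2) x)}.
  apply: ae_all_count => -[[m p] q] /=.
  have [pq|pq] := boolP ((ratr p : R) <= ratr q).
    by apply: ae_imp (flux_plateau m mz z1 lg zg pq) => r h r0 _; exact: h.
  by apply: aeW => r _.
have z1' := ae_prod z1.
apply: ae_imp (ae_and (ae_and h1 (ae_after0_sq lg)) (ae_and zc z1')) => r.
move=> [[h2 g2] [c zr1]] r0.
have cz := c r0.
have zle : forall x, `|z r x| <= 1.
  by apply: continuous_ae_le1 => //; apply: ae_imp zr1 => x; apply.
have mg : measurable_fun [set: mR] (g r).
  have := measurable_section1 r (after0_measurable lg.1).
  by congr (measurable_fun _ _); apply/funext => x; rewrite /after0 (ltW r0).
have g2' : intble setT (fun x => g r x ^+ 2).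
  by have := g2 r0; rewrite /after0 (ltW r0).
have lG := sq_locally_integrable mg g2'.
split => //; apply: (flux_rat_real cz lG) => p q pq.
apply: flux_limit => // m.
have := h2 (m, p, q) r0 pq; rewrite /=.
rewrite /after0 (ltW r0) /after0_clamp r0 => <-.
by apply: eq_Rintegral => x _; rewrite clamp1_id.
Qed.

End flux.

(** * Difference quotients *)

Section difference_quotients.
Context {R : realType}.
Local Notation mu := (@lebesgue_measure R).
Local Notation mR := (measurableTypeR R).
Local Notation intble D f := (mu.-integrable D (EFin \o f)).
Local Notation plane_measurable F :=
  (measurable_fun [set: mR * mR] (fun p => F p.1 p.2)).
Local Notation plane_intble F :=
  ((mu \x mu)%E.-integrable [set: mR * mR] (fun p => (F p.1 p.2)%:E)).
Implicit Types (w : R -> R) (h x y r : R).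

Lemma ae_shift h (P : R -> Prop) : {ae mu, forall x, P x} -> {ae mu, forall x, P (x + h)}.
Proof.
move=> [A [mA A0 PA]].
exists ((fun x => x + h) @^-1` A); split.
- by rewrite -[X in measurable X]setTI; exact: measurable_shift.
- by rewrite -[RHS]A0 -(lebesgue_measure_shift h mA).
- by move=> x /= Px; exact: PA.
Qed.

Lemma intble_shiftB w h : intble setT w -> intble setT (fun x => w (x + h) - w x).
Proof. by move=> iw; apply: intbleB => //; exact: intble_shift. Qed.

(** An integrable profile has to come from 0 and to return to 0. The
    increment is tested against the function that is 1 up to [y] and - 1
    after [y]: translations cancel all integrals except two times that over
    ]y, y + h]. *)
Lemma shift_lower_bound w y h : intble setT w -> 0 < h ->
  2 * \int[mu]_(x in `]y, y + h]) w x <= \int[mu]_x `|w (x + h) - w x|.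
Proof.
move=> iw h0; pose sg x : R := 1 - 2 * \1_(`]y, +oo[) x.
have msg : measurable_fun [set: mR] sg.
  by apply: measurable_funB => //; apply: measurable_funM => //; exact: measurable_indic.
have sg1 x : `|sg x| <= 1.
  rewrite /sg indicE; case: (x \in _) => /=; last by rewrite mulr0 subr0 normr1.
  by rewrite mulr1 -opprB normrN; rewrite ger0_norm; lra.
have i1 : intble setT (fun x => sg x * w x).
  by apply: (@intble_bounded_mul _ _ _ _ _ _ _ 1).
have i2 : intble setT (fun x => sg x * w (x + h)).
  by apply: (@intble_bounded_mul _ _ _ _ _ _ _ 1) => //; exact: intble_shift.
have msh : measurable_fun [set: mR] (fun x => sg (x - h)).
  by apply: (measurableT_comp msg); exact: measurable_shift.
have i3 : intble setT (fun x => sg (x - h) * w x).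
  by apply: (@intble_bounded_mul _ _ _ _ _ _ _ 1).
have e2 : \int[mu]_x (sg x * w (x + h)) = \int[mu]_x (sg (x - h) * w x).
  rewrite -(Rintegral_shift h i3); apply: eq_Rintegral => x _.
  by rewrite addrK.
apply: (@le_trans _ _ (\int[mu]_x (sg x * (w (x + h) - w x)))); last first.
  apply: le_Rintegral => //.
  - apply: (@intble_bounded_mul _ _ _ _ _ _ _ 1) => //; exact: intble_shiftB.
  - by apply: intble_norm; exact: intble_shiftB.
  - move=> x _; rewrite (le_trans (ler_norm _))// normrM ler_piMl//.
rewrite (_ : \int[mu]_x (sg x * (w (x + h) - w x)) =
   \int[mu]_x (sg x * w (x + h)) - \int[mu]_x (sg x * w x)); last first.
  by rewrite -RintegralB//; apply: eq_Rintegral => x _; rewrite mulrBr.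
rewrite e2 -RintegralB// -Rintegral_indic -RintegralZl//; last first.
  have := (@intble_bounded_mul _ _ _ mu setT (\1_(`]y, y + h])) w 1 measurableT
    (measurable_indic _) _ iw).
  have hb x : [set: mR] x -> `|\1_(`]y, y + h]) x : R| <= 1.
    by move=> _; rewrite indicE; case: (_ \in _); rewrite ?normr1 ?normr0.
  move=> /(_ (measurable_itv _) hb).
  by apply: eq_integrable => // x _ /=; rewrite mulrC.
rewrite le_eqVlt; apply/orP; left; apply/eqP; apply: eq_Rintegral => x _.
rewrite -mulrBl /sg indic_itvE !indicE !mem_setE !in_itv/= !andbT ltrBrDr.
case: (ltP y x) => yx; case: (leP x (y + h)) => xh /=; try ring.
exfalso; lra.
Qed.

Lemma difference_quotient_le w C : intble setT w ->
  (forall h, 0 < h -> \int[mu]_x `|w (x + h) - w x| <= C * h) ->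
  {ae mu, forall x, 2 * w x <= C}.
Proof.
move=> iw wC; have lw := intble_locally iw.
apply: ae_imp (lebesgue_differentiation lw) => x wx.
have h1 := lebesgue_avg lw wx.
have h2 : 2 * (n.+1%:R * \int[mu]_(y in `]x, x + n.+1%:R^-1]) w y) @[n --> \oo] --> 2 * w x.
  by apply: cvgM => //; exact: cvg_cst.
apply: (cvgr_to_le h2); apply: nearW => n.
have n0 : 0 < n.+1%:R :> R by rewrite ltr0n.
have hn := invn_gt0 (R := R) n.
have := le_trans (shift_lower_bound x iw hn) (wC _ hn).
rewrite -(ler_pM2l n0) mulrCA => h3; apply: (le_trans h3).
by rewrite mulrCA divff ?mulr1// gt_eqF.
Qed.

Lemma bv_bounded w C : intble setT w ->
  (forall h, 0 < h -> \int[mu]_x `|w (x + h) - w x| <= C * h) ->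
  {ae mu, forall x, `|w x| <= C}.
Proof.
move=> iw wC.
have := @difference_quotient_le (fun x => `|w x|) C (intble_norm iw).
have C0 : 0 <= C.
  have := wC 1 ltr01; rewrite mulr1; apply: le_trans; exact: Rintegral_ge0.
move=> h; apply: ae_imp (h _) => [x|r r0].
  by have := normr_ge0 (w x); lra.
apply: le_trans (wC r r0); apply: le_Rintegral => //.
- by apply: intble_norm; exact: (intble_shiftB _ (intble_norm iw)).
- by apply: intble_norm; exact: intble_shiftB.
- by move=> x _; exact: ler_dist_dist.
Qed.

(** A function of bounded variation is bounded, hence its modulus of
    continuity in L^1 controls the one in L^2. *)
Lemma bv_shift_sq w C : intble setT w ->
  (forall h, 0 < h -> \int[mu]_x `|w (x + h) - w x| <= C * h) ->
  intble setT (fun x => w x ^+ 2) ->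
  forall h, 0 < h -> \int[mu]_x ((w (x + h) - w x) ^+ 2) <= 2 * C ^+ 2 * h.
Proof.
move=> iw wC w2 h h0; have wb := bv_bounded iw wC.
have mw := intble_meas iw.
have C0 : 0 <= C.
  have := wC 1 ltr01; rewrite mulr1; apply: le_trans; exact: Rintegral_ge0.
have i2 : intble setT (fun x => (w (x + h) - w x) ^+ 2).
  apply: intble_sqB => //; last exact: (intble_shift h w2).
  by apply: (measurableT_comp mw); exact: measurable_shift.
have i1 := intble_norm (intble_shiftB h iw).
apply: (@le_trans _ _ (\int[mu]_x (2 * C * `|w (x + h) - w x|))).
  apply: ae_le_Rintegral => //; first exact: intbleZ.
  apply: ae_imp (ae_and wb (ae_shift h wb)) => x [h1 h2] _.
  rewrite -(real_normK (num_real (_ - _))) expr2 ler_wpM2r//.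
  by apply: (le_trans (ler_normB _ _)); lra.
rewrite RintegralZl//.
have := wC h h0 => hw.
have := ler_wpM2l (mulr_ge0 (ler0n R 2) C0) hw.
by move/le_trans; apply; rewrite expr2; lra.
Qed.

(** Z y - Z (y - h) is the integral of [G] over ]y - h, y]; the exchange of
    the integrals moves the translation from [G] to [w]. *)
Lemma translation_average w (Z G : R -> R) h : good_flux Z G -> 0 < h ->
  intble setT w -> intble setT (fun x => w x ^+ 2) ->
  intble `]- h, 0] (fun r => \int[mu]_y (w (y - r) * G y)) /\
  \int[mu]_y (w y * (Z y - Z (y - h))) =
    \int[mu]_(r in `]- h, 0]) \int[mu]_y (w (y - r) * G y).
Proof.
move=> [cZ Z1 mG G2 ZG] h0 iw w2; have mw := intble_meas iw.
pose F (r y : mR) : R := \1_(`]- h, 0]) r * (w y * G (y + r)).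
have mF : plane_measurable F.
  apply: measurable_funM; first by apply: prod_measurable1; exact: measurable_indic.
  apply: measurable_funM; first exact: prod_measurable2.
  apply: (measurableT_comp (f := G) (g := fun p : mR * mR => p.2 + p.1 : mR)) => //.
  by apply: measurable_funD; [exact: measurable_snd|exact: measurable_fst].
have G2s r : intble setT (fun y => G (y + r) ^+ 2) by exact: (intble_shift r G2).
have iwG r : intble setT (fun y => w y * G (y + r)).
  apply: intble_mul2 => //.
  by apply: (measurableT_comp mG); exact: measurable_shift.
have iF : plane_intble F.
  apply: (prod_intble_lty (f := F)) => //.
  pose c := \int[mu]_y (w y ^+ 2) + \int[mu]_y (G y ^+ 2).
  have bnd r : (\int[mu]_y (`|F r y|)%:E <= (\1_(`]- h, 0]) r * c)%:E)%E.
    have iFr : intble setT (F r) by exact: (intbleZ (\1_(`]- h, 0]) r) measurableT (iwG r)).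
    rewrite -(EFin_Rintegral measurableT (intble_norm iFr)) lee_fin.
    have -> : c = \int[mu]_y (w y ^+ 2 + G (y + r) ^+ 2).
      by rewrite RintegralD// (Rintegral_shift r G2).
    have iD := intbleD measurableT w2 (G2s r).
    rewrite -RintegralZl//; apply: le_Rintegral => //.
    - exact: intble_norm.
    - exact: intbleZ.
    - by move=> y _; rewrite /F normrM ger0_norm// ler_wpM2l// normrM_le_sqD.
  apply: (@le_lt_trans _ _ (\int[mu]_r (\1_(`]- h, 0]) r * c)%:E)%E).
    apply: ge0_le_integral => //.
    - by move=> r _; apply: integral_ge0.
    - have mA : measurable_fun [set: mR * mR] (fun p : mR * mR => (`|F p.1 p.2|)%:E).
        by apply/measurable_EFinP; exact: measurableT_comp.
      exact: (measurable_fun_fubini_tonelli_F (m2 := mu)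
        (fun p : mR * mR => (`|F p.1 p.2|)%:E)).
    - by apply/measurable_EFinP; apply: measurable_funM => //; exact: measurable_indic.
  have i1 : intble setT (fun r => \1_(`]- h, 0]) r * c).
    apply: (@intble_supp _ `]- h, 0]) => //.
    - by move=> x xI; rewrite indicE memNset// mul0r.
    - have := intble_cst_itv c (- h) 0; apply: eq_integrable => // x xI /=.
      by rewrite indicE xI mul1r.
  by rewrite -(EFin_Rintegral measurableT i1) ltry.
have eF r : \int[mu]_y F r y = \int[mu]_y (w (y - r) * G y) * \1_(`]- h, 0]) r.
  rewrite /F RintegralZl// mulrC; congr (_ * _).
  have iw2 : intble setT (fun y => w (y - r) * G y).
    have := intble_shift (- r) (iwG r); apply: eq_integrable => // y _ /=.
    by rewrite subrK.
  by rewrite -(Rintegral_shift r iw2); apply: eq_Rintegral => y _; rewrite addrK.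
split.
  have mI : measurable (`]- h, 0] : set mR) by exact: measurable_itv.
  have := integrableS measurableT mI (@subsetT _ _) (intble_integral_section iF).
  by apply: eq_integrable => // r rI /=; rewrite eF indicE rI mulr1.
rewrite -[RHS]Rintegral_indic.
transitivity (\int[mu]_y \int[mu]_r F r y).
  apply: eq_Rintegral => y _.
  have -> : Z y - Z (y - h) = \int[mu]_(x in `](y - h), y]) G x.
    by apply: ZG; rewrite gerBl ltW.
  have lG := sq_locally_integrable mG G2.
  have iGy : intble setT (fun x => G x * \1_(`](y - h), y]) x).
    apply: (@intble_supp _ `](y - h), y]) => //.
    - by move=> x xI; rewrite indicE memNset// mulr0.
    - have : intble `](y - h), y] G.
        apply: (intble_itv _ lG (@subset_itv_oc_cc _ _ (y - h) y)); exact: measurable_itv.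
      by apply: eq_integrable => // x xI /=; rewrite indicE xI mulr1.
  rewrite -Rintegral_indic -(Rintegral_shift y iGy) -RintegralZl//; last first.
    exact: (intble_shift y iGy).
  apply: eq_Rintegral => r _; rewrite /F !indic_itvE (addrC r y).
  rewrite ltrBlDl addrCA ltrDl (_ : (0 < h + r) = (- h < r)); last first.
    by rewrite -ltrBlDl sub0r.
  by rewrite gerDl; ring.
by rewrite -(Rfubini iF); apply: eq_Rintegral => r _; exact: eF.
Qed.

(** The parameter makes the integral of G ^ 2 count as little as needed when
    that of p ^ 2 is small. *)
Lemma Rintegral_mul_young (p G : R -> R) lam : 0 < lam ->
  measurable_fun [set: mR] p -> measurable_fun [set: mR] G ->
  intble setT (fun x => p x ^+ 2) -> intble setT (fun x => G x ^+ 2) ->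
  `|\int[mu]_x (p x * G x)| <=
    lam^-1 * \int[mu]_x (p x ^+ 2) + lam * \int[mu]_x (G x ^+ 2).
Proof.
move=> l0 mp mG p2 G2; have ipG := intble_mul2 measurableT mp mG p2 G2.
apply: (le_trans (le_normr_Rintegral measurableT ipG)).
rewrite -!RintegralZl// -RintegralD//; try exact: intbleZ.
apply: le_Rintegral => //.
- exact: intble_norm.
- by apply: intbleD => //; exact: intbleZ.
move=> x _; rewrite normrM -(real_normK (num_real (p x))) -(real_normK (num_real (G x))).
move: `|p x| `|G x| (normr_ge0 (p x)) (normr_ge0 (G x)) => a b a0 b0.
have := sqr_ge0 (a - lam * b); rewrite sqrrB exprMn => h.
have ab : 0 <= lam * (a * b) by rewrite !mulr_ge0// ltW.
rewrite -(ler_pM2l l0) mulrDr (mulrA lam lam^-1) divff ?gt_eqF// mul1r.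
lra.
Qed.

(** By [translation_average] only the translates of [w] have to converge in
    L^2, and [B] gives a rate for them. *)
Lemma translation_average_cvg w (Z G : R -> R) B : good_flux Z G ->
  intble setT w -> intble setT (fun x => w x ^+ 2) ->
  (forall h, 0 < h -> \int[mu]_x ((w (x + h) - w x) ^+ 2) <= B * h) ->
  n.+1%:R * \int[mu]_y (w y * (Z y - Z (y - n.+1%:R^-1))) @[n --> \oo] -->
    \int[mu]_y (w y * G y).
Proof.
move=> gZ iw w2 wB; have mw := intble_meas iw.
have mG : measurable_fun [set: mR] G by case: gZ.
have G2 : intble setT (fun x => G x ^+ 2) by case: gZ.
have iwG := intble_mul2 measurableT mw mG w2 G2.
have B0 : 0 <= B.
  have := wB 1 ltr01; rewrite mulr1; apply: le_trans.
  by apply: Rintegral_ge0 => x _; exact: sqr_ge0.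
pose c r := \int[mu]_y (w (y - r) * G y).
pose G2n := \int[mu]_x (G x ^+ 2).
have G2n0 : 0 <= G2n by apply: Rintegral_ge0 => x _; exact: sqr_ge0.
have cb lam h r : 0 < lam -> r \in `]- h, 0] ->
    `|c r - \int[mu]_y (w y * G y)| <= lam^-1 * (B * h) + lam * G2n.
  move=> l0; rewrite in_itv/= => /andP[hr r0].
  have ms : measurable_fun [set: mR] (fun y => w (y - r)).
    by apply: (measurableT_comp mw); exact: measurable_shift.
  have s2 : intble setT (fun y => w (y - r) ^+ 2) by exact: (intble_shift (- r) w2).
  rewrite /c -RintegralB//; last exact: intble_mul2.
  under eq_Rintegral do rewrite -mulrBl.
  have md : measurable_fun [set: mR] (fun y => w (y - r) - w y).
    exact: measurable_funB.
  have d2 := intble_sqB ms mw s2 w2.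
  have h1 := Rintegral_mul_young l0 md mG d2 G2.
  apply: (le_trans h1); rewrite lerD2r ler_wpM2l ?invr_ge0 ?(ltW l0)//.
  have [->|rn0] := eqVneq r 0.
    under eq_Rintegral do rewrite subr0 subrr expr0n.
    rewrite Rintegral_cst// mul0r mulr_ge0//; lra.
  have r0' : 0 < - r by rewrite oppr_gt0 lt_neqAle rn0.
  apply: (le_trans (wB _ r0')); rewrite ler_wpM2l//; lra.
apply/cvgrPdist_le => e e0.
pose lam := e / 2 / (G2n + 1).
have G1 : 0 < G2n + 1 by rewrite ltr_wpDl.
have B1 : 0 < B + 1 by rewrite ltr_wpDl.
have e2 : 0 < e / 2 by rewrite divr_gt0.
have l0 : 0 < lam by rewrite divr_gt0.
have hh : n.+1%:R^-1 @[n --> \oo] --> (0 : R) by exact: cvg_harmonic.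
have e1 : 0 < e / 2 * lam / (B + 1) by exact: divr_gt0 (mulr_gt0 e2 l0) B1.
move/cvgr0Pnorm_le : hh => /(_ _ e1); apply: filterS => n.
have hn := invn_gt0 (R := R) n.
rewrite gtr0_norm// => hne.
have [ic ->] := translation_average gZ hn iw w2.
have n0 : 0 < n.+1%:R :> R by rewrite ltr0n.
have E (K : R) : K = n.+1%:R * \int[mu]_(r in `]- n.+1%:R^-1, 0]) K.
  rewrite Rintegral_cst// fine_lebesgue_itv ?oppr_le0 ?(ltW hn)// sub0r opprK.
  by rewrite mulrCA divff ?mulr1// pnatr_eq0.
rewrite [X in `|X - _|]E -mulrBr normrM (gtr0_norm n0).
rewrite -RintegralB//; last exact: intble_cst_itv.
rewrite [X in _ <= X]E ler_pM2l//.
apply: (le_trans (le_normr_Rintegral _ _)) => //.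
  by apply: intbleB => //; exact: intble_cst_itv.
apply: le_Rintegral => //.
- by apply: intble_norm; apply: intbleB => //; exact: intble_cst_itv.
- exact: intble_cst_itv.
move=> r rI; rewrite distrC; apply: (le_trans (cb lam _ r l0 rI)).
have h1 : lam * G2n <= e / 2.
  rewrite /lam mulrAC ler_pdivrMr// ler_wpM2l ?(ltW e2)//.
  by rewrite lerDl.
have h2 : lam^-1 * (B * n.+1%:R^-1) <= e / 2.
  rewrite ler_pdivrMl//.
  apply: (le_trans (ler_wpM2l B0 hne)).
  rewrite mulrCA (mulrC lam); apply: ler_piMr.
    exact: ltW (mulr_gt0 e2 l0).
  by rewrite ler_pdivrMr// mul1r lerDl.
by rewrite [leRHS](splitr e) lerD.
Qed.

(** Summation by parts. *)
Lemma flux_summation w (Z G : R -> R) h : good_flux Z G -> intble setT w ->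
  \int[mu]_y (w y * (Z y - Z (y - h))) =
  - (\int[mu]_y (Z y * (w (y + h) - w y))).
Proof.
move=> [cZ Z1 _ _ _] iw.
have mZ : measurable_fun [set: mR] Z by exact: continuous_measurable_fun.
have mZh : measurable_fun [set: mR] (fun y => Z (y - h)).
  by apply: (measurableT_comp mZ); exact: measurable_shift.
have i1 : intble setT (fun y => Z y * w y).
  exact: (@intble_bounded_mul _ _ _ _ _ _ _ 1).
have i2 : intble setT (fun y => Z y * w (y + h)).
  by apply: (@intble_bounded_mul _ _ _ _ _ _ _ 1) => //; exact: intble_shift.
have i3 : intble setT (fun y => Z (y - h) * w y).
  exact: (@intble_bounded_mul _ _ _ _ _ _ _ 1).
under [in RHS]eq_Rintegral do rewrite mulrBr.
rewrite RintegralB// opprB.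
have -> : \int[mu]_y (Z y * w (y + h)) = \int[mu]_y (Z (y - h) * w y).
  by rewrite -(Rintegral_shift h i3); apply: eq_Rintegral => y _; rewrite addrK.
by rewrite -RintegralB//; apply: eq_Rintegral => y _; rewrite mulrC mulrBl.
Qed.

Lemma flux_duality w (Z G : R -> R) h : good_flux Z G -> intble setT w ->
  - (\int[mu]_y (w y * (Z y - Z (y - h)))) <= \int[mu]_x `|w (x + h) - w x|.
Proof.
move=> gZ iw; have fs := flux_summation h gZ iw.
have -> : (- (\int[mu]_y (w y * (Z y - Z (y - h))))) = \int[mu]_y (Z y * (w (y + h) - w y)).
  by rewrite fs opprK.
have [cZ Z1 _ _ _] := gZ.
have mZ : measurable_fun [set: mR] Z by exact: continuous_measurable_fun.
apply: (@le_Rintegral _ _ _ mu setT) => //.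
- by apply: (@intble_bounded_mul _ _ _ _ _ _ _ 1) => //; exact: intble_shiftB.
- by apply: intble_norm; exact: intble_shiftB.
- by move=> y _; rewrite (le_trans (ler_norm _))// normrM ler_piMl.
Qed.

End difference_quotients.

(** * Measure derivatives *)

Section finite_measure_windows.
Context {R : realType}.
Local Notation mu := (@lebesgue_measure R).
Local Notation mR := (measurableTypeR R).
Local Notation intble D f := (mu.-integrable D (EFin \o f)).
Variable m : {finite_measure set (measurableTypeR R) -> \bar R}.

Lemma finite_intble_bounded (f : R -> R) (C : R) : measurable_fun [set: mR] f ->
  (forall x, `|f x| <= C) -> m.-integrable setT (EFin \o f).
Proof.
move=> mf fC; apply: (@intble_le _ _ _ m setT _ (fun=> C)) => //.
exact: finite_measure_integrable_cst.
Qed.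

(** In [s] this is an interval to the right of [x], in [x] an interval to
    the left of [s]: Fubini's theorem turns masses of intervals into
    averages of test functions. *)
Definition window (h : R) (x s : mR) : R := \1_(`]x, x + h]) s.

Lemma windowE h x s : window h x s = ((x < s) && (s <= x + h))%:R.
Proof. exact: indic_itvE. Qed.

Lemma window_le1 h x s : `|window h x s| <= 1.
Proof. by rewrite windowE; case: (_ && _); rewrite ?normr1 ?normr0. Qed.

Lemma measurable_window h :
  measurable_fun [set: mR * mR] (fun p => window h p.1 p.2).
Proof.
have m1 : measurable_fun [set: mR * mR] (fun p => p.1 : R) by exact: measurable_fst.
have m2 : measurable_fun [set: mR * mR] (fun p => p.2 : R) by exact: measurable_snd.
have m3 : measurable_fun [set: mR * mR] (fun p => (p.1 : R) < p.2).
  exact: measurable_fun_ltr.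
have m4 : measurable_fun [set: mR * mR] (fun p => (p.2 : R) <= p.1 + h).
  by apply: measurable_fun_ler => //; exact: measurable_funD.
have m5 := measurable_and m3 m4.
rewrite (_ : (fun p => _) = (fun p : mR * mR =>
  if (p.1 < p.2) && (p.2 <= p.1 + h) then 1 else 0)); last first.
  by apply/funext => p; rewrite windowE; case: (_ && _).
by apply: measurable_fun_ifT => //.
Qed.

Lemma windowL_int h (Z : R -> R) s : 
  (fun x => Z x * window h x s) = (fun x => Z x * \1_(`[s - h, s[) x).
Proof.
apply/funext => x; by rewrite windowE indicE mem_setE in_itv/= lerBlDr andbC.
Qed.

Lemma fine_lebesgue_itvco (a b : R) : a <= b -> fine (mu `[a, b[) = b - a.
Proof.
rewrite lebesgue_measure_itv/= lte_fin le_eqVlt => /predU1P[->|->//].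
by rewrite ltxx subrr.
Qed.

Lemma intble_windowL h (Z : R -> R) s : 0 < h -> measurable_fun [set: mR] Z ->
  (forall x, `|Z x| <= 1) -> intble `[s - h, s[ Z.
Proof.
move=> h0 mZ Z1; have mI : measurable (`[s - h, s[ : set mR) by exact: measurable_itv.
apply: (@intble_le _ _ _ mu `[s - h, s[ Z (fun=> 1)) => //.
  exact: measurable_funTS.
apply: (intble_itv mI (locally_integrable_cst 1)).
exact: subset_itv_co_cc.
Qed.

Lemma windowL_bound h (Z : R -> R) s : 0 < h -> measurable_fun [set: mR] Z ->
  (forall x, `|Z x| <= 1) -> `|\int[mu]_x (Z x * window h x s)| <= h.
Proof.
move=> h0 mZ Z1; rewrite windowL_int Rintegral_indic.
have iZ := intble_windowL s h0 mZ Z1.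
apply: (le_trans (le_normr_Rintegral _ iZ)) => //.
have e : \int[mu]_(x in `[s - h, s[) 1 = h.
  rewrite Rintegral_cst// fine_lebesgue_itvco ?mul1r; first by rewrite subKr.
  by rewrite lerBlDr lerDl ltW.
rewrite -[leRHS]e.
apply: le_Rintegral => //; first exact: intble_norm.
by apply: (intble_windowL s h0 _ _) => // x; rewrite normr1.
Qed.

Lemma window_intble h (Z : R -> R) : 0 < h -> measurable_fun [set: mR] Z ->
  (forall x, `|Z x| <= 1) ->
  (m \x mu)%E.-integrable [set: mR * mR] (fun p => (Z p.2 * window h p.2 p.1)%:E).
Proof.
move=> h0 mZ Z1.
have mF : measurable_fun [set: mR * mR] (fun p => Z p.2 * window h p.2 p.1).
  apply: measurable_funM; first exact: (prod_measurable2 (T1 := mR) mZ).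
  exact: (prod_measurable_swap (measurable_window h)).
apply: (prod_intble_lty (f := fun s x : mR => Z x * window h x s)) => //.
apply: (@le_lt_trans _ _ (\int[m]_s h%:E)%E).
  apply: ge0_le_integral => //.
  - by move=> s _; apply: integral_ge0.
  - have mA : measurable_fun [set: mR * mR] (fun p : mR * mR => (`|Z p.2 * window h p.2 p.1|)%:E).
      by apply/measurable_EFinP; exact: measurableT_comp.
    exact: (measurable_fun_fubini_tonelli_F (m2 := mu)
      (fun p : mR * mR => (`|Z p.2 * window h p.2 p.1|)%:E)).
  - move=> s _.
    have iZ := intble_windowL s h0 mZ Z1.
    have i1 : intble setT (fun x => Z x * window h x s).
      rewrite windowL_int; apply: (@intble_supp _ `[s - h, s[) => //.
        by move=> x xI; rewrite indicE memNset// mulr0.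
      by apply: eq_integrable iZ => // x xI /=; rewrite indicE xI mulr1.
    rewrite -(EFin_Rintegral measurableT (intble_norm i1)) lee_fin.
    have := windowL_bound s h0 (measurableT_comp (@normr_measurable _ _) mZ).
    have Zn x : `| `|Z x| | <= 1 by rewrite normr_id.
    move=> /(_ Zn) /ler_normlW; apply: le_trans.
    rewrite le_eqVlt; apply/orP; left; apply/eqP; apply: eq_Rintegral => x _.
    by rewrite normrM [X in _ * X]ger0_norm// windowE ler0n.
rewrite integral_cst//= lte_mul_pinfty ?lee_fin ?(ltW h0)//.
by rewrite ltey_eq fin_num_measure.
Qed.

Lemma finite_window h x : \int[m]_s window h x s = fine (m [set` `]x, x + h]]).
Proof.
rewrite /Rintegral /window; congr fine; rewrite integral_indic ?setIT//.
Qed.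

Lemma window_measure_fubini h (Z : R -> R) : 0 < h -> measurable_fun [set: mR] Z ->
  (forall x, `|Z x| <= 1) ->
  intble setT (fun x => Z x * fine (m [set` `]x, x + h]])) /\
  \int[mu]_x (Z x * fine (m [set` `]x, x + h]])) =
  \int[m]_s \int[mu]_x (Z x * window h x s).
Proof.
move=> h0 mZ Z1; have iF := window_intble h0 mZ Z1.
have iW x : m.-integrable setT (EFin \o window h x).
  apply: (finite_intble_bounded (C := 1)); last exact: window_le1.
  exact: measurable_indic.
have e x : Z x * fine (m [set` `]x, x + h]]) = \int[m]_s (Z x * window h x s).
  by rewrite -finite_window RintegralZl.
split.
  have := intble_integral_section (f := fun x s : mR => Z x * window h x s)
    (prod_intble_swap (f := fun s x : mR => Z x * window h x s) iF).
  by apply: eq_integrable => // x _ /=; rewrite e.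
rewrite (Rfubini (f := fun s x : mR => Z x * window h x s) iF).
by apply: eq_Rintegral => x _; exact: e.
Qed.

Lemma left_average_cvg (Z : R -> R) s : continuous Z -> (forall x, `|Z x| <= 1) ->
  n.+1%:R * \int[mu]_x (Z x * window n.+1%:R^-1 x s) @[n --> \oo] --> Z s.
Proof.
move=> cZ Z1; have mZ : measurable_fun [set: mR] Z by exact: continuous_measurable_fun.
apply/cvgrPdist_le => e e0.
have := cZ s => /cvgrPdist_le /(_ e e0) /nbhs_ballP [d d0 hd].
have hh : n.+1%:R^-1 @[n --> \oo] --> (0 : R) by exact: cvg_harmonic.
move/cvgr0Pnorm_lt : hh => /(_ _ d0); apply: filterS => n.
have hn := invn_gt0 (R := R) n; rewrite gtr0_norm// => hnd.
have n0 : 0 < n.+1%:R :> R by rewrite ltr0n.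
set h := n.+1%:R^-1 in hn hnd *.
have hs : s - h <= s by rewrite lerBlDr lerDl ltW.
have E (K : R) : K = n.+1%:R * \int[mu]_(r in `[s - h, s[) K.
  rewrite Rintegral_cst// fine_lebesgue_itvco// subKr.
  by rewrite mulrCA /h divff ?mulr1// pnatr_eq0.
rewrite windowL_int Rintegral_indic.
have iK (K : R) : intble `[s - h, s[ (fun=> K).
  apply: (intble_itv _ (locally_integrable_cst K) (@subset_itv_co_cc _ _ (s - h) s)).
  exact: measurable_itv.
have iZ := intble_windowL s hn mZ Z1.
rewrite [X in `|X - _|]E -mulrBr normrM (gtr0_norm n0) -RintegralB//.
rewrite [leRHS]E ler_pM2l//.
apply: (le_trans (le_normr_Rintegral _ _)) => //; first exact: intbleB.
apply: le_Rintegral => //; first by apply: intble_norm; exact: intbleB.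
move=> x; rewrite /= in_itv/= => /andP[sx xs]; apply: hd.
rewrite /ball/= ger0_norm ?subr_ge0 ?(ltW xs)//.
by apply: le_lt_trans hnd; rewrite lerBlDr -lerBlDl.
Qed.

(** The functions m ]x, x + h] / h converge weakly to the measure [m]. *)
Lemma window_average_cvg (Z : R -> R) : continuous Z -> (forall x, `|Z x| <= 1) ->
  n.+1%:R * \int[mu]_x (Z x * fine (m [set` `]x, x + n.+1%:R^-1]])) @[n --> \oo] -->
  \int[m]_s Z s.
Proof.
move=> cZ Z1; have mZ : measurable_fun [set: mR] Z by exact: continuous_measurable_fun.
have mW n : measurable_fun [set: mR]
    (fun s => \int[mu]_x (Z x * window n.+1%:R^-1 x s)).
  have iF := window_intble (invn_gt0 (R := R) n) mZ Z1.
  exact: (measurable_integral_section _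
    (prod_intble_meas (f := fun s x : mR => Z x * window n.+1%:R^-1 x s) iF)).
have bW n s : `|n.+1%:R * \int[mu]_x (Z x * window n.+1%:R^-1 x s)| <= 1.
  rewrite normrM normr_nat -ler_pdivlMl ?ltr0n// mulr1.
  exact: (windowL_bound s (invn_gt0 (R := R) n) mZ Z1).
rewrite (_ : (fun n => _) = fun n : nat =>
    \int[m]_s (n.+1%:R * \int[mu]_x (Z x * window n.+1%:R^-1 x s))); last first.
  apply/funext => n; rewrite (window_measure_fubini (invn_gt0 (R := R) n) mZ Z1).2.
  rewrite RintegralZl//.
  apply: (finite_intble_bounded (C := n.+1%:R^-1)) => // s.
  exact: (windowL_bound s (invn_gt0 (R := R) n) mZ Z1).
apply: (@Rintegral_dominated _ _ _ m setT _ _ (fun=> 1)) => //.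
- by move=> n; apply: measurable_funM.
- by apply: aeW => s _; exact: left_average_cvg.
- exact: finite_measure_integrable_cst.
Qed.

Lemma window_total h : 0 < h ->
  intble setT (fun x => fine (m [set` `]x, x + h]])) /\
  \int[mu]_x fine (m [set` `]x, x + h]]) = h * fine (m setT).
Proof.
move=> h0.
have one1 (x : R) : `|1 : R| <= 1 by rewrite normr1.
have [i e] := window_measure_fubini h0 (measurable_cst (1 : R)) one1.
split; first by apply: eq_integrable i => // x _ /=; rewrite mul1r.
under eq_Rintegral do rewrite -[fine _]mul1r.
rewrite e -Rintegral_cst//; apply: eq_Rintegral => s _.
rewrite windowL_int Rintegral_indic Rintegral_cst// fine_lebesgue_itvco ?mul1r ?subKr//.
by rewrite lerBlDr lerDl ltW.
Qed.

End finite_measure_windows.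

Section bv_slices.
Context {R : realType}.
Local Notation mu := (@lebesgue_measure R).
Local Notation mR := (measurableTypeR R).
Local Notation intble D f := (mu.-integrable D (EFin \o f)).
Variable D : realCharge R.

Local Notation mp := (jordan_pos (hahn D)).
Local Notation mn := (jordan_neg (hahn D)).

Lemma charge_integralE (f : R -> R) (C : R) : measurable_fun [set: mR] f ->
  (forall x, `|f x| <= C) ->
  charge_integral D f = (\int[mp]_x f x - \int[mn]_x f x)%:E.
Proof.
move=> mf fC; rewrite /charge_integral.
have ip := finite_intble_bounded mp mf fC.
have inn := finite_intble_bounded mn mf fC.
by rewrite -(EFin_Rintegral measurableT ip) -(EFin_Rintegral measurableT inn).
Qed.

Lemma charge_total_variationE :
  charge_total_variation D = (fine (mp setT) + fine (mn setT))%:E.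
Proof.
rewrite /charge_total_variation /charge_variation /= EFinD !fineK//;
  exact: fin_num_measure.
Qed.

Lemma charge_integral_le (f : R -> R) : measurable_fun [set: mR] f ->
  (forall x, `|f x| <= 1) -> (charge_integral D f <= charge_total_variation D)%E.
Proof.
move=> mf f1; rewrite (charge_integralE mf f1) charge_total_variationE lee_fin.
have h (m : {finite_measure set mR -> \bar R}) : `|\int[m]_x f x| <= fine (m setT).
  have i := finite_intble_bounded m mf f1.
  apply: (le_trans (le_normr_Rintegral measurableT i)).
  rewrite -[leRHS]mul1r -Rintegral_cst//.
  apply: le_Rintegral => //; first exact: intble_norm.
  exact: finite_measure_integrable_cst.
have := h mp; have := h mn; rewrite !ler_norml => /andP[? ?] /andP[? ?].
lra.
Qed.

Definition interval_mass (x h : R) : R :=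
  fine (mp [set` `]x, x + h]]) - fine (mn [set` `]x, x + h]]).

(** The plateaus over ]x, x + h] tend to its indicator and their derivatives
    to the difference of the Dirac masses at the two ends, provided that
    both ends are Lebesgue points of [u]. *)
Lemma bv_increment (u : R -> R) h : intble setT u -> distributional_derivative u D ->
  0 < h -> {ae mu, forall x, u (x + h) - u x = interval_mass x h}.
Proof.
move=> iu uD h0; have lu := intble_locally iu.
have luh := intble_locally (intble_shift h iu).
apply: ae_imp (ae_and (lebesgue_differentiation lu) (lebesgue_differentiation luh)) => x [l1 l2].
have xh : x <= x + h by rewrite lerDl ltW.
have h1 := dstep_at_cvg lu l1.
have h2 := dstep_at_cvg luh l2.
have e n : \int[mu]_y (dstep_at n x y * u y) - \int[mu]_y (dstep_at n x y * u (y + h)) =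
    - (\int[mp]_y plateau n x (x + h) y - \int[mn]_y plateau n x (x + h) y).
  have mpl : measurable_fun [set: mR] (plateau n x (x + h)).
    exact: (box_bounded_plateau n xh).1.
  have := uD _ (plateau_test_function n xh).
  rewrite (charge_integralE mpl (plateau_le1 n x (x + h))) derive1_plateau -EFinN.
  have id1 := intble_dstep_mul n x lu; have id2 := intble_dstep_mul n (x + h) lu.
  have idp : intble setT (fun y => u y * dplateau n x (x + h) y).
    have := intbleB measurableT id1 id2; apply: eq_integrable => // y _ /=.
    by rewrite -mulrBl mulrC.
  rewrite -(EFin_Rintegral measurableT idp) => -[<-].
  have -> : \int[mu]_y (dstep_at n x y * u (y + h)) = \int[mu]_y (dstep_at n (x + h) y * u y).
    rewrite -(Rintegral_shift h id2); apply: eq_Rintegral => y _.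
    by rewrite /dstep_at (addrC x h) addrKA.
  rewrite -(RintegralB measurableT id1 id2); apply: eq_Rintegral => y _.
  by rewrite -mulrBl mulrC.
have pl (m : {finite_measure set mR -> \bar R}) :
    \int[m]_y plateau n x (x + h) y @[n --> \oo] --> fine (m [set` `]x, x + h]]).
  rewrite -(finite_window m h x).
  apply: (@Rintegral_dominated _ _ _ m setT _ _ (fun=> 1)) => //.
  - by move=> n; exact: (box_bounded_plateau n xh).1.
  - exact: measurable_indic.
  - by apply: aeW => s _; exact: plateau_cvg.
  - exact: finite_measure_integrable_cst.
  - by move=> n y _; exact: plateau_le1.
have h4 : (- (\int[mp]_y plateau n x (x + h) y - \int[mn]_y plateau n x (x + h) y))
    @[n --> \oo] --> - interval_mass x h.
  by apply: cvgN; apply: cvgB; exact: pl.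
have h5 : (- (\int[mp]_y plateau n x (x + h) y - \int[mn]_y plateau n x (x + h) y))
    @[n --> \oo] --> u x - u (x + h).
  rewrite (_ : (fun n => _) = (fun n => \int[mu]_y (dstep_at n x y * u y) -
      \int[mu]_y (dstep_at n x y * u (y + h)))).
    exact: cvgB.
  by apply/funext => n; rewrite e.
have h6 : - interval_mass x h = u x - u (x + h) by exact: (cvg_unique _ h4 h5).
by rewrite -[RHS]opprK h6 opprB.
Qed.

Lemma bv_difference_quotient (u : R -> R) h : intble setT u ->
  distributional_derivative u D -> 0 < h ->
  \int[mu]_x `|u (x + h) - u x| <= fine (charge_total_variation D) * h.
Proof.
move=> iu uD h0.
have [ip ep] := window_total mp h0; have [inn en] := window_total mn h0.
rewrite charge_total_variationE /= mulrDl mulrC -ep [X in _ + X]mulrC -en -RintegralD//.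
apply: ae_le_Rintegral => //.
- by apply: intble_norm; exact: intble_shiftB.
- exact: intbleD.
- apply: ae_imp (bv_increment iu uD h0) => x -> _.
  rewrite /interval_mass (le_trans (ler_normB _ _))//.
  by rewrite !ger0_norm ?fine_ge0.
Qed.

(** The distributional derivative cannot be tested against [Z], which is
    neither smooth nor compactly supported. The measure is replaced by its
    averages over the intervals ]x, x + h], which are the increments of [u]
    divided by [h]; these are summed by parts before [h] tends to 0. *)
Lemma charge_integral_flux (u Z G : R -> R) : intble setT u ->
  intble setT (fun x => u x ^+ 2) -> distributional_derivative u D -> good_flux Z G ->
  charge_integral D Z = (- \int[mu]_x (u x * G x))%:E.
Proof.
move=> iu u2 uD gZ; have [cZ Z1 _ _ _] := gZ.
have mZ : measurable_fun [set: mR] Z by exact: continuous_measurable_fun.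
rewrite (charge_integralE mZ Z1); congr EFin.
pose C := fine (charge_total_variation D).
have uC h : 0 < h -> \int[mu]_x `|u (x + h) - u x| <= C * h.
  exact: bv_difference_quotient.
have h1 := translation_average_cvg gZ iu u2 (bv_shift_sq iu uC u2).
have h2 : (- (n.+1%:R * \int[mu]_x (Z x * fine (mp [set` `]x, x + n.+1%:R^-1]])) -
     n.+1%:R * \int[mu]_x (Z x * fine (mn [set` `]x, x + n.+1%:R^-1]])))) @[n --> \oo] -->
     - (\int[mp]_s Z s - \int[mn]_s Z s).
  by apply: cvgN; apply: cvgB; exact: window_average_cvg.
apply/eqP; rewrite eq_sym -eqr_opp opprK; apply/eqP.
apply: (cvg_unique _ h1) => //.
rewrite (_ : (fun n => _) = (fun n : nat =>
    - (n.+1%:R * \int[mu]_x (Z x * fine (mp [set` `]x, x + n.+1%:R^-1]])) -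
     n.+1%:R * \int[mu]_x (Z x * fine (mn [set` `]x, x + n.+1%:R^-1]])))))//.
apply/funext => n.
have hn := invn_gt0 (R := R) n.
rewrite (flux_summation _ gZ iu) mulrN -mulrBr; congr (- (_ * _)).
have [ip _] := window_measure_fubini mp hn mZ Z1.
have [inn _] := window_measure_fubini mn hn mZ Z1.
rewrite -RintegralB//.
have mu_ := intble_meas iu.
apply: ae_eq_Rintegral => //.
- by apply: measurable_funM => //; exact: intble_meas (intble_shiftB _ iu).
- by apply: measurable_funB; [exact: intble_meas ip|exact: intble_meas inn].
- by apply: ae_imp (bv_increment iu uD hn) => x -> _; rewrite mulrBr.
Qed.

End bv_slices.

(** * Saturated pairing at almost every time *)

Section lower_integrals.
Context d (T : measurableType d) (R : realType) (mu : {measure set T -> \bar R}).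
Implicit Types (D : set T) (f g : T -> \bar R).
Import HBNNSimple.
Local Open Scope ereal_scope.

Let lower_integral_leT f g : (forall x, 0 <= f x) -> (forall x, 0 <= g x) ->
  {ae mu, forall x, f x <= g x} -> \int[mu]_x f x <= \int[mu]_x g x.
Proof.
move=> f0 g0 [N [mN N0 fgN]].
rewrite !ge0_integralTE//; apply: ge_ereal_sup => _ [h /= hf <-].
have mC := measurableC mN.
pose h' := proj_nnsfun h mC.
have -> : sintegral mu h = sintegral mu h'.
  have e (k : {nnsfun T >-> R}) : sintegral mu k = \int[mu]_x (k x)%:E.
    by rewrite integral_nnsfun// patch_setT.
  rewrite !e; apply: ae_eq_integral => //; try exact/measurable_EFinP.
  exists N; split => // x /= hx; apply: contrapT => Nx; apply: hx => _.
  by rewrite /h' /= mindicE mem_set// mulr1.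
apply: ereal_sup_ubound; exists h' => // x /=.
rewrite mindicE; case: (boolP (x \in ~` N)) => xN; last by rewrite mulr0.
rewrite mulr1 (le_trans (hf x))//; apply: contrapT => fg.
by move: xN; rewrite inE /=; apply; exact: fgN.
Qed.

(** The integral of a non-negative function is the supremum of the integrals
    of the simple functions below it, also if the function is not
    measurable. *)
Lemma lower_integral_le D f g : (forall x, D x -> 0 <= f x) ->
  (forall x, D x -> 0 <= g x) -> {ae mu, forall x, D x -> f x <= g x} ->
  \int[mu]_(x in D) f x <= \int[mu]_(x in D) g x.
Proof.
move=> f0 g0 fg; rewrite integral_mkcond [leRHS]integral_mkcond.
apply: lower_integral_leT; try exact: erestrict_ge0.
apply: ae_imp fg => x fg; rewrite !patchE.
by case: ifPn => // /set_mem Dx; exact: fg.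
Qed.

Lemma ae_eq_integral_any D f g : {ae mu, forall x, D x -> f x = g x} ->
  \int[mu]_(x in D) f x = \int[mu]_(x in D) g x.
Proof.
move=> fg; rewrite integralE [RHS]integralE; congr (_ - _);
  apply/eqP; rewrite eq_le; apply/andP; split; apply: lower_integral_le => //;
  by apply: ae_imp fg => x fg Dx; rewrite ?funeposE ?funenegE fg.
Qed.

End lower_integrals.

Section slices.
Context {R : realType}.
Local Notation mu := (@lebesgue_measure R).
Local Notation mR := (measurableTypeR R).
Local Notation intble D f := (mu.-integrable D (EFin \o f)).
Local Notation plane_measurable F :=
  (measurable_fun [set: mR * mR] (fun p => F p.1 p.2)).
Local Notation plane_intble F :=
  ((mu \x mu)%E.-integrable [set: mR * mR] (fun p => (F p.1 p.2)%:E)).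
Implicit Types (u g z : R -> R -> R).

Definition quotient (w : R -> R) n : R :=
  n.+1%:R * \int[mu]_x `|w (x + n.+1%:R^-1) - w x|.

(** The flow at a fixed time: [G] is the derivative of a flux that saturates
    the total variation of [w], which is expressed by its difference
    quotients. *)
Definition steepest (w G : R -> R) := exists (Z : R -> R) (C : R),
  [/\ good_flux Z G, intble setT w, intble setT (fun x => w x ^+ 2),
    forall h, 0 < h -> \int[mu]_x `|w (x + h) - w x| <= C * h &
    forall n, quotient w n <= - (\int[mu]_x (w x * G x))].

Lemma ae_Rintegral0 (A : set mR) (f : R -> R) : measurable A -> measurable_fun A f ->
  {ae mu, forall x, A x -> f x = 0} -> \int[mu]_(x in A) f x = 0.
Proof.
move=> mA mf f0; rewrite -[RHS](mul0r (fine (mu A))) -(Rintegral_cst mu mA).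
exact: ae_eq_Rintegral.
Qed.

Lemma ae_Rintegral_ge0 (A : set mR) (f : R -> R) : measurable A -> intble A f ->
  {ae mu, forall x, A x -> 0 <= f x} -> 0 <= \int[mu]_(x in A) f x.
Proof.
move=> mA fi f0; have <- : \int[mu]_(x in A) `|f x| = \int[mu]_(x in A) f x.
  have mf := intble_meas fi; apply: ae_eq_Rintegral => //.
    exact: measurableT_comp.
  by apply: ae_imp f0 => x f0 Ax; rewrite ger0_norm// f0.
by apply: Rintegral_ge0 => x _.
Qed.

Lemma Rintegral_ge0_ae0 (A : set mR) (f : R -> R) : measurable A -> intble A f ->
  {ae mu, forall x, A x -> 0 <= f x} -> \int[mu]_(x in A) f x <= 0 ->
  {ae mu, forall x, A x -> f x = 0}.
Proof.
move=> mA fi f0 i0; have mf := intble_meas fi.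
have e : \int[mu]_(x in A) `|f x| = \int[mu]_(x in A) f x.
  apply: ae_eq_Rintegral => //; first exact: measurableT_comp.
  by apply: ae_imp f0 => x f0 Ax; rewrite ger0_norm// f0.
have z : \int[mu]_(x in A) `|f x| = 0.
  by apply/eqP; rewrite eq_le Rintegral_ge0// e i0.
have : (\int[mu]_(x in A) `|(EFin \o f) x| = 0)%E.
  by rewrite -[RHS]/(0%R%:E) -z (EFin_Rintegral mA (intble_norm fi)).
have mEf : measurable_fun A (EFin \o f) by exact/measurable_EFinP.
case: (ae_eq_integral_abs mu mA mEf) => h _ /h; apply: ae_imp => x /= h1 Ax.
by case: (h1 Ax).
Qed.

Lemma plane_intble_mul u g tau : L2loc_L2 u -> L2loc_L2 g -> 0 < tau ->
  plane_intble (fun r x => \1_(`[0, tau]) r * (after0 u r x * after0 g r x)).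
Proof.
move=> lu lg t0.
have iu := strip_sq_intble lu t0; have ig := strip_sq_intble lg t0.
have mu_ := after0_measurable lu.1; have mg := after0_measurable lg.1.
apply: (plane_intble_le
  (F := fun r x => \1_(`[0, tau]) r * (after0 u r x * after0 g r x))
  (G := fun r x => \1_(`[0, tau]) r * after0 u r x ^+ 2 +
     \1_(`[0, tau]) r * after0 g r x ^+ 2) _ (intbleD measurableT iu ig)).
- apply: measurable_funM; first by apply: prod_measurable1; exact: measurable_indic.
  exact: measurable_funM.
- by move=> r x; rewrite normrM ger0_norm// -mulrDr ler_wpM2l// normrM_le_sqD.
Qed.

Lemma measurable_quotient u n : L2loc_L2 u ->
  measurable_fun [set: mR] (fun t => quotient (after0 u t) n).
Proof.
move=> lu; have mU := after0_measurable lu.1.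
apply: measurable_funM => //.
apply: (measurable_integral_section _
  (f := fun t x : mR => `|after0 u t (x + n.+1%:R^-1) - after0 u t x|)).
apply: measurableT_comp => //; apply: measurable_funB => //.
have ms : measurable_fun [set: mR * mR] (fun p => (p.1, p.2 + n.+1%:R^-1) : mR * mR).
  apply: measurable_fun_pair; first exact: measurable_fst.
  by apply: measurable_funD => //; exact: measurable_snd.
exact: (measurableT_comp mU ms).
Qed.

(** The total variation is at least the pairing P of the solution with the
    flux and at least any difference quotient V, hence at least max (P, V);
    and it has the same integral in time as P. So max (P, V) = P at almost
    every time. Lower integrals are used because the total variation is not
    known to be measurable in time. *)
Lemma ae_steepest u g z (Du : R -> realCharge R) (M : R) :
  L2loc_L2 u -> L2loc_L2 g ->
  (forall t, 0 <= t -> intble setT (u t)) ->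
  (forall t, 0 <= t -> intble setT (fun x => u t x ^+ 2)) ->
  {ae mu, forall t, 0 <= t -> BV_derivative (u t) (Du t)} ->
  {ae mu, forall t, 0 <= t -> (charge_total_variation (Du t) <= M%:E)%E} ->
  {ae mu, forall t, 0 < t -> good_flux (z t) (g t)} ->
  (forall tau : R, 0 < tau ->
    (\int[mu]_(t in `]0%R, tau[) charge_integral (Du t) (z t) =
     \int[mu]_(t in `]0%R, tau[) charge_total_variation (Du t))%E) ->
  {ae mu, forall t, 0 < t -> steepest (u t) (g t)}.
Proof.
move=> lu lg uL1 uL2 hD hM hz hE.
pose P t := - (\int[mu]_x (after0 u t x * after0 g t x)).
pose V n t := quotient (after0 u t) n.
have V0 n t : 0 <= V n t.
  by rewrite mulr_ge0//; apply: Rintegral_ge0 => x _; exact: normr_ge0.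
have slice : {ae mu, forall t, 0 < t ->
    [/\ charge_integral (Du t) (z t) = (P t)%:E,
     (charge_integral (Du t) (z t) <= charge_total_variation (Du t))%E,
     (charge_total_variation (Du t) <= M%:E)%E &
     forall n, ((V n t)%:E <= charge_total_variation (Du t))%E]}.
  apply: ae_imp (ae_and hD (ae_and hM hz)) => t [hD1 [hM1 hz1]] t0.
  have [_ dD] := hD1 (ltW t0); have gz := hz1 t0.
  have it := uL1 t (ltW t0); have i2 := uL2 t (ltW t0).
  have e w : after0 w t = w t by rewrite /after0 (ltW t0).
  split.
  - by rewrite (charge_integral_flux it i2 dD gz) /P !e.
  - have [cZ Z1 _ _ _] := gz; apply: charge_integral_le => //.
    exact: continuous_measurable_fun.
  - exact: hM1 (ltW t0).
  - move=> n; rewrite /V e /quotient charge_total_variationE lee_fin.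
    have := bv_difference_quotient it dD (invn_gt0 (R := R) n).
    rewrite charge_total_variationE /= => h.
    have n0 : 0 < n.+1%:R :> R by rewrite ltr0n.
    by rewrite -ler_pdivlMl// mulrC.
have mUG : plane_measurable (fun t x => after0 u t x * after0 g t x).
  by apply: measurable_funM; [exact: after0_measurable lu.1|exact: after0_measurable lg.1].
have mP : measurable_fun [set: mR] P.
  apply: measurableT_comp => //.
  exact: (measurable_integral_section _ (f := fun t x : mR => after0 u t x * after0 g t x)).
have mV n : measurable_fun [set: mR] (V n) by exact: measurable_quotient.
suff main n (k : nat) : {ae mu, forall t, `]0, k.+1%:R[%classic t -> V n t <= P t}.
  have : {ae mu, forall t, forall n, forall k : nat, `]0, k.+1%:R[%classic t -> V n t <= P t}.
    by apply: ae_all_nat => n; apply: ae_all_nat => k; exact: main.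
  move=> hVP; apply: ae_imp (ae_and hVP (ae_and hD hz)) => t [h [hD1 hz1]] t0.
  have [_ dD] := hD1 (ltW t0); have it := uL1 t (ltW t0).
  exists (z t), (fine (charge_total_variation (Du t))); split.
  - exact: hz1.
  - exact: it.
  - exact: uL2 (ltW t0).
  - by move=> r r0; exact: bv_difference_quotient.
  - move=> n; have := h n (Num.truncn t); rewrite /V /P /after0 (ltW t0) => h1.
    by apply: h1; rewrite /= in_itv/= t0/= truncnS_gt.
pose A : set mR := [set` `]0, k.+1%:R[].
have mA : measurable A by exact: measurable_itv.
have At t : A t -> 0 < t by rewrite /A /= in_itv/= => /andP[].
(* The maximum is non-negative, like V; the sign of P is not known yet. *)
pose m t := Num.max (P t) (V n t).
have m0 t : 0 <= m t by rewrite le_max V0 orbT.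
have mm : measurable_fun [set: mR] m by exact: measurable_maxr.
have k0 : 0 < k.+1%:R :> R by rewrite ltr0n.
have iP : intble A P.
  have i1 := intble_integral_section
    (f := fun r x : mR => \1_(`[0, k.+1%:R]) r * (after0 u r x * after0 g r x))
    (plane_intble_mul lu lg k0).
  have i2 := intbleN measurableT i1.
  have i3 : intble A _ := integrableS measurableT mA (@subsetT _ _) i2.
  apply: eq_integrable i3 => // t tA /=; rewrite /P; congr (- _)%:E.
  apply: eq_Rintegral => x _; rewrite indicE mem_set ?mul1r//.
  by move: tA; rewrite inE /A; apply: subset_itv_oo_cc.
have imle : (\int[mu]_(t in A) (m t)%:E <= \int[mu]_(t in A) (P t)%:E)%E.
  have <- : (\int[mu]_(t in A) charge_integral (Du t) (z t) = \int[mu]_(t in A) (P t)%:E)%E.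
    apply: ae_eq_integral_any.
    by apply: ae_imp slice => t h /At t0; have [] := h t0.
  rewrite hE//; apply: lower_integral_le => //.
  - by move=> t _; rewrite lee_fin.
  - apply: ae_imp slice => t h /At t0; have [h1 h2 _ h3] := h t0.
    rewrite /m EFin_max ge_max h3 andbT -h1; exact: h2.
have im : intble A m.
  apply: intble_ge0_lty => //; first exact: measurable_funTS.
  by apply: (le_lt_trans imle); rewrite -(EFin_Rintegral mA iP) ltry.
have imP : intble A (fun t => m t - P t) by exact: intbleB.
have := Rintegral_ge0_ae0 mA imP.
have mP0 : {ae mu, forall x, A x -> 0 <= m x - P x}.
  by apply: aeW => t _; rewrite subr_ge0 le_max lexx.
move=> /(_ mP0) h.
have : \int[mu]_(t in A) (m t - P t) <= 0.
  rewrite RintegralB// subr_le0 -lee_fin.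
  by rewrite (EFin_Rintegral mA im) (EFin_Rintegral mA iP).
move=> /h; apply: ae_imp => t h1 /h1 /eqP; rewrite subr_eq0 => /eqP <-.
by rewrite le_max lexx orbT.
Qed.

End slices.

(** * Truncation at a fixed time *)

Section descent.
Context {R : realType}.
Local Notation mu := (@lebesgue_measure R).
Local Notation mR := (measurableTypeR R).
Local Notation intble D f := (mu.-integrable D (EFin \o f)).
Implicit Types (w G beta : R -> R).

Definition contraction0 beta := [/\ measurable_fun [set: mR] beta, beta 0 = 0 &
  forall a b, a <= b -> 0 <= beta b - beta a <= b - a].

(** Both [beta] and the complementary function b - beta b are nondecreasing,
    hence the oscillations of the two parts of a profile add up. *)
Lemma contraction0_dist beta a b : contraction0 beta ->
  `|b - a| = `|beta b - beta a| + `|(b - beta b) - (a - beta a)|.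
Proof.
move=> [_ _ hb]; wlog ab : a b / a <= b => [th|].
  have [ab|/ltW ab] := leP a b; first exact: th.
  by rewrite distrC [`|beta b - _|]distrC [`|_ - (a - _)|]distrC; exact: th.
have /andP[h1 h2] := hb a b ab.
rewrite (ger0_norm h1) !ger0_norm ?subr_ge0//; lra.
Qed.

Lemma contraction0_le beta a : contraction0 beta -> `|beta a| <= `|a|.
Proof.
move=> hb; have := contraction0_dist 0 a hb; have [_ b0 _] := hb.
by rewrite b0 !subr0 => ->; rewrite lerDl.
Qed.

Lemma contraction0_residual_le beta a : contraction0 beta -> `|a - beta a| <= `|a|.
Proof.
move=> hb; have := contraction0_dist 0 a hb; have [_ b0 _] := hb.
by rewrite b0 !subr0 => ->; rewrite lerDr.
Qed.

Lemma intble_contraction beta w : contraction0 beta -> intble setT w ->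
  intble setT (beta \o w).
Proof.
move=> hb iw; apply: (intble_le _ _ (intble_norm iw)) => //.
- have [mb _ _] := hb; exact: measurableT_comp mb (intble_meas iw).
- by move=> x _; exact: (contraction0_le (w x) hb).
Qed.

Lemma intble_residual beta w : contraction0 beta -> intble setT w ->
  intble setT (fun x => w x - beta (w x)).
Proof. by move=> hb iw; apply: intbleB => //; exact: intble_contraction. Qed.

(** The difference quotient of [w] is the sum of those of beta w and of the
    residual w - beta w. By [flux_duality] the second one is at least the
    pairing of the residual with the increments of the flux, which tends to
    the pairing with [G]. The bound on the pairing thus passes from [w] to
    beta w. *)
Lemma steepest_descent beta w G (c : nat -> R) l : contraction0 beta -> steepest w G ->
  (forall n, c n <= quotient (beta \o w) n) -> c n @[n --> \oo] --> l ->
  l <= - (\int[mu]_x (beta (w x) * G x)).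
Proof.
move=> hb [Z [C [gZ iw w2 wC hq]]] hc cl.
have [cZ Z1 mG G2 _] := gZ; have mw := intble_meas iw.
pose r x := w x - beta (w x).
have ir : intble setT r by exact: intble_residual.
have mr := intble_meas ir.
have r2 : intble setT (fun x => r x ^+ 2).
  apply: (intble_le _ _ w2) => //; first exact: measurable_funX.
  move=> x _; rewrite normrX -(real_normK (num_real (w x))) ler_pXn2r ?nnegrE//.
  exact: (contraction0_residual_le (w x) hb).
have rC h : 0 < h -> \int[mu]_x `|r (x + h) - r x| <= C * h.
  move=> h0; apply: le_trans (wC h h0); apply: le_Rintegral => //.
  - by apply: intble_norm; exact: intble_shiftB.
  - by apply: intble_norm; exact: intble_shiftB.
  - by move=> x _; rewrite (contraction0_dist (w x) (w (x + h)) hb) lerDr.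
have lim := translation_average_cvg gZ ir r2 (bv_shift_sq ir rC r2).
have iwG : intble setT (fun x => w x * G x) by exact: intble_mul2.
have irG : intble setT (fun x => r x * G x) by exact: intble_mul2.
have -> : - (\int[mu]_x (beta (w x) * G x)) =
    - (\int[mu]_x (w x * G x)) + \int[mu]_x (r x * G x).
  rewrite -[X in - X = _](_ : \int[mu]_x (w x * G x - r x * G x) = _).
    by rewrite RintegralB// opprB addrC.
  by apply: eq_Rintegral => x _; rewrite /r; ring.
apply: (ler_cvg_to cl (cvgD (cvg_cst _) lim)).
near=> n; apply: (le_trans (hc n)).
have := hq n; rewrite /quotient => hqn.
have h0 := invn_gt0 (R := R) n.
have e : \int[mu]_x `|w (x + n.+1%:R^-1) - w x| =
   \int[mu]_x `|(beta \o w) (x + n.+1%:R^-1) - (beta \o w) x| +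
   \int[mu]_x `|r (x + n.+1%:R^-1) - r x|.
  rewrite -RintegralD//.
  - by apply: eq_Rintegral => x _; rewrite (contraction0_dist _ _ hb).
  - by apply/intble_norm/intble_shiftB; exact: intble_contraction.
  - by apply/intble_norm/intble_shiftB.
have d := flux_duality n.+1%:R^-1 gZ ir.
have d2 := ler_wpM2l (ler0n R n.+1) d.
move: hqn d2; rewrite e mulrDr mulrN /quotient /= => hqn d2.
rewrite -subr_ge0 in hqn; rewrite -subr_ge0 in d2; rewrite -subr_ge0.
apply: le_trans (addr_ge0 hqn d2) _; rewrite le_eqVlt; apply/orP; left; apply/eqP.
by rewrite !fctE /=; ring.
Unshelve. all: by end_near. Qed.

Lemma steepest_descent_ge0 beta w G : contraction0 beta -> steepest w G ->
  0 <= - (\int[mu]_x (beta (w x) * G x)).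
Proof.
move=> hb hs; apply: (steepest_descent (c := fun=> 0) hb hs); last exact: cvg_cst.
by move=> n; rewrite mulr_ge0//; apply: Rintegral_ge0 => x _; exact: normr_ge0.
Qed.

(** The profile beta w rises from 0 to each of its values and returns to 0,
    see [shift_lower_bound]. *)
Lemma steepest_descent_ge beta w G : contraction0 beta -> steepest w G ->
  {ae mu, forall x, 2 * beta (w x) <= - (\int[mu]_x (beta (w x) * G x))}.
Proof.
move=> hb hs; have iw : intble setT w by have [? [? []]] := hs.
have ib := intble_contraction hb iw.
apply: ae_imp (lebesgue_differentiation (intble_locally ib)) => y hy.
have h1 := lebesgue_avg (intble_locally ib) hy.
have h2 : (2 * (n.+1%:R * \int[mu]_(y in `]y, y + n.+1%:R^-1]) (beta \o w) y))
   @[n --> \oo] --> 2 * beta (w y) by exact: cvgMr.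
apply: (steepest_descent hb hs _ h2) => n.
rewrite /quotient mulrCA ler_wpM2l//.
exact: shift_lower_bound (invn_gt0 n).
Qed.

End descent.

(** * The chain rule along a path *)

Section chain_rule.
Context {R : realType}.
Local Notation mu := (@lebesgue_measure R).
Local Notation mR := (measurableTypeR R).
Local Notation intble D f := (mu.-integrable D (EFin \o f)).
Local Notation plane_measurable F :=
  (measurable_fun [set: mR * mR] (fun p => F p.1 p.2)).
Implicit Types (f g beta Psi : R -> R).

Lemma plane_measurable_primitive (F : R -> R -> R) s : plane_measurable F ->
  plane_measurable (fun t x => \int[mu]_(r in `]s, t]) F r x).
Proof.
move=> mF; pose H (p : mR * mR) (r : mR) : R := if (s < r) && (r <= p.1) then F r p.2 else 0.
rewrite (_ : (fun p => _) = fun p => \int[mu]_r H p r); last first.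
  apply/funext => p; rewrite -(@Rintegral_supp _ [set` `]s, p.1]] (H p)).
    apply: eq_Rintegral => r; rewrite inE/= in_itv/= /H => ->//.
  by move=> r /=; rewrite in_itv /H; case: ifP.
apply: measurable_integral_section.
apply: measurable_fun_ifT.
- apply: measurable_and.
  + by apply: measurable_fun_ltr => //; exact: measurable_snd.
  + apply: measurable_fun_ler; first exact: measurable_snd.
    by apply: measurableT_comp measurable_fst; exact: measurable_fst.
- have ms : measurable_fun [set: mR * mR * mR] (fun p => (p.2, p.1.2) : mR * mR).
    apply: measurable_fun_pair; first exact: measurable_snd.
    by apply: measurableT_comp measurable_fst; exact: measurable_snd.
  exact: (measurableT_comp mF ms).
- exact: measurable_cst.
Qed.

Lemma measurable_primitive f s : measurable_fun [set: mR] f ->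
  measurable_fun [set: mR] (fun t => \int[mu]_(r in `]s, t]) f r).
Proof.
move=> mf; apply: (measurable_section2 (f := fun t x : mR => \int[mu]_(r in `]s, t]) f r) 0).
by apply: (plane_measurable_primitive (F := fun r x : mR => f r)); exact: prod_measurable1.
Qed.

Lemma RintegralD_itv f a b c : a <= b -> b <= c -> intble `]a, c] f ->
  \int[mu]_(x in `]a, c]) f x = \int[mu]_(x in `]a, b]) f x + \int[mu]_(x in `]b, c]) f x.
Proof.
move=> ab bc fi; rewrite -(@Rintegral_itvB _ f (BRight a) (BRight c) b fi) ?bnd_simp//.
by rewrite addrC subrK.
Qed.

(** Expansion of the square of the difference between [f] and its mean. *)
Lemma sq_Rintegral_le f s t : s < t -> intble `]s, t] f ->
  intble `]s, t] (fun x => f x ^+ 2) ->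
  (\int[mu]_(x in `]s, t]) f x) ^+ 2 <= (t - s) * \int[mu]_(x in `]s, t]) (f x ^+ 2).
Proof.
move=> st fi f2; set m := \int[mu]_(x in _) f x; set q := \int[mu]_(x in _) (f x ^+ 2).
have ts0 : 0 < t - s by rewrite subr_gt0.
pose c := m / (t - s).
have mA : measurable (`]s, t] : set mR) by exact: measurable_itv.
have : 0 <= \int[mu]_(x in `]s, t]) ((f x - c) ^+ 2).
  by apply: Rintegral_ge0 => x _; exact: sqr_ge0.
have -> : \int[mu]_(x in `]s, t]) ((f x - c) ^+ 2) = q - 2 * c * m + c ^+ 2 * (t - s).
  have e1 : \int[mu]_(x in `]s, t]) (2 * c * f x) = 2 * c * m by rewrite RintegralZl.
  have e2 : \int[mu]_(x in `]s, t]) (cst (c ^+ 2) x) = c ^+ 2 * (t - s).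
    by rewrite Rintegral_cst// (fine_lebesgue_itv (ltW st)).
  rewrite -e1 -e2.
  rewrite -RintegralB//; last exact: intbleZ.
  rewrite -RintegralD//; last 2 first.
  - by apply: intbleB => //; exact: intbleZ.
  - exact: intble_cst_itv.
  by apply: eq_Rintegral => x _; rewrite /cst; ring.
rewrite -(pmulr_rge0 _ ts0) => h.
rewrite -subr_ge0; apply: (le_trans h); rewrite le_eqVlt; apply/orP; left.
by apply/eqP; rewrite /c; field; rewrite gt_eqF.
Qed.

Section path.
Variables (g : R -> R) (s0 t0 y0 : R).
Hypotheses (mg : measurable_fun [set: mR] g) (ig : intble `]s0, t0] g)
  (ig2 : intble `]s0, t0] (fun x => g x ^+ 2)).
Variables (Psi beta : R -> R).
Hypotheses (mbeta : measurable_fun [set: mR] beta)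
  (lip : forall a b, `|beta b - beta a| <= `|b - a|)
  (conv : forall a b, Psi b - Psi a <= beta b * (b - a)).

Let y t := y0 + \int[mu]_(r in `]s0, t]) g r.

Let sub_intble f s t : s0 <= s -> t <= t0 -> intble `]s0, t0] f -> intble `]s, t] f.
Proof.
move=> ss tt; apply: integrableS; try exact: measurable_itv.
by apply: subset_itv; rewrite bnd_simp.
Qed.

Let y_increment s t : s0 <= s -> s <= t -> t <= t0 ->
  y t - y s = \int[mu]_(r in `]s, t]) g r.
Proof.
move=> ss st tt; rewrite /y (RintegralD_itv ss st); last exact: sub_intble.
by ring.
Qed.

Let my : measurable_fun [set: mR] y.
Proof. by apply: measurable_funD => //; exact: measurable_primitive. Qed.

Let y_dist s t r : s0 <= s -> t <= t0 -> s <= r -> r <= t ->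
  `|y t - y r| <= \int[mu]_(x in `]s, t]) `|g x|.
Proof.
move=> ss tt sr rt; rewrite y_increment//; last exact: le_trans ss sr.
have i1 : intble `]s, t] g by exact: sub_intble.
rewrite (RintegralD_itv sr rt); last exact: intble_norm.
have i2 : intble `]r, t] g by apply: sub_intble => //; exact: le_trans ss sr.
have mA : measurable (`]r, t] : set mR) by exact: measurable_itv.
apply: (le_trans (le_normr_Rintegral mA i2)).
by rewrite lerDr; apply: Rintegral_ge0 => x _; exact: normr_ge0.
Qed.

Lemma path_intble : s0 <= t0 -> intble `]s0, t0] (fun r => beta (y r) * g r).
Proof.
move=> st; have mA : measurable (`]s0, t0] : set mR) by exact: measurable_itv.
apply: (intble_bounded_mul (C := `|beta (y t0)| + \int[mu]_(x in `]s0, t0]) `|g x|)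
  mA _ _ ig).
- by apply: measurable_funTS; exact: measurableT_comp.
- move=> r /=; rewrite in_itv/= => /andP[sr rt].
  rewrite -[beta (y r)](subrK (beta (y t0))) addrC.
  apply: (le_trans (ler_normD _ _)); rewrite lerD2l.
  apply: (le_trans (lip _ _)); rewrite distrC.
  by apply: y_dist => //; exact: ltW.
Qed.

(** Freezing beta (y r) at the end of the interval makes an error of at most
    the square of the integral of |g|. *)
Let chain_step s t : s0 <= s -> s < t -> t <= t0 ->
  Psi (y t) - Psi (y s) <= \int[mu]_(r in `]s, t]) (beta (y r) * g r) +
    (t - s) * \int[mu]_(r in `]s, t]) (g r ^+ 2).
Proof.
move=> ss st tt; apply: (le_trans (conv _ _)); rewrite y_increment//; last exact: ltW.
have mA : measurable (`]s, t] : set mR) by exact: measurable_itv.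
have s0t0 : s0 <= t0 by apply: (le_trans ss); apply: le_trans tt; exact: ltW.
have i1 : intble `]s, t] g by exact: sub_intble.
have i2 : intble `]s, t] (fun r => beta (y r) * g r).
  by apply: sub_intble => //; exact: path_intble.
set m := \int[mu]_(r in `]s, t]) `|g r|.
rewrite -(RintegralZl (beta (y t)) mA i1) -lerBlDl -RintegralB//; last exact: intbleZ.
apply: (@le_trans _ _ (m ^+ 2)).
  rewrite expr2 -[X in _ <= m * X]/(\int[mu]_(r in `]s, t]) `|g r|).
  rewrite -(RintegralZl m mA (intble_norm i1)).
  have i3 : intble `]s, t] (fun r => beta (y t) * g r - beta (y r) * g r).
    by apply: intbleB => //; exact: intbleZ.
  have i4 : intble `]s, t] (fun r => m * `|g r|).
    by apply: intbleZ => //; exact: intble_norm.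
  apply: (le_Rintegral mA i3 i4) => r /=; rewrite in_itv/= => /andP[sr rt].
  rewrite -mulrBl; apply: (le_trans (ler_norm _)); rewrite normrM ler_wpM2r//.
  by apply: (le_trans (lip _ _)); apply: y_dist => //; exact: ltW.
rewrite /m; under [X in _ <= _ * X]eq_Rintegral do rewrite -real_normK ?num_real//.
apply: sq_Rintegral_le => //; first exact: intble_norm.
rewrite (_ : (fun x => `|g x| ^+ 2) = fun x => g x ^+ 2); first exact: sub_intble.
by apply/funext => x; rewrite real_normK ?num_real.
Qed.

(** A partition into n + 1 pieces of equal length makes an error of order 1
    / (n + 1), the integral of g ^ 2 being finite. *)
Lemma chain_rule_le : s0 < t0 ->
  Psi (y t0) <= Psi y0 + \int[mu]_(r in `]s0, t0]) (beta (y r) * g r).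
Proof.
move=> st.
pose e n := (t0 - s0) * n.+1%:R^-1.
pose tk n k := s0 + k%:R * e n.
have e0 n : 0 < e n by rewrite mulr_gt0 ?invr_gt0 ?ltr0n// subr_gt0.
have tkn n : tk n n.+1 = t0.
  by rewrite /tk /e; field; rewrite gt_eqF// ltr0n.
have tkS n k : tk n k.+1 - tk n k = e n by rewrite /tk -natr1; ring.
have tk0 n k : s0 <= tk n k by rewrite lerDl mulr_ge0// ltW.
have tk1 n k : (k <= n.+1)%N -> tk n k <= t0.
  by move=> kn; rewrite -(tkn n) lerD2l ler_wpM2r ?ler_nat// ltW.
have yy : y s0 = y0 by rewrite /y set_itvxx ?Rintegral_set0 ?addr0.
have h n k : (k <= n.+1)%N -> Psi (y (tk n k)) <= Psi y0 +
    \int[mu]_(r in `]s0, tk n k]) (beta (y r) * g r) +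
    e n * \int[mu]_(r in `]s0, tk n k]) (g r ^+ 2).
  elim: k => [_|k IH kn].
    by rewrite /tk mul0r addr0 yy !set_itvxx !Rintegral_set0 mulr0 !addr0.
  have kt : tk n k < tk n k.+1 by rewrite -subr_gt0 tkS.
  have := chain_step (tk0 n k) kt (tk1 _ _ kn); rewrite tkS.
  have := IH (ltnW kn).
  have i1 : intble `]s0, tk n k.+1] (fun r => beta (y r) * g r).
    by apply: sub_intble => //; [exact: tk1|apply: path_intble; exact: ltW].
  have i2 : intble `]s0, tk n k.+1] (fun r => g r ^+ 2).
    by apply: sub_intble => //; exact: tk1.
  rewrite (RintegralD_itv (tk0 n k) (ltW kt) i1) (RintegralD_itv (tk0 n k) (ltW kt) i2).
  rewrite mulrDr; lra.
set I := \int[mu]_(r in _) (_ * _); pose Q := \int[mu]_(r in `]s0, t0]) (g r ^+ 2).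
have h2 n : Psi (y t0) <= Psi y0 + I + e n * Q.
  by have := h n n.+1 (leqnn _); rewrite tkn.
have c1 : (Psi y0 + I + e n * Q) @[n --> \oo] --> Psi y0 + I + (t0 - s0) * 0 * Q.
  apply: cvgD; first exact: cvg_cst.
  by apply: cvgMl; apply: cvgMr; exact: cvg_harmonic.
rewrite mulr0 mul0r addr0 in c1.
apply: (ler_cvg_to (cvg_cst (Psi (y t0))) c1).
by apply: nearW => n; exact: h2.
Qed.

End path.
End chain_rule.

(** * Energy inequalities *)

Section energy.
Context {R : realType}.
Local Notation mu := (@lebesgue_measure R).
Local Notation mR := (measurableTypeR R).
Local Notation intble D f := (mu.-integrable D (EFin \o f)).
Local Notation plane_measurable F :=
  (measurable_fun [set: mR * mR] (fun p => F p.1 p.2)).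
Local Notation plane_intble F :=
  ((mu \x mu)%E.-integrable [set: mR * mR] (fun p => (F p.1 p.2)%:E)).
Implicit Types (u g : R -> R -> R) (beta Psi : R -> R).

Lemma box_intble_swap (F : R -> R -> R) : box_intble F -> box_intble (fun x r => F r x).
Proof.
move=> hF; split; first by apply: (prod_measurable_swap (f := F : mR -> mR -> R)); exact: hF.1.
have bi (a b : R) : box_bounded (\1_(`[a, b]) : R -> R) a b.
  split; first exact: measurable_indic.
  by exists 1 => // r; rewrite mul1r ger0_norm.
move=> tau L tau0.
have := prod_intble_swap (f := fun r x : mR => \1_(`[- L, L]) r * (F r x * \1_(`[- tau, tau]) x))
  (box_intble_mul hF (bi (- L) L) (bi (- tau) tau)).
by congr (_.-integrable _ _); apply/funext => p /=; congr EFin; ring.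
Qed.

Lemma Rintegral_indicZl (A : set R) q (f : R -> R) :
  \int[mu]_y (\1_A q * f y) = \1_A q * \int[mu]_y f y.
Proof.
rewrite indicE; case: (_ \in _).
  by rewrite mul1r; apply: eq_Rintegral => y _; rewrite mul1r.
rewrite mul0r -[RHS](mul0r (fine (mu setT))) -(Rintegral_cst mu measurableT).
by apply: eq_Rintegral => y _; rewrite mul0r.
Qed.

(** A version of [u] that is jointly measurable and has absolutely
    continuous paths for almost every [x], whereas each [u r] is determined
    only up to a null set. *)
Definition evolve u g s r x := u s x + \int[mu]_(q in `]s, r]) after0 g q x.

Section flow.
Variables (u g : R -> R -> R).
Hypotheses (lu : L2loc_L2 u) (lg : L2loc_L2 g) (ug : weak_d_t u g)
  (uc : L2_continuous u).

Let mu_ t : 0 <= t -> measurable_fun [set: mR] (u t).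
Proof. by move=> t0; apply: inL2_measurable; exact: uc.1. Qed.

Let u2 t : 0 <= t -> intble setT (fun x => u t x ^+ 2).
Proof. by move=> t0; apply: inL2_sq; exact: uc.1. Qed.

Lemma evolve_measurable s : 0 <= s -> plane_measurable (evolve u g s).
Proof.
move=> s0; apply: measurable_funD.
  by apply: (prod_measurable2 (f := u s : mR -> R)); exact: mu_.
by apply: plane_measurable_primitive; exact: after0_measurable lg.1.
Qed.

(** Both sides have the same integral over each interval, by
    [time_increment] and Fubini's theorem. *)
Lemma evolve_ae s r : 0 <= s -> s <= r -> {ae mu, forall x, u r x = evolve u g s r x}.
Proof.
move=> s0 sr; have r0 := le_trans s0 sr.
pose I x := \int[mu]_(q in `]s, r]) after0 g q x.
have bg := box_intble_after0 lg.
have lI : locally_integrable setT I.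
  exact: locally_integrable_section_itv (box_intble_swap bg).
have lsq t : 0 <= t -> locally_integrable setT (u t).
  by move=> t0; apply: sq_locally_integrable; [exact: mu_|exact: u2].
pose v x := u r x - u s x - I x.
have lv : locally_integrable setT v.
  exact: (locally_integrableB (locally_integrableB (lsq _ r0) (lsq _ s0)) lI).
suff : {ae mu, forall x, True -> v x = 0}.
  apply: ae_imp => x /(_ Logic.I) /eqP; rewrite /v subr_eq0 subr_eq => /eqP ->.
  by rewrite addrC.
apply: (itv_integral0_ae lv) => x _ h h0.
have xh : x <= x + h by rewrite lerDl ltW.
have mA : measurable (`]x, x + h] : set mR) by exact: measurable_itv.
have il f : locally_integrable setT f -> intble `]x, x + h] f.
  by move=> lf; apply: (intble_itv mA lf (@subset_itv_oc_cc _ _ x (x + h))).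
have i1 := il _ (lsq _ r0); have i2 := il _ (lsq _ s0); have i3 := il _ lI.
rewrite /v RintegralB//; last exact: intbleB.
rewrite RintegralB// (time_increment lu lg ug uc s0 sr xh).
apply/eqP; rewrite subr_eq0; apply/eqP.
pose F q y := \1_(`]s, r]) q * (after0 g q y * \1_(`]x, x + h]) y).
have iF : plane_intble F.
  by apply: (box_intble_mul bg); exact: box_bounded_indic.
rewrite -Rintegral_indic.
have -> : \int[mu]_q (\int[mu]_(y in `]x, x + h]) after0 g q y * \1_(`]s, r]) q) =
    \int[mu]_q \int[mu]_y F q y.
  apply: eq_Rintegral => q _; rewrite -Rintegral_indic mulrC.
  exact/esym/Rintegral_indicZl.
rewrite (Rfubini (f := F : mR -> mR -> R) iF).
rewrite -[RHS]Rintegral_indic; apply: eq_Rintegral => y _.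
rewrite /I -Rintegral_indic [RHS]mulrC -Rintegral_indicZl.
by apply: eq_Rintegral => q _; rewrite /F; ring.
Qed.

Variables (beta Psi : R -> R).
Hypotheses (hbeta : contraction0 beta)
  (conv : forall a b, Psi b - Psi a <= beta b * (b - a))
  (mPsi : measurable_fun [set: mR] Psi) (Psi_sq : forall a, `|Psi a| <= a ^+ 2).

Let mbeta : measurable_fun [set: mR] beta. Proof. by case: hbeta. Qed.

Let lip a b : `|beta b - beta a| <= `|b - a|.
Proof. by rewrite (contraction0_dist a b hbeta) lerDl. Qed.

Lemma intble_Psi t : 0 <= t -> intble setT (fun x => Psi (u t x)).
Proof.
move=> t0; apply: (intble_le _ _ (u2 t0)) => //.
  by apply: (measurableT_comp mPsi); exact: mu_.
Qed.

Let power r := \int[mu]_x (beta (u r x) * g r x).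

Let G s t r x := \1_(`]s, t]) r * (beta (after0 u r x) * after0 g r x).

Let G_intble s t : 0 <= s -> s < t -> plane_intble (G s t).
Proof.
move=> s0 st; have t0 := le_lt_trans s0 st.
have mU := after0_measurable lu.1; have mG := after0_measurable lg.1.
apply: (plane_intble_le (F := G s t)
  (G := fun r x => `|\1_(`[0, t]) r * (after0 u r x * after0 g r x)|)).
- apply: measurable_funM; first by apply: prod_measurable1; exact: measurable_indic.
  by apply: measurable_funM => //; exact: measurableT_comp.
- by apply: intble_norm; exact: plane_intble_mul.
- move=> r x; rewrite /G !normrM.
  apply: ler_pM => //.
    rewrite !ger0_norm//; apply: indic_le => y /=; rewrite !in_itv/= => /andP[sy ->].
    by rewrite andbT ltW// (le_lt_trans s0).
  by apply: ler_wpM2r => //; exact: contraction0_le.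
Qed.

Let G_section s t r : 0 <= s ->
  \int[mu]_x G s t r x = power r * \1_(`]s, t]) r.
Proof.
move=> s0; rewrite /G Rintegral_indicZl mulrC indicE.
case: (boolP (r \in _)); last by rewrite !mulr0.
rewrite inE/= in_itv/= => /andP[sr _]; rewrite !mulr1.
by apply: eq_Rintegral => x _; rewrite /after0 ltW// (le_lt_trans s0).
Qed.

Lemma power_intble s t : 0 <= s -> s < t -> intble `]s, t] power.
Proof.
move=> s0 st.
have i1 := intble_integral_section (f := G s t : mR -> mR -> R) (G_intble s0 st).
have mA : measurable (`]s, t] : set mR) by exact: measurable_itv.
have i2 : intble `]s, t] _ := integrableS measurableT mA (@subsetT _ _) i1.
apply: eq_integrable i2 => // r rA /=.
by rewrite (G_section _ _ s0) indicE rA mulr1.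
Qed.

(** The chain rule is applied to the path of almost every point [x] and then
    integrated in [x]. *)
Lemma energy_le s t : 0 <= s -> s < t ->
  \int[mu]_x Psi (u t x) <= \int[mu]_x Psi (u s x) + \int[mu]_(r in `]s, t]) power r.
Proof.
move=> s0 st; have t0 := le_lt_trans s0 st.
have mA : measurable (`]s, t] : set mR) by exact: measurable_itv.
have mG := after0_measurable lg.1; have mE := evolve_measurable s0.
pose F r x := \1_(`]s, t]) r * (beta (evolve u g s r x) * after0 g r x).
have mF : plane_measurable F.
  apply: measurable_funM; first by apply: prod_measurable1; exact: measurable_indic.
  by apply: measurable_funM => //; exact: measurableT_comp.
have FG r : {ae mu, forall x, F r x = G s t r x}.
  have [sr|rs] := boolP (r \in (`]s, t]%classic : set R)); last first.
    by apply: aeW => x; rewrite /F /G indicE (negbTE rs) !mul0r.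
  have [sr1 _] : s < r /\ r <= t by move: sr; rewrite inE/= in_itv/= => /andP.
  apply: ae_imp (evolve_ae s0 (ltW sr1)) => x e.
  by rewrite /F /G -e /after0 ltW// (le_lt_trans s0).
have iG := G_intble s0 st; have mG' := prod_intble_meas iG.
have iF : plane_intble F.
  apply: (prod_intble_lty (f := F : mR -> mR -> R)) => //.
  rewrite [X in (X < _)%E](_ : _ = \int[mu]_r \int[mu]_x (`|G s t r x|)%:E)%E.
    exact: prod_lty_intble.
  apply: eq_integral => r _; apply: ae_eq_integral => //.
  - apply/measurable_EFinP; apply: measurableT_comp => //.
    exact: (measurable_section1 (f := F : mR -> mR -> R)).
  - apply/measurable_EFinP; apply: measurableT_comp => //.
    exact: (measurable_section1 (f := G s t : mR -> mR -> R)).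
  - by apply: ae_imp (FG r) => x -> _.
have e1 : \int[mu]_(r in `]s, t]) power r = \int[mu]_x \int[mu]_r F r x.
  rewrite -Rintegral_indic -(Rfubini (f := F : mR -> mR -> R) iF).
  apply: eq_Rintegral => r _; rewrite -(G_section _ _ s0).
  apply: ae_eq_Rintegral => //.
  - exact: (measurable_section1 (f := G s t : mR -> mR -> R)).
  - exact: (measurable_section1 (f := F : mR -> mR -> R)).
  - by apply: ae_imp (FG r) => x -> _.
have iFx := intble_integral_section (f := fun x r : mR => F r x)
  (prod_intble_swap (f := F : mR -> mR -> R) iF).
rewrite e1 -RintegralD//; last exact: intble_Psi.
apply: ae_le_Rintegral => //.
- by apply: intble_Psi; exact: ltW.
- by apply: intbleD => //; exact: intble_Psi.
have sq := prod_intble_section2 (strip_sq_intble lg t0).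
apply: ae_imp (ae_and sq (evolve_ae s0 (ltW st))) => x [sx ->] _.
have mgx : measurable_fun [set: mR] (fun r => after0 g r x).
  exact: (measurable_section2 (f := after0 g : mR -> mR -> R)).
have g2 : intble `]s, t] (fun r => after0 g r x ^+ 2).
  have i2 : intble `]s, t] _ := integrableS measurableT mA (@subsetT _ _) sx.
  apply: eq_integrable i2 => // r rA /=; rewrite indicE mem_set ?mul1r//.
  move: rA; rewrite inE/= !in_itv/= => /andP[sr ->].
  by rewrite andbT ltW// (le_lt_trans s0).
have g1 : intble `]s, t] (fun r => after0 g r x).
  have : intble `]s, t] (fun r => after0 g r x * 1).
    apply: intble_mul2 => //; first exact: measurable_funTS.
    by rewrite expr1n; exact: intble_cst_itv.
  by apply: eq_integrable => // r _ /=; rewrite mulr1.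
have := chain_rule_le (u s x) mgx g1 g2 mbeta lip conv st.
rewrite -[X in Psi X]/(evolve u g s t x) => h; apply: (le_trans h).
rewrite lerD2l le_eqVlt; apply/orP; left; apply/eqP.
by rewrite -Rintegral_indic; apply: eq_Rintegral => r _; rewrite /F /evolve mulrC.
Qed.

End flow.

Lemma energy_decrease u g beta Psi s t : L2loc_L2 u -> L2loc_L2 g -> weak_d_t u g ->
  L2_continuous u -> contraction0 beta ->
  (forall a b, Psi b - Psi a <= beta b * (b - a)) ->
  measurable_fun [set: mR] Psi -> (forall a, `|Psi a| <= a ^+ 2) ->
  {ae mu, forall r, 0 < r -> steepest (u r) (g r)} -> 0 <= s -> s <= t ->
  \int[mu]_x Psi (u t x) <= \int[mu]_x Psi (u s x).
Proof.
move=> lu lg ug uc hb cv mP P2 hs s0; rewrite le_eqVlt => /orP[/eqP->//|st].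
apply: (le_trans (energy_le lu lg ug uc hb cv mP P2 s0 st)).
rewrite gerDl.
have mA : measurable (`]s, t] : set mR) by exact: measurable_itv.
rewrite -[leRHS](mul0r (fine (mu `]s, t]))) -(Rintegral_cst mu mA).
apply: ae_le_Rintegral => //; first exact: power_intble.
  exact: intble_cst_itv.
apply: ae_imp hs => r hr; rewrite /= in_itv/= => /andP[sr _].
by have := steepest_descent_ge0 hb (hr (le_lt_trans s0 sr)); rewrite oppr_ge0.
Qed.

(** The hypothesis on [kappa] says that it is at most the essential supremum
    of beta u at all times up to [t]. *)
Lemma energy_decrease_rate u g beta Psi kappa t : L2loc_L2 u -> L2loc_L2 g ->
  weak_d_t u g ->
  L2_continuous u -> contraction0 beta ->
  (forall a b, Psi b - Psi a <= beta b * (b - a)) ->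
  measurable_fun [set: mR] Psi -> (forall a, `|Psi a| <= a ^+ 2) ->
  {ae mu, forall r, 0 < r -> steepest (u r) (g r)} -> 0 <= t ->
  (forall r M, 0 < r -> r <= t -> {ae mu, forall x, beta (u r x) <= M} -> kappa <= M) ->
  \int[mu]_x Psi (u t x) <= \int[mu]_x Psi (u 0 x) - 2 * kappa * t.
Proof.
move=> lu lg ug uc hb cv mP P2 hs; rewrite le_eqVlt => /orP[/eqP<- _|t0 hk].
  by rewrite mulr0 subr0.
apply: (le_trans (energy_le lu lg ug uc hb cv mP P2 (lexx 0) t0)).
rewrite lerD2l.
have mA : measurable (`]0, t] : set mR) by exact: measurable_itv.
rewrite -mulNr -[X in _ * X]subr0 -(fine_lebesgue_itv (ltW t0)) -(Rintegral_cst mu mA).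
apply: ae_le_Rintegral => //; first exact: power_intble.
  exact: intble_cst_itv.
apply: ae_imp hs => r hr; rewrite /= in_itv/= => /andP[r0 rt].
have := steepest_descent_ge hb (hr r0); set I := \int[mu]_x _ => h.
have : kappa <= - I / 2.
  by apply: (hk r) => //; apply: ae_imp h => x; rewrite ler_pdivlMr// mulrC.
rewrite ler_pdivlMr//; lra.
Qed.

End energy.

(** * Upper bound of the mass *)

Section mass.
Context {R : realType}.
Local Notation mu := (@lebesgue_measure R).
Local Notation mR := (measurableTypeR R).
Local Notation intble D f := (mu.-integrable D (EFin \o f)).
Implicit Types (u g : R -> R -> R).

Definition cutoff (c s : R) : R := Num.min s c.

(** The primitive of [cutoff c] that vanishes at 0, if [c] is not negative. *)
Definition cutoff_energy (c s : R) : R :=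
  if s <= c then s ^+ 2 / 2 else c * s - c ^+ 2 / 2.

Lemma contraction0_cutoff c : 0 <= c -> contraction0 (cutoff c).
Proof.
move=> c0; split.
- by apply: measurable_minr.
- by rewrite /cutoff min_l.
- move=> a b ab; rewrite /cutoff !minEle.
  by case: (leP a c) => ac; case: (leP b c) => bc; lra.
Qed.

Lemma cutoff_energy_convex c a b :
  cutoff_energy c b - cutoff_energy c a <= cutoff c b * (b - a).
Proof.
rewrite /cutoff_energy /cutoff !minEle.
have h1 := sqr_ge0 (b - a); have h2 := sqr_ge0 (a - c); have h3 := sqr_ge0 (b - c).
case: (leP a c) => ac; case: (leP b c) => bc; rewrite -subr_ge0.
- by rewrite (_ : _ - _ = (b - a) ^+ 2 / 2) ?divr_ge0//; field.
- by rewrite (_ : _ - _ = (a - c) ^+ 2 / 2) ?divr_ge0//; field.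
- rewrite (_ : _ - _ = (c - b) * (a - c) + (b - c) ^+ 2 / 2); last by field.
  by rewrite addr_ge0 ?divr_ge0// mulr_ge0// subr_ge0// ltW.
- by rewrite (_ : _ - _ = 0)//; field.
Qed.

Lemma measurable_cutoff_energy c : measurable_fun [set: mR] (cutoff_energy c).
Proof.
apply: measurable_fun_ifT.
- by apply: measurable_fun_ler.
- by apply: measurable_funM => //; exact: measurable_funX.
- by apply: measurable_funB => //; exact: measurable_funM.
Qed.

Lemma cutoff_energy_ge0 c a : 0 <= c -> 0 <= cutoff_energy c a.
Proof.
move=> c0; rewrite /cutoff_energy; case: (leP a c) => ac; first by rewrite divr_ge0 ?sqr_ge0.
by have := ler_wpM2l c0 (ltW ac); have := sqr_ge0 c; rewrite expr2; lra.
Qed.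

Lemma cutoff_energy_sq c a : 0 <= c -> `|cutoff_energy c a| <= a ^+ 2.
Proof.
move=> c0; rewrite ger0_norm ?cutoff_energy_ge0// /cutoff_energy.
have h := sqr_ge0 a; case: (leP a c) => ac; first by lra.
have := sqr_ge0 (a - c); rewrite sqrrB => h2.
by rewrite mulrC; lra.
Qed.

Lemma cutoff_energy_le c a : 0 <= c -> 0 <= a -> cutoff_energy c a <= c * a.
Proof.
rewrite /cutoff_energy => c0 a0; have h := sqr_ge0 c; case: (leP a c) => ac; last lra.
have := mulr_ge0 c0 a0; have := ler_wpM2r a0 ac; rewrite -expr2; lra.
Qed.

Lemma cutoff_energy_ge c a : 0 <= a -> c * a - c ^+ 2 / 2 <= cutoff_energy c a.
Proof.
rewrite /cutoff_energy => a0; case: (leP a c) => ac; last by [].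
by have := sqr_ge0 (a - c); rewrite sqrrB mulr2n mulrC; lra.
Qed.

(** On non-negative numbers, [cutoff_energy c] divided by [c] is below the
    identity and at distance at most c / 2 from it. *)
Lemma cutoff_energy_mass_le0 (w : R -> R) K N : intble setT w ->
  (forall x, 0 <= w x) ->
  (forall n, (N <= n)%N ->
     \int[mu]_x cutoff_energy n.+1%:R^-1 (w x) <= n.+1%:R^-1 * K) ->
  \int[mu]_x w x <= K.
Proof.
move=> iw w0 h; have mw := intble_meas iw.
pose f n x := n.+1%:R * cutoff_energy n.+1%:R^-1 (w x).
have n0 n : 0 < n.+1%:R :> R by rewrite ltr0n.
have mc n : measurable_fun [set: mR] (fun x => cutoff_energy n.+1%:R^-1 (w x)).
  by apply: measurableT_comp mw; exact: measurable_cutoff_energy.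
have mf n : measurable_fun [set: mR] (f n) by exact: measurable_funM.
have fle n x : 0 <= f n x <= w x.
  have i0 := ltW (invn_gt0 (R := R) n).
  rewrite mulr_ge0 ?cutoff_energy_ge0//= -ler_pdivlMl//.
  exact: cutoff_energy_le.
have lim : \int[mu]_x f n x @[n --> \oo] --> \int[mu]_x w x.
  apply: (@Rintegral_dominated _ _ _ mu setT f w w) => //; last first.
    by move=> n x _; have /andP[f0 fw] := fle n x; rewrite ger0_norm.
  apply: aeW => x _.
  apply: (@squeeze_cvgr _ _ _ _ (fun n => w x - n.+1%:R^-1 / 2) (fun=> w x)); last 2 first.
  - rewrite -[X in _ --> X]subr0 -[X in _ - X](mul0r (2^-1)).
    by apply: cvgB; [exact: cvg_cst|apply: cvgMl; exact: cvg_harmonic].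
  - exact: cvg_cst.
  apply: nearW => n; have /andP[_ ->] := fle n x; rewrite andbT.
  rewrite /f -ler_pdivrMl// (le_trans _ (cutoff_energy_ge _ (w0 x)))//.
  by rewrite le_eqVlt; apply/orP; left; apply/eqP; rewrite mulrBr; ring.
apply: (ler_cvg_to lim (cvg_cst K)); exists N => // n /= Nn.
have ifn : intble setT (f n).
  apply: (intble_le _ _ iw) => // x _.
  by have /andP[f0 fw] := fle n x; rewrite ger0_norm.
rewrite /f RintegralZl_intble// -ler_pdivlMl//; exact: h.
Qed.

Lemma cutoff_energy_mass_le (w : R -> R) K N : intble setT w ->
  {ae mu, forall x, 0 <= w x} ->
  (forall n, (N <= n)%N ->
     \int[mu]_x cutoff_energy n.+1%:R^-1 (w x) <= n.+1%:R^-1 * K) ->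
  \int[mu]_x w x <= K.
Proof.
move=> iw w0 h; have mw := intble_meas iw.
have mn : measurable_fun [set: mR] (fun x => `|w x|) by exact: measurableT_comp.
have -> : \int[mu]_x w x = \int[mu]_x `|w x|.
  by apply: ae_eq_Rintegral => //; apply: ae_imp w0 => x w0 _; rewrite ger0_norm.
apply: (@cutoff_energy_mass_le0 _ K N (intble_norm iw)) => // n Nn.
rewrite -[leLHS](_ : \int[mu]_x cutoff_energy n.+1%:R^-1 (w x) = _); first exact: h.
have mc := measurable_cutoff_energy n.+1%:R^-1.
apply: ae_eq_Rintegral => //; try exact: (measurableT_comp mc).
by apply: ae_imp w0 => x w0 _; rewrite ger0_norm.
Qed.

Section strong.
Variables (u g : R -> R -> R).
Hypotheses (lu : L2loc_L2 u) (lg : L2loc_L2 g) (ug : weak_d_t u g)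
  (uc : L2_continuous u) (uL1 : forall t, 0 <= t -> intble setT (u t))
  (hs : {ae mu, forall r, 0 < r -> steepest (u r) (g r)})
  (u00 : {ae mu, forall x, 0 <= u 0 x}).

Let u2 t : 0 <= t -> intble setT (fun x => u t x ^+ 2).
Proof. by move=> t0; apply: inL2_sq; exact: uc.1. Qed.

(** The cut-off at level 0 keeps only the negative part, whose energy starts
    from 0 and does not increase. *)
Lemma strong_ge0 t : 0 <= t -> {ae mu, forall x, 0 <= u t x}.
Proof.
move=> t0; have mc := measurable_cutoff_energy 0.
have conv := @cutoff_energy_convex 0.
have sq a := @cutoff_energy_sq 0 a (lexx 0).
have := energy_decrease lu lg ug uc (contraction0_cutoff (lexx 0)) conv mc sq hs (lexx 0) t0.
have it r : 0 <= r -> intble setT (fun x => cutoff_energy 0 (u r x)).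
  by move=> r0; exact: (intble_Psi uc mc sq r0).
have -> : \int[mu]_x cutoff_energy 0 (u 0 x) = 0.
  apply: ae_Rintegral0 => //; first exact: intble_meas (it 0 (lexx 0)).
  apply: ae_imp u00 => x x0 _; rewrite /cutoff_energy; case: leP => x1.
    by rewrite (_ : u 0 x = 0) ?expr0n ?mul0r//; apply/eqP; rewrite eq_le x1.
  by rewrite mul0r expr0n mul0r subr0.
have c0 : {ae mu, forall x, setT x -> 0 <= cutoff_energy 0 (u t x)}.
  by apply: aeW => x _; exact: cutoff_energy_ge0.
move=> h; have := Rintegral_ge0_ae0 measurableT (it t t0) c0 h.
apply: ae_imp => x /(_ Logic.I); rewrite /cutoff_energy; case: leP => [x0|/ltW//].
by move/eqP; rewrite mulf_eq0 invr_eq0 pnatr_eq0 orbF sqrf_eq0 => /eqP ->.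
Qed.

Lemma strong_cutoff_energy0 c : 0 <= c ->
  \int[mu]_x cutoff_energy c (u 0 x) <= c * \int[mu]_x u 0 x.
Proof.
move=> c0; have i0 := uL1 (lexx 0).
rewrite -RintegralZl//; apply: ae_le_Rintegral => //.
- apply: (intble_Psi uc (measurable_cutoff_energy c) _ (lexx 0)) => a.
  exact: cutoff_energy_sq.
- exact: intbleZ.
- by apply: ae_imp u00 => x x0 _; exact: cutoff_energy_le.
Qed.

Lemma strong_mass_le t : 0 <= t -> \int[mu]_x u t x <= \int[mu]_x u 0 x.
Proof.
move=> t0; apply: (@cutoff_energy_mass_le _ _ 0 (uL1 t0) (strong_ge0 t0)) => n _.
have n0 := ltW (invn_gt0 (R := R) n).
apply: le_trans (strong_cutoff_energy0 n0).
apply: (energy_decrease lu lg ug uc (contraction0_cutoff n0) _ _ _ hs (lexx 0) t0).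
- exact: cutoff_energy_convex.
- exact: measurable_cutoff_energy.
- by move=> a; exact: cutoff_energy_sq.
Qed.

Lemma strong_sq_decrease s t : 0 <= s -> s <= t ->
  \int[mu]_x (u t x ^+ 2 / 2) <= \int[mu]_x (u s x ^+ 2 / 2).
Proof.
move=> s0 st.
apply: (energy_decrease (beta := id) (Psi := fun a => a ^+ 2 / 2) lu lg ug uc _ _ _ _ hs s0 st).
- by split => // a b ab; rewrite subr_ge0 ab /=.
- by move=> a b; have := sqr_ge0 (b - a); rewrite sqrrB mulrBr -expr2; lra.
- by apply: measurable_funM => //; exact: measurable_funX.
- move=> a; rewrite ger0_norm; last by rewrite mulr_ge0 ?sqr_ge0 ?invr_ge0.
  by rewrite ler_pdivrMr// ler_peMr ?sqr_ge0// ler1n.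
Qed.

(** The norm in L^2 does not increase, hence a solution that is not zero at
    time [t] was not below some fixed level at any earlier time. The cut-off
    at a lower level loses energy at full speed during the whole time
    interval, and its energy divided by the level tends to the mass as the
    level tends to 0. *)
Lemma strong_mass_upper t : 0 <= t -> ~ {ae mu, forall x, u t x = 0} ->
  \int[mu]_x u t x <= \int[mu]_x u 0 x - 2 * t.
Proof.
move=> t0 ut.
pose E := \int[mu]_x (u t x ^+ 2 / 2).
have iE r : 0 <= r -> intble setT (fun x => u r x ^+ 2 / 2).
  move=> r0; have := intbleZ 2^-1 measurableT (u2 r0).
  by apply: eq_integrable => // x _ /=; rewrite mulrC.
have E0 : 0 < E.
  rewrite ltNge; apply/negP => Ele; apply: ut.
  have p0 : {ae mu, forall x, setT x -> 0 <= u t x ^+ 2 / 2}.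
    by apply: aeW => x _; rewrite mulr_ge0 ?sqr_ge0 ?invr_ge0.
  apply: ae_imp (Rintegral_ge0_ae0 measurableT (iE t t0) p0 Ele) => x /(_ Logic.I).
  by move/eqP; rewrite mulf_eq0 invr_eq0 pnatr_eq0 orbF sqrf_eq0 => /eqP.
pose m := \int[mu]_x u 0 x.
have m0 : 0 <= m.
  by apply: ae_Rintegral_ge0 => //; [exact: uL1|apply: ae_imp u00].
(* From rank N on, a non-negative function below 1 / (n + 1) whose mass is at
   most m has an energy of less than E. *)
pose N := Num.truncn (m / E).
apply: (@cutoff_energy_mass_le _ _ N (uL1 t0) (strong_ge0 t0)) => n Nn.
have n0 := invn_gt0 (R := R) n.
have small : n.+1%:R^-1 * m < E.
  rewrite ltr_pdivrMl ?ltr0n// -ltr_pdivrMr//.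
  by apply: (lt_le_trans (truncnS_gt _)); rewrite ler_nat.
apply: (@le_trans _ _ (n.+1%:R^-1 * m - 2 * n.+1%:R^-1 * t)); last first.
  by rewrite le_eqVlt; apply/orP; left; apply/eqP; rewrite /m; ring.
apply: le_trans (lerB (strong_cutoff_energy0 (ltW n0)) (lexx _)).
apply: (energy_decrease_rate lu lg ug uc (contraction0_cutoff (ltW n0)) _ _ _ hs t0).
- exact: cutoff_energy_convex.
- exact: measurable_cutoff_energy.
- by move=> a; apply: cutoff_energy_sq; exact: ltW.
move=> r M r0 rt hM; rewrite leNgt; apply/negP => Mn.
have ur0 := strong_ge0 (ltW r0); have iur := uL1 (ltW r0).
have : E <= \int[mu]_x (n.+1%:R^-1 * u r x).
  apply: (le_trans (strong_sq_decrease (ltW r0) rt)).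
  apply: ae_le_Rintegral => //; [exact: iE (ltW r0)|exact: intbleZ|].
  apply: ae_imp (ae_and hM ur0) => x [hx x0] _.
  move: hx; rewrite /cutoff ge_min => /orP[hx|]; last by rewrite leNgt Mn.
  have h1 := ler_wpM2r x0 (le_trans hx (ltW Mn)); have h2 := sqr_ge0 (u r x).
  by rewrite -expr2 in h1; apply: le_trans h1; move: h2; lra.
rewrite RintegralZl// => h.
have d := ler_wpM2l (ltW n0) (strong_mass_le (ltW r0)).
by have := le_lt_trans (le_trans h d) small; rewrite ltxx.
Qed.

End strong.
End mass.

(** * The mass of a strong solution *)

Section strong_mass.
Context {R : realType}.
Local Notation mu := (@lebesgue_measure R).
Local Notation mR := (measurableTypeR R).
Local Notation intble D f := (mu.-integrable D (EFin \o f)).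
Implicit Types (u g z : R -> R -> R).

Lemma intble_ae_eq (f h : R -> R) : measurable_fun [set: mR] f -> intble setT h ->
  {ae mu, forall x, f x = h x} -> intble setT f.
Proof.
move=> mf ih fh; have mh := intble_meas ih.
apply: intble_lty => //.
rewrite [X in (X < _)%E](_ : _ = \int[mu]_x (`|h x|)%:E)%E.
  by have /integrableP[_] := ih.
apply: ae_eq_integral => //; try by apply/measurable_EFinP; exact: measurableT_comp.
by apply: ae_imp fh => x -> _.
Qed.

Lemma Rintegral_windows (w : R -> R) : intble setT w ->
  \int[mu]_(x in `]- n%:R, n%:R]) w x @[n --> \oo] --> \int[mu]_x w x.
Proof.
move=> iw; have mw := intble_meas iw.
rewrite (_ : (fun n => _) = fun n : nat => \int[mu]_x (w x * \1_(`]- n%:R, n%:R]) x)); last first.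
  by apply/funext => n; rewrite Rintegral_indic.
have m1 (n : nat) : measurable_fun [set: mR] (\1_(`]- n%:R, n%:R]) : R -> R).
  exact: measurable_indic.
apply: (@Rintegral_dominated _ _ _ mu setT _ w (fun x => `|w x|)) => //.
- by move=> n; exact: measurable_funM.
- apply: aeW => x _; apply: cvg_near_cst.
  exists (Num.truncn `|x|).+1 => // n /= xn.
  have : `|x| < n%:R.
    by apply: (lt_le_trans (truncnS_gt _)); rewrite ler_nat.
  rewrite ltr_norml indicE => /andP[x1 x2].
  by rewrite mem_set ?mulr1//= in_itv/= x1 ltW.
- exact: intble_norm.
- move=> n x _; rewrite normrM ler_piMr//.
  by rewrite ger0_norm// indicE lern1; case: (_ \in _).
Qed.

(** At most 1 flows out through each end of an interval. *)
Lemma flux_mass_lower u g z t : L2loc_L2 u -> L2loc_L2 g -> weak_d_t u g ->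
  L2_continuous u -> (forall r, 0 <= r -> intble setT (u r)) ->
  {ae mu, forall r, 0 < r -> good_flux (z r) (g r)} -> 0 <= t ->
  \int[mu]_x u 0 x - 2 * t <= \int[mu]_x u t x.
Proof.
move=> lu lg ug uc uL1 hz t0.
have c0 := Rintegral_windows (uL1 0 (lexx 0)).
have ct := Rintegral_windows (uL1 t t0).
apply: (ler_cvg_to (cvgB c0 (cvg_cst (2 * t))) ct); apply: nearW => n.
have nn : - n%:R <= n%:R :> R by rewrite ge0_cp.
have mA : measurable (`]0, t] : set mR) by exact: measurable_itv.
rewrite !fctE lerBlDr -lerBlDl.
rewrite -opprB (time_increment lu lg ug uc (lexx 0) t0 nn).
rewrite lerNl -[X in _ * X]subr0 -mulNr -(fine_lebesgue_itv t0) -(Rintegral_cst mu mA).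
apply: ae_le_Rintegral => //; first exact: intble_cst_itv.
  have l := locally_integrable_section_itv (- n%:R) n%:R (box_intble_after0 lg).
  exact: (intble_itv mA l (@subset_itv_oc_cc _ _ 0 t)).
apply: ae_imp hz => r hr; rewrite /= in_itv/= => /andP[r0 _].
have [_ Z1 _ _ inc] := hr r0.
rewrite /after0 (ltW r0) -(inc _ _ nn).
have := Z1 n%:R; have := Z1 (- n%:R); rewrite !ler_norml => /andP[? ?] /andP[? ?].
lra.
Qed.

(** A solution that is zero at time [t] has lost all its mass, which by
    [flux_mass_lower] takes at least half of the initial mass as time;
    otherwise the two bounds agree. *)
Lemma strong_solution_mass (f : R -> R) u (v : R -> R -> R) :
  tvf_strong_solution f u -> (forall t, 0 <= t -> inL1 (v t)) ->
  (forall t, 0 <= t -> {ae mu, forall x, v t x = u t x}) ->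
  measurable_fun [set: mR] f ->
  {ae mu, forall x, 0 <= f x} ->
  forall t, 0 <= t -> [/\ intble setT (u t), {ae mu, forall x, 0 <= u t x} &
    \int[mu]_x u t x = Num.max (\int[mu]_x f x - 2 * t) 0].
Proof.
move=> [u0f [Du [z [g [[hBV [M hM]] [lu lg ug uc] [mz z1 cz] xz hE]]]]] vL1 vu mf f0 t t0.
have uL1 r : 0 <= r -> intble setT (u r).
  move=> r0; apply: (intble_ae_eq _ (inL1_intble (vL1 r r0))).
    by apply: inL2_measurable; exact: uc.1.
  by apply: ae_imp (vu r r0) => x ->.
have hz := ae_good_flux mz z1 cz lg xz.
have uL2 r : 0 <= r -> intble setT (fun x => u r x ^+ 2).
  by move=> r0; apply: inL2_sq; exact: uc.1.
have hs := ae_steepest lu lg uL1 uL2 hBV hM hz hE.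
have u00 : {ae mu, forall x, 0 <= u 0 x}.
  by apply: ae_imp (ae_and u0f f0) => x [->].
have m0 : \int[mu]_x u 0 x = \int[mu]_x f x.
  apply: ae_eq_Rintegral => //; first exact: intble_meas (uL1 0 (lexx 0)).
  by apply: ae_imp u0f => x ->.
have ut0 := strong_ge0 lu lg ug uc hs u00 t0.
split => //; first exact: uL1.
have low := flux_mass_lower lu lg ug uc uL1 hz t0; rewrite m0 in low.
have mt0 : 0 <= \int[mu]_x u t x.
  by apply: ae_Rintegral_ge0 => //; [exact: uL1|apply: ae_imp ut0].
have [uz|unz] := pselect {ae mu, forall x, u t x = 0}.
  have e : \int[mu]_x u t x = 0.
    apply: ae_Rintegral0 => //; first exact: intble_meas (uL1 t t0).
    by apply: ae_imp uz => x ->.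
  by rewrite e max_r// -e.
have up := strong_mass_upper lu lg ug uc uL1 hs u00 t0 unz; rewrite m0 in up.
have e : \int[mu]_x u t x = \int[mu]_x f x - 2 * t by apply/eqP; rewrite eq_le up.
by rewrite max_l -e.
Qed.

End strong_mass.

(** * Charges with a density *)

Section densities.
Context {R : realType}.
Local Notation mu := (@lebesgue_measure R).
Local Notation mR := (measurableTypeR R).
Local Notation intble D f := (mu.-integrable D (EFin \o f)).
Implicit Types (m : {finite_measure set mR -> \bar R}).

Lemma density_of_finite_measure m : m `<< mu -> exists p : R -> R,
  [/\ intble setT p,
    forall A : set mR, measurable A -> m A = (\int[mu]_(x in A) (p x)%:E)%E &
    forall (phi : R -> R) (C : R), measurable_fun [set: mR] phi ->
      (forall x, `|phi x| <= C) -> \int[m]_x phi x = \int[mu]_x (phi x * p x)].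
Proof.
move=> mmu; pose q := Radon_Nikodym (charge_of_finite_measure m) mu.
have qf x : q x \is a fin_num by exact: Radon_Nikodym_fin_num.
have e : EFin \o (fine \o q) = q by apply/funext => x /=; rewrite fineK.
exists (fine \o q); split.
- by rewrite e; exact: Radon_Nikodym_integrable.
- move=> A mA; rewrite -[LHS]/(charge_of_finite_measure m A).
  rewrite (@Radon_Nikodym_integral _ _ _ (charge_of_finite_measure m) mu A)//.
  by apply: eq_integral => x _; rewrite fineK.
- move=> phi C mphi phiC; rewrite /Rintegral; congr fine.
  have ip := finite_intble_bounded m mphi phiC.
  rewrite -(Radon_Nikodym_change_of_variables mmu measurableT ip).
  by apply: eq_integral => x _; rewrite EFinM fineK.
Qed.

(** The two parts of the Jordan decomposition have densities, and the
    difference of these is [q] almost everywhere. *)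
Lemma charge_integral_density (q : R -> R) (iq : intble setT q) (phi : R -> R) C :
  measurable_fun [set: mR] phi -> (forall x, `|phi x| <= C) ->
  charge_integral (induced_charge iq : realCharge R) phi =
  (\int[mu]_x (phi x * q x))%:E.
Proof.
move=> mphi phiC; set D : realCharge R := induced_charge iq.
have dD : D `<< mu.
  move=> A hA B mB BA; rewrite /D /= /induced_charge.
  apply: null_set_integral => //; last exact: hA.
  exact: measurable_funTS (measurable_int _ iq).
rewrite (charge_integralE D mphi phiC).
have [p [ip pA pE]] := density_of_finite_measure (jordan_pos_dominates (hahn D) dD).
have [n [inn nA nE]] := density_of_finite_measure (jordan_neg_dominates (hahn D) dD).
rewrite (pE phi C mphi phiC) (nE phi C mphi phiC).
have bm f : intble setT f -> intble setT (fun x => phi x * f x).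
  by move=> fi; exact: (intble_bounded_mul (C := C)).
rewrite -RintegralB//; try exact: bm.
congr EFin; apply: ae_eq_Rintegral => //.
- by apply: intble_meas; apply: intbleB => //; exact: bm.
- by apply: intble_meas; exact: bm.
have ipn : intble setT (fun x => p x - n x) by exact: intbleB.
have : ae_eq mu setT (EFin \o (fun x => p x - n x)) (EFin \o q).
  apply: integral_ae_eq => //; first exact: measurable_int iq.
  move=> A _ mA; rewrite -[RHS]/(D A).
  have -> : D A = (jordan_pos (hahn D) A - jordan_neg (hahn D) A)%E.
    by rewrite [LHS](jordan_decomp (hahn D) mA)// /cadd /= cscaleN1.
  rewrite [jordan_pos _ A]pA// [jordan_neg _ A]nA// -integralB//; try exact: (integrableS measurableT mA (@subsetT _ _)).
apply: ae_imp => x /= /(_ Logic.I) [e] _.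
by rewrite -mulrBr e.
Qed.

End densities.

(** * Moving averages *)

Section averages.
Context {R : realType}.
Local Notation mu := (@lebesgue_measure R).
Local Notation mR := (measurableTypeR R).
Local Notation intble D f := (mu.-integrable D (EFin \o f)).
Local Notation plane_intble F :=
  ((mu \x mu)%E.-integrable [set: mR * mR] (fun p => (F p.1 p.2)%:E)).
Implicit Types (f Z phi : R -> R).

Definition average (h : R) f (x : R) : R := h^-1 * \int[mu]_(y in `]x, x + h]) f y.

Lemma window_ge0 (h x s : R) : 0 <= window h x s.
Proof. by rewrite windowE ler0n. Qed.

Lemma window_section_intble (h c s : R) : intble setT (fun x => c * window h x s).
Proof.
rewrite (windowL_int h (fun=> c) s).
have mI : measurable (`[s - h, s[ : set mR) by exact: measurable_itv.
apply: (intble_supp mI).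
  by move=> x xI; rewrite indicE memNset// mulr0.
apply: (@intble_le _ _ _ mu _ _ (fun=> `|c|)) => //.
- by apply: measurable_funTS; apply: measurable_funM => //; exact: measurable_indic.
- exact: (intble_itv mI (locally_integrable_cst `|c|) (@subset_itv_co_cc _ _ _ _)).
- by move=> x _; rewrite normrM ler_piMr// ger0_norm// indicE lern1.
Qed.

Lemma window_section (h c s : R) : 0 < h -> \int[mu]_x (c * window h x s) = c * h.
Proof.
move=> h0; rewrite (@windowL_int _ h (cst c)) Rintegral_indic Rintegral_cst//.
by rewrite fine_lebesgue_itvco ?subKr// gerBl ltW.
Qed.

Lemma window_plane_intble h f Z C : 0 < h -> intble setT f ->
  measurable_fun [set: mR] Z -> (forall x, `|Z x| <= C) ->
  plane_intble (fun s x => f s * (Z x * window h x s)).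
Proof.
move=> h0 fi mZ ZC; have mf := intble_meas fi.
have mW : measurable_fun [set: mR * mR] (fun p => f p.1 * (Z p.2 * window h p.2 p.1)).
  apply: measurable_funM; first exact: (prod_measurable1 (f := f : mR -> R)).
  apply: measurable_funM; first exact: (prod_measurable2 (f := Z : mR -> R)).
  exact: (prod_measurable_swap (f := window h : mR -> mR -> R) (measurable_window h)).
apply: (prod_intble_lty (f := fun s x : mR => f s * (Z x * window h x s))) => //.
have fC := intbleZ (C * h) measurableT (intble_norm fi).
apply: (@le_lt_trans _ _ (\int[mu]_s (C * h * `|f s|)%:E)%E); last first.
  by rewrite -(EFin_Rintegral measurableT fC) ltry.
apply: ge0_le_integral => //.
- by move=> s _; apply: integral_ge0 => x _; rewrite lee_fin.
- have mn : measurable_fun [set: mR * mR] (fun p => (`|f p.1 * (Z p.2 * window h p.2 p.1)|)%:E).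
    by apply/measurable_EFinP; exact: measurableT_comp.
  exact: (measurable_fun_fubini_tonelli_F (m2 := mu)
    (fun p : mR * mR => (`|f p.1 * (Z p.2 * window h p.2 p.1)|)%:E)).
- by apply: measurable_int fC.
move=> s _.
have wi := window_section_intble h (C * `|f s|) s.
have -> : C * h * `|f s| = C * `|f s| * h by ring.
rewrite -(window_section _ s h0) (EFin_Rintegral measurableT wi).
apply: ge0_le_integral => //.
- apply/measurable_EFinP; apply: measurableT_comp => //.
  exact: (measurable_section1 (f := fun s x : mR => f s * (Z x * window h x s))).
- exact: measurable_int wi.
move=> x _; rewrite lee_fin !normrM [C * _]mulrC -mulrA ler_wpM2l//.
by rewrite [X in _ * X]ger0_norm ?window_ge0// ler_wpM2r ?window_ge0.
Qed.

Lemma window_fubini h f Z C : 0 < h -> intble setT f ->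
  measurable_fun [set: mR] Z -> (forall x, `|Z x| <= C) ->
  intble setT (fun x => Z x * average h f x) /\
  \int[mu]_x (Z x * average h f x) =
    h^-1 * \int[mu]_s (f s * \int[mu]_(x in `[s - h, s[) Z x).
Proof.
move=> h0 fi mZ ZC; have iW := window_plane_intble h0 fi mZ ZC.
have isw := intble_integral_section (f := fun x s : mR => f s * (Z x * window h x s))
  (prod_intble_swap (f := fun s x : mR => f s * (Z x * window h x s)) iW).
have e x : Z x * average h f x = h^-1 * \int[mu]_s (f s * (Z x * window h x s)).
  rewrite /average mulrCA; congr (_ * _).
  rewrite -Rintegral_indic.
  have i1 : intble setT (fun s => f s * \1_(`]x, x + h]) s).
    apply: (intble_le _ _ (intble_norm fi)) => //.
      by apply: measurable_funM; [exact: intble_meas fi|exact: measurable_indic].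
    move=> s _; rewrite normrM ler_piMr//.
    by rewrite ger0_norm// indicE lern1; case: (_ \in _).
  rewrite -(RintegralZl _ measurableT i1).
  by apply: eq_Rintegral => s _; rewrite /window mulrCA.
rewrite (_ : (fun x => Z x * _) = fun x => h^-1 * \int[mu]_s (f s * (Z x * window h x s))); last first.
  by apply/funext.
split; first exact: intbleZ.
rewrite RintegralZl//; congr (_ * _).
rewrite -(Rfubini (f := fun s x : mR => f s * (Z x * window h x s)) iW).
apply: eq_Rintegral => s _.
rewrite -Rintegral_indic -windowL_int.
rewrite RintegralZl//.
rewrite windowL_int.
have mI : measurable (`[s - h, s[ : set mR) by exact: measurable_itv.
apply: (intble_le (g := fun x => C * window h x s)) => //.
- by apply: measurable_funM => //; exact: measurable_indic.
- exact: window_section_intble.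
move=> x _; rewrite normrM [leRHS](congr1 (@^~ x) (windowL_int h (fun=> C) s)).
by rewrite [X in _ * X]ger0_norm// ler_wpM2r.
Qed.

Lemma average_intble h f : 0 < h -> intble setT f -> intble setT (average h f) /\
  \int[mu]_x average h f x = \int[mu]_x f x.
Proof.
move=> h0 fi; have n1 (x : R) : `|(1 : R)| <= 1 by rewrite normr1.
have [i e] := window_fubini h0 fi (measurable_cst (1 : R)) n1.
have E : (fun x => 1 * average h f x) = average h f by apply/funext => x; rewrite mul1r.
rewrite !E in i e; split => //; rewrite e.
rewrite -RintegralZl//; last first.
  have : intble setT (fun s => h * f s) by exact: intbleZ.
  apply: eq_integrable => // s _ /=; rewrite Rintegral_cst//.
  by rewrite fine_lebesgue_itvco ?subKr ?mul1r 1?mulrC// gerBl ltW.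
apply: eq_Rintegral => s _; rewrite Rintegral_cst//.
rewrite fine_lebesgue_itvco ?subKr ?mul1r; last by rewrite gerBl ltW.
by rewrite mulrCA mulVf ?mulr1// gt_eqF.
Qed.

End averages.

(** * From BV data to integrable data *)

Section density.
Context {R : realType}.
Local Notation mu := (@lebesgue_measure R).
Local Notation mR := (measurableTypeR R).
Local Notation intble D f := (mu.-integrable D (EFin \o f)).
Implicit Types (f phi : R -> R).

Lemma test_function_smooth phi : test_function phi -> smooth phi.
Proof. by case. Qed.

Lemma test_function_derive1 phi : test_function phi -> test_function (derive1 phi).
Proof.
move=> [d [K cK K0]]; split; first by move=> n x; rewrite -derive1Sn; exact: d.
exists K => // x Kx; rewrite derive1E.
rewrite -(derive_cst (0 : R) x 1); apply: near_eq_derive.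
have oK : open (~` K) by apply: closed_openC; exact: compact_closed.
near do apply: K0.
exact: open_nbhs_nbhs.
Unshelve. all: by end_near. Qed.

Lemma test_function_bounded phi : test_function phi -> exists C, forall x, `|phi x| <= C.
Proof.
move=> tf; have cp := smooth_continuous (test_function_smooth tf); have [_ [K cK K0]] := tf.
have := compact_bounded (continuous_compact (continuous_subspaceT cp) cK).
move=> [M [_ MA]]; exists (Num.max (M + 1) 0) => x.
have [Kx|Kx] := pselect (K x); last by rewrite K0// normr0 le_max lexx orbT.
by rewrite le_max MA ?ltrDl//; exists x.
Qed.

Lemma test_function_ftc phi a b : test_function phi -> a < b ->
  \int[mu]_(x in `[a, b[) derive1 phi x = phi b - phi a.
Proof.
move=> /test_function_smooth sf ab.
rewrite Rintegral_itv_bndo_bndc ?smooth_ftc//.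
apply: integrableS (smooth_derive1_intble a b sf) => //.
exact: subset_itv_co_cc.
Qed.

(** The derivative has the density (f (x + h) - f x) / h. *)
Lemma average_inBV h f : 0 < h -> intble setT f -> inBV (average h f).
Proof.
move=> h0 fi.
have iq : intble setT (fun x => h^-1 * (f (x + h) - f x)).
  by apply: intbleZ => //; exact: intble_shiftB.
exists (induced_charge iq : realCharge R); split.
  by apply: intble_locally; have [] := average_intble h0 fi.
move=> phi tf.
have [C hC] := test_function_bounded tf.
have td := test_function_derive1 tf; have [C' hC'] := test_function_bounded td.
have mp : measurable_fun [set: mR] phi.
  exact: smooth_measurable (test_function_smooth tf).
have md : measurable_fun [set: mR] (derive1 phi).
  exact: smooth_measurable (test_function_smooth td).
have [iw ew] := window_fubini h0 fi md hC'.
rewrite (charge_integral_density iq mp hC).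
have -> : (\int[mu]_x (average h f x * derive1 phi x)%:E =
    (\int[mu]_x (derive1 phi x * average h f x))%:E)%E.
  by rewrite (EFin_Rintegral measurableT iw); apply: eq_integral => x _; rewrite mulrC.
rewrite -EFinN ew; congr EFin.
have i1 : intble setT (fun s => phi s * f s) by exact: (intble_bounded_mul (C := C)).
have i2 : intble setT (fun s => phi (s - h) * f s).
  apply: (intble_bounded_mul (C := C)) => //.
  exact: (measurableT_comp mp (measurable_shift (- h))).
have i3 : intble setT (fun s => phi s * f (s + h)).
  by apply: (intble_bounded_mul (C := C)) => //; exact: intble_shift.
have -> : \int[mu]_s (f s * \int[mu]_(x in `[s - h, s[) derive1 phi x) =
    \int[mu]_s (phi s * f s) - \int[mu]_s (phi (s - h) * f s).
  rewrite -RintegralB//; apply: eq_Rintegral => s _.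
  by rewrite test_function_ftc ?gtrBl//; ring.
have <- : \int[mu]_s (phi s * f (s + h)) = \int[mu]_s (phi (s - h) * f s).
  rewrite -(Rintegral_shift h i2); apply: eq_Rintegral => s _.
  by rewrite addrK.
rewrite -opprB mulrN -RintegralB// -RintegralZl//; last exact: intbleB.
by congr (- _); apply: eq_Rintegral => s _; ring.
Qed.

Lemma average_ge0 h f x : 0 < h -> (forall y, 0 <= f y) -> 0 <= average h f x.
Proof.
move=> h0 f0; apply: mulr_ge0; first by rewrite invr_ge0 ltW.
by apply: Rintegral_ge0 => y _; exact: f0.
Qed.

(** The averages converge at the Lebesgue points and have the same mass as
    [f], so they converge in L^1: the integral of |a - f| is twice the
    integral of the positive part of f - a, which lies below [f]. *)
Lemma average_cvg f : intble setT f -> (forall x, 0 <= f x) ->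
  \int[mu]_x `|average n.+1%:R^-1 f x - f x| @[n --> \oo] --> (0 : R).
Proof.
move=> fi f0.
pose a n := average n.+1%:R^-1 f.
have n0 n : 0 < n.+1%:R^-1 :> R by exact: invn_gt0.
have ia n : intble setT (a n) by have [] := average_intble (n0 n) fi.
have ea n : \int[mu]_x a n x = \int[mu]_x f x by have [] := average_intble (n0 n) fi.
have a0 n x : 0 <= a n x by exact: average_ge0.
pose p n x := Num.max (f x - a n x) 0.
have p0 n x : 0 <= p n x by rewrite le_max lexx orbT.
have pf n x : p n x <= f x by rewrite ge_max f0 andbT gerBl.
have mp n : measurable_fun [set: mR] (p n).
  by apply: measurable_maxr => //; apply: measurable_funB; [exact: intble_meas fi|exact: intble_meas (ia n)].
have ip n : intble setT (p n).
  by apply: (intble_le _ _ fi) => // x _; rewrite ger0_norm.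
have e n : \int[mu]_x `|a n x - f x| = 2 * \int[mu]_x p n x.
  transitivity (\int[mu]_x ((a n x - f x) + 2 * p n x)).
    apply: eq_Rintegral => x _; rewrite /p.
    by have [h|h] := leP (f x - a n x) 0; [rewrite ger0_norm|rewrite ltr0_norm]; lra.
  rewrite RintegralD//; last 2 first.
    exact: intbleB.
    exact: intbleZ.
  by rewrite RintegralB// ea subrr add0r RintegralZl.
have lim : \int[mu]_x p n x @[n --> \oo] --> \int[mu]_x (cst 0 x).
  apply: (@Rintegral_dominated _ _ _ mu setT p (cst 0) f) => //; last first.
    by move=> n x _; rewrite ger0_norm.
  apply: ae_imp (lebesgue_differentiation (intble_locally fi)) => x hx _.
  have h1 := lebesgue_avg (intble_locally fi) hx.
  have h2 : `|f x - a n x| @[n --> \oo] --> (0 : R).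
    rewrite -[X in _ --> X](normr0 R) -(subrr (f x)).
    apply: cvg_norm; apply: cvgB; first exact: cvg_cst.
    by rewrite /a /average; under eq_fun do rewrite invrK.
  apply: (squeeze_cvgr _ (cvg_cst 0) h2).
  by apply: nearW => n; rewrite p0 /= /p ge_max ler_norm /=.
under eq_fun do rewrite e.
rewrite Rintegral_cst// mul0r in lim.
have -> : (0 : R) = 2 * 0 by rewrite mulr0.
exact: cvgMr.
Qed.

Lemma L1norm_Rintegral f : intble setT f -> L1norm f = (\int[mu]_x `|f x|)%:E.
Proof.
by move=> fi; rewrite /L1norm Lnorm1 (EFin_Rintegral measurableT (intble_norm fi)).
Qed.

Lemma intble_inL1 f : intble setT f -> inL1 f.
Proof. by move=> fi; apply/Lfun1_integrable. Qed.

Lemma Rintegral_eq0_ge0 f : intble setT f -> (forall x, 0 <= f x) ->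
  (forall e, 0 < e -> \int[mu]_x f x <= e) -> {ae mu, forall x, f x = 0}.
Proof.
move=> fi f0 h; have f00 : {ae mu, forall x, setT x -> 0 <= f x} by exact: aeW.
have i0 : \int[mu]_x f x <= 0 by apply/ler_addgt0Pr => e e0; rewrite add0r; exact: h.
by apply: ae_imp (Rintegral_ge0_ae0 measurableT fi f00 i0) => x; exact.
Qed.

(** The averages of the datum are in BV(R) and have its mass. The mass is
    continuous in L^1 and non-negative functions are closed in L^1, so both
    conclusions pass to the limit. *)
Lemma semigroup_mass (S : R -> (R -> R) -> (R -> R)) (u0 : R -> R) t :
  tvf_semigroup S -> inL1 u0 -> {ae mu, forall x, 0 <= u0 x} -> 0 <= t ->
  {ae mu, forall x, 0 <= S t u0 x} /\
  \int[mu]_x S t u0 x = Num.max (\int[mu]_x u0 x - 2 * t) 0.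
Proof.
move=> [SL1 Scont Sstrong] u0L1 u00 t0.
have iu0 := inL1_intble u0L1; have mu0 := intble_meas iu0.
pose f x := `|u0 x|.
have fi : intble setT f by exact: intble_norm.
have fu : {ae mu, forall x, f x = u0 x}.
  by apply: ae_imp u00 => x x0; rewrite /f ger0_norm.
have ef : \int[mu]_x f x = \int[mu]_x u0 x.
  apply: ae_eq_Rintegral => //; first exact: intble_meas fi.
  by apply: ae_imp fu => x ->.
have iS : intble setT (S t u0) by apply: inL1_intble; exact: SL1.
pose K := Num.max (\int[mu]_x u0 x - 2 * t) 0.
(* Functions close to the solution, with the expected sign and mass. *)
have approx e : 0 < e -> exists v, [/\ intble setT v, {ae mu, forall x, 0 <= v x},
    \int[mu]_x v x = K & \int[mu]_x `|v x - S t u0 x| <= e].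
  move=> e0; have [d d0 hd] := Scont t u0 t0 u0L1 e e0.
  have /cvgrPdist_lt /(_ d d0) [n _ /(_ n (leqnn n))] := average_cvg fi (fun x => normr_ge0 _).
  rewrite /= sub0r normrN ger0_norm; last by apply: Rintegral_ge0 => x _; exact: normr_ge0.
  have n0 : 0 < n.+1%:R^-1 :> R by exact: invn_gt0.
  set g := average n.+1%:R^-1 f => gd.
  have [ig eg] := average_intble n0 fi; rewrite -/g in ig eg.
  have g0 x : 0 <= g x by apply: average_ge0 => // y; exact: normr_ge0.
  have gL1 := intble_inL1 ig.
  have iSg : intble setT (S t g) by apply: inL1_intble; exact: SL1.
  have [w sw wS] := Sstrong g (average_inBV n0 fi) gL1.
  have SgL1 r : 0 <= r -> inL1 (S r g) by move=> r0; exact: SL1.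
  have gae : {ae mu, forall x, 0 <= g x} by exact: aeW.
  have [iw w0 ew] := strong_solution_mass (v := fun r => S r g) sw SgL1 wS
    (intble_meas ig) gae t0.
  exists (S t g); split => //.
  - by apply: ae_imp (ae_and w0 (wS t t0)) => x [h ->].
  - rewrite /K -ef -eg -ew; apply: ae_eq_Rintegral => //.
    + exact: intble_meas iSg.
    + exact: intble_meas iw.
    + by apply: ae_imp (wS t t0) => x ->.
  - have igu : intble setT (fun x => g x - u0 x) by exact: intbleB.
    have iSS : intble setT (fun x => S t g x - S t u0 x) by exact: intbleB.
    apply: ltW; rewrite -lte_fin -(L1norm_Rintegral iSS); apply: hd => //.
    rewrite (L1norm_Rintegral igu) lte_fin.
    rewrite [ltLHS](_ : _ = \int[mu]_x `|g x - f x|)//.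
    apply: ae_eq_Rintegral => //.
    + exact: intble_meas (intble_norm igu).
    + exact: intble_meas (intble_norm (intbleB measurableT ig fi)).
    + by apply: ae_imp fu => x ->.
split.
  pose neg x := Num.max (- S t u0 x) 0.
  have n0 x : 0 <= neg x by rewrite le_max lexx orbT.
  have ineg : intble setT neg.
    apply: (intble_le _ _ (intble_norm iS)) => //.
      apply: measurable_maxr => //; exact: measurableT_comp (intble_meas iS).
    by move=> x _; rewrite ger0_norm// ge_max normr_ge0 andbT -normrN ler_norm.
  have : {ae mu, forall x, neg x = 0}.
    apply: Rintegral_eq0_ge0 => // e /approx[v [iv v0 _ hv]].
    apply: le_trans hv; apply: ae_le_Rintegral => //.
      by apply: intble_norm; exact: intbleB.
    apply: ae_imp v0 => x x0 _; rewrite ge_max normr_ge0 andbT.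
    by apply: le_trans (ler_norm _); rewrite lerDr.
  by apply: ae_imp => x e; move: (le_max (- S t u0 x) (- S t u0 x) 0); rewrite -/(neg x) e lexx oppr_le0 => ->.
apply/eqP; rewrite -/K -subr_eq0 -normr_le0; apply/ler_addgt0Pr => e /approx[v [iv _ <- hv]].
rewrite add0r distrC -RintegralB//; apply: le_trans hv.
by apply: le_normr_Rintegral => //; exact: intbleB.
Qed.

End density.

(** * The extinction time *)

Theorem proposition2p10 (R : realType) (u0 : R -> R) (u : R -> R -> R)
    (u0_L1 : inL1 u0)
    (u0_ge0 : {ae leb R, forall x, 0 <= u0 x})
    (u0_supp : compactly_supported u0)
    (u_sol : tvf_solution u0 u) :
  extinction_time u = (2^-1%:E * \int[leb R]_x (u0 x)%:E)%E /\
  forall t : R, 0 <= t -> (t%:E <= extinction_time u)%E ->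
    (\int[leb R]_x (u t x)%:E = \int[leb R]_x (u0 x)%:E - (2 * t)%:E)%E /\
    (\int[leb R]_x (u0 x)%:E - (2 * t)%:E = 2%:E * (extinction_time u - t%:E))%E.
Proof.
have iu0 := inL1_intble u0_L1.
have [S hS uS] := u_sol.
rewrite -(EFin_Rintegral measurableT iu0); set m := (\int[leb R]_x u0 x)%R.
have iu t : 0 <= t -> (leb R).-integrable setT (EFin \o u t).
  by move=> t0; apply: inL1_intble; have [] := uS t t0.
have mass t : 0 <= t -> {ae leb R, forall x, 0 <= u t x} /\
    \int[leb R]_x u t x = Num.max (m - 2 * t) 0.
  move=> t0; have [S0 Sm] := semigroup_mass hS u0_L1 u0_ge0 t0.
  have [_ e] := uS t t0; split; first by apply: ae_imp (ae_and S0 e) => x [h ->].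
  rewrite /m -Sm; apply: ae_eq_Rintegral => //.
  - exact: intble_meas (iu t t0).
  - by apply: intble_meas; apply: inL1_intble; have [h _ _] := hS; exact: h.
  - by apply: ae_imp e => x ->.
have m0 : 0 <= m by apply: ae_Rintegral_ge0 => //; apply: ae_imp u0_ge0.
have T : extinction_time u = (m / 2)%:E.
  apply/eqP; rewrite eq_le; apply/andP; split.
    apply: ereal_inf_lbound; exists (m / 2) => //=; split; first by rewrite divr_ge0.
    have h0 : 0 <= m / 2 by rewrite divr_ge0.
    have [p e] := mass _ h0.
    have p' : {ae leb R, forall x, setT x -> 0 <= u (m / 2) x} by apply: ae_imp p.
    have e' : \int[leb R]_x u (m / 2) x <= 0.
      by rewrite e (_ : m - 2 * (m / 2) = 0) ?maxxx//; field.
    by apply: ae_imp (Rintegral_ge0_ae0 measurableT (iu _ h0) p' e') => x; exact.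
  apply: le_ereal_inf_tmp => _ [t [t0 ut0] <-].
  have [_ e] := mass t t0.
  have z : \int[leb R]_x u t x = 0.
    apply: ae_Rintegral0 => //; first exact: intble_meas (iu t t0).
    by apply: ae_imp ut0 => x ->.
  rewrite lee_fin ler_pdivrMr// mulrC -subr_le0 -[leRHS]z e.
  by rewrite le_max lexx.
rewrite T; split; first by rewrite -EFinM mulrC.
move=> t t0; rewrite lee_fin ler_pdivlMr// mulrC => tm.
have [_ e] := mass t t0.
rewrite -(EFin_Rintegral measurableT (iu t t0)) e max_l ?subr_ge0//.
split; first by rewrite EFinB.
by rewrite -!EFinB -EFinM; congr EFin; field.
Qed.
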